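(* Let $T>0$ and $x\in\mathbb{R}^d$. Let $b,b_n:[0,T]\times\mathbb{R}^d\times\mathcal{P}_2(\mathbb{R}^d)\to\mathbb{R}^d$ and $\sigma,\sigma_n:[0,T]\times\mathbb{R}^d\times\mathcal{P}_2(\mathbb{R}^d)\to\mathbb{R}^d\otimes\mathbb{R}^d$ ($n\in\mathbb{N}$) be such that each of the pairs $(\beta,s)=(b,\sigma)$ and $(\beta,s)=(b_n,\sigma_n)$ satisfies the following: $\beta$ and $s$ are Borel measurable; there is a constant $C'>0$ with $|\beta(t,y,\mu)|+|s(t,y,\mu)|\le C'(1+|y|)$ for all $(t,y,\mu)$; and there is a constant $L>0$ with $$|\beta(t,y,\mu)-\beta(t,y',\mu')|\le L[|y-y'|+W_2(\mu,\mu')],\qquad |s(t,y,\mu)-s(t,y',\mu')|\le L[|y-y'|+W_2(\mu,\mu')]$$ for all $t\in[0,T]$, $y,y'\in\mathbb{R}^d$, $\mu,\mu'\in\mathcal{P}_2(\mathbb{R}^d)$. Suppose further that: (i) there exists $C>0$ such that for all $n\in\mathbb{N}$, $y\in\mathbb{R}^d$ and $\mu\in\mathcal{P}_2(\mathbb{R}^d)$, $\sup_{t\le T}\left(|b_n(t,y,\mu)|+|\sigma_n(t,y,\mu)|\right)\le C(1+|y|)$; (ii) for each compact set $K\subset\mathbb{R}^d$, $$\lim_{n\to\infty}\ \sup_{t\le T}\ \sup_{y\in K}\ \sup_{\mu\in\mathcal{P}_2(\mathbb{R}^d)}\left(|b_n(t,y,\mu)-b(t,y,\mu)|+|\sigma_n(t,y,\mu)-\sigma(t,y,\mu)|\right)=0.$$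 Let $X$ and $X^n$ be respectively the solutions on $[0,T]$ of $$dX_t=b(t,X_t,\mathbb{P}_{X_t})\,dt+\sigma(t,X_t,\mathbb{P}_{X_t})\,dB_t,\quad X_0=x,$$ $$dX^n_t=b_n(t,X^n_t,\mathbb{P}_{X^n_t})\,dt+\sigma_n(t,X^n_t,\mathbb{P}_{X^n_t})\,dB_t,\quad X^n_0=x.$$ Then $$\lim_{n\to\infty}E\left[\sup_{t\le T}|X^n_t-X_t|^2\right]=0.$$
   Context: $(\Omega,\mathcal{F},P)$ is a probability space with a filtration $(\mathcal{F}_t)$ satisfying the usual conditions and $B$ is a $d$-dimensional $(\mathcal{F}_t,P)$-Brownian motion. $\mathbb{P}_{X}$ denotes the law of a random variable $X$. $\mathcal{P}_2(\mathbb{R}^d)$ is the set of probability measures on $\mathbb{R}^d$ with finite second moment, and $W_2(\mu,\nu)=\inf_{\pi\in\Pi(\mu,\nu)}\left[\int|x-y|^2\,d\pi(x,y)\right]^{1/2}$, where $\Pi(\mu,\nu)$ is the set of couplings of $\mu$ and $\nu$. Under the stated growth and Lipschitz conditions it is known that each equation has a unique continuous adapted solution, and this solution satisfies $E[\sup_{t\le T}|X_t|^2]<+\infty$. *)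

(* Defs.v *)
From HB Require Import structures.
From mathcomp Require Import all_boot all_order all_algebra.
From mathcomp Require Import all_classical all_reals all_analysis.

Set Implicit Arguments.
Unset Strict Implicit.
Unset Printing Implicit Defensive.

Import Order.TTheory GRing.Theory Num.Theory.
Import numFieldNormedType.Exports.

Local Open Scope classical_set_scope.
Local Open Scope ring_scope.

(* R^d is 'cV[R]_d, and R^d (x) R^d is 'M[R]_d. *)

(* Matrices carry the Borel sigma-algebra of their topology. *)
HB.instance Definition _ (R : realType) (m n : nat) :=
  Measurable.copy 'M[R]_(m, n) (g_sigma_algebraType (@open 'M[R]_(m, n))).

(* The norm that the library puts on matrices is the sup norm. This one is the
   Euclidean norm on columns and the Frobenius norm on square matrices. *)
Definition enorm (R : realType) (m n : nat) (v : 'M[R]_(m, n)) : R :=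
  Num.sqrt (\sum_(i < m) \sum_(j < n) v i j ^+ 2).

Section wasserstein.
Context (R : realType) (d : nat).
Local Notation Rd := 'cV[R]_d.

(* P_2(R^d), as a set of probability measures *)
Definition P2 : set (probability Rd R) :=
  [set mu | (\int[mu]_y ((enorm y) ^+ 2)%:E < +oo)%E].

Definition coupling (mu nu : probability Rd R) : set (probability (Rd * Rd)%type R) :=
  [set pi | forall A : set Rd, measurable A ->
     pi (A `*` setT) = mu A /\ pi (setT `*` A) = nu A].

(* finite on P_2(R^d) *)
Definition W2 (mu nu : probability Rd R) : \bar R :=
  ereal_inf [set ((\int[pi]_z (enorm (z.1 - z.2) ^+ 2)%:E) `^ 2^-1)%E
            | pi in coupling mu nu].

End wasserstein.

(* A map on [0,T] x R^d x P_2(R^d) is a total function of a real, a vector and a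
   probability measure; its values outside that domain play no role. *)
Definition coeff (R : realType) (d m n : nat) :=
  R -> 'cV[R]_d -> probability 'cV[R]_d R -> 'M[R]_(m, n).

Section coefficients.
Context (R : realType) (d : nat) (T : R).
Local Notation Rd := 'cV[R]_d.
Local Notation point := (R * Rd * probability Rd R)%type.

Definition coeff_dom : set point :=
  [set z | z.1.1 \in `[0, T] /\ P2 z.2].

(* open subsets of the domain, for the product of the Euclidean topologies and
   of the W_2 topology *)
Definition coeff_open : set (set point) :=
  [set U | U `<=` coeff_dom /\
    forall t y mu, U (t, y, mu) -> exists2 e : R, 0 < e &
      forall t' y' mu', coeff_dom (t', y', mu') ->
        `|t - t'| < e -> enorm (y - y') < e -> (W2 mu mu' < e%:E)%E ->
        U (t', y', mu')].

Definition coeff_borel (m n : nat) (f : coeff R d m n) : Prop :=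
  forall A : set 'M[R]_(m, n), measurable A ->
    <<s coeff_dom, coeff_open >> (coeff_dom `&` [set z | A (f z.1.1 z.1.2 z.2)]).

Definition linear_growth (b : coeff R d d 1) (s : coeff R d d d) : Prop :=
  exists2 C : R, 0 < C & forall (t : R) y mu, t \in `[0, T] -> P2 mu ->
    enorm (b t y mu) + enorm (s t y mu) <= C * (1 + enorm y).

Definition lipschitz_with (L : R) (m n : nat) (f : coeff R d m n) : Prop :=
  forall (t : R) y y' mu mu', t \in `[0, T] -> P2 mu -> P2 mu' ->
    ((enorm (f t y mu - f t y' mu'))%:E
       <= L%:E * ((enorm (y - y'))%:E + W2 mu mu'))%E.

Definition admissible (b : coeff R d d 1) (s : coeff R d d d) : Prop :=
  [/\ coeff_borel b, coeff_borel s, linear_growth b s &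
      exists2 L : R, 0 < L & lipschitz_with L b /\ lipschitz_with L s].

End coefficients.

Section stochastic_basis.
Context (d0 : measure_display) (Omega : measurableType d0) (R : realType).
Context (P : probability Omega R).

(* Time is [0, +oo[; filtrations and processes are not used at negative times. *)
Definition usual_filtration (F : R -> set (set Omega)) : Prop :=
  [/\ forall t : R, 0 <= t -> sigma_algebra setT (F t) /\ F t `<=` measurable,
      forall s t : R, 0 <= s -> s <= t -> F s `<=` F t,
      forall (t : R) A, 0 <= t -> (forall s : R, t < s -> F s A) -> F t A &
      forall N, P.-negligible N -> F 0 N].

Definition measurable_wrt (G : set (set Omega)) (m n : nat)
    (f : Omega -> 'M[R]_(m, n)) : Prop :=
  forall A : set 'M[R]_(m, n), measurable A -> G (f @^-1` A).

Definition brownian_motion (F : R -> set (set Omega)) (d : nat)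
    (B : R -> Omega -> 'cV[R]_d) : Prop :=
  [/\ forall t : R, 0 <= t -> measurable_wrt (F t) (B t),
      {ae P, forall w, B 0 w = 0 /\
         {within [set t : R | 0 <= t], continuous (fun t : R => B t w)}},
      forall (s t : R) E (A : set 'cV[R]_d), 0 <= s -> s < t -> F s E -> measurable A ->
        P (E `&` [set w | A (B t w - B s w)])
          = (P E * P [set w | A (B t w - B s w)%R])%E &
      (* increments are N(0, (t - s) I_d); normal_prob takes a standard deviation *)
      forall (s t : R) (A : 'I_d -> set R), 0 <= s -> s < t ->
        (forall i, measurable (A i)) ->
        P [set w | forall i, A i ((B t w - B s w) i 0)]
          = (\prod_(i < d) normal_prob 0 (Num.sqrt (t - s)) (A i))%E].

(* B([0,t]) (x) F_t -measurability on [0,t] x Omega, for every t in [0,T] *)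
Definition progressive (F : R -> set (set Omega)) (T : R) (m n : nat)
    (H : R -> Omega -> 'M[R]_(m, n)) : Prop :=
  forall t : R, t \in `[0, T] -> forall A : set 'M[R]_(m, n), measurable A ->
    <<s (`[0, t] `*` setT : set (R * Omega)),
        [set U | exists (C : set R) (E : set Omega),
           [/\ measurable C, C `<=` `[0, t], F t E & U = C `*` E]] >>
      ((`[0, t] `*` setT) `&` [set z | A (H z.1 z.2)]).

(* The process \sum_(i < n) xi_i 1_(t_i, t_(i+1)] *)
Record simple_process (d : nat) := SimpleProcess {
  sp_size : nat;
  sp_time : nat -> R;
  sp_val : nat -> Omega -> 'M[R]_d }.

Definition simple_wf (F : R -> set (set Omega)) (d : nat)
    (G : simple_process d) : Prop :=
  [/\ 0 <= sp_time G 0,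
      forall i, (i < sp_size G)%N -> sp_time G i <= sp_time G i.+1,
      forall i, (i < sp_size G)%N -> measurable_wrt (F (sp_time G i)) (sp_val G i) &
      exists M : R, forall i w, (i < sp_size G)%N -> enorm (sp_val G i w) <= M].

Definition simple_eval (d : nat) (G : simple_process d) (t : R) (w : Omega) : 'M[R]_d :=
  \sum_(i < sp_size G | sp_time G i < t <= sp_time G i.+1) sp_val G i w.

Definition simple_integral (d : nat) (B : R -> Omega -> 'cV[R]_d)
    (G : simple_process d) (t : R) (w : Omega) : 'cV[R]_d :=
  \sum_(i < sp_size G) sp_val G i w *m
    (B (Num.min t (sp_time G i.+1)) w - B (Num.min t (sp_time G i)) w).

Definition cvg_prob0 (Z : nat -> Omega -> \bar R) : Prop :=
  forall e : R, 0 < e -> P [set w | (e%:E < Z k w)%E] @[k --> \oo] --> 0%E.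

(* I is (a continuous version of) the Ito integral of H with respect to B over
   [0,T]: the limit, uniformly on [0,T] in probability, of the integrals of
   simple processes G_k such that \int_0^T |G_k - H|^2 ds tends to 0 in
   probability. Such G_k exist iff \int_0^T |H|^2 ds is a.s. finite, and the
   limit does not depend on them. *)
Definition ito_integral (F : R -> set (set Omega)) (d : nat)
    (B : R -> Omega -> 'cV[R]_d) (T : R)
    (H : R -> Omega -> 'M[R]_d) (I : R -> Omega -> 'cV[R]_d) : Prop :=
  [/\ progressive F T H,
      forall t : R, t \in `[0, T] -> measurable_wrt (F t) (I t),
      {ae P, forall w, {within `[0, T], continuous (fun t : R => I t w)}} &
      exists G : nat -> simple_process d,
      [/\ forall k, simple_wf F (G k),
          cvg_prob0 (fun k w => \int[lebesgue_measure]_(s in `[0%R, T])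
            (enorm (simple_eval (G k) s w - H s w) ^+ 2)%:E)%E &
          cvg_prob0 (fun k w => ereal_sup
            [set (enorm (simple_integral B (G k) t w - I t w))%:E
            | t in `[0, T]])]].

(* X is a solution on [0,T] of
     dX_t = b(t, X_t, P_(X_t)) dt + s(t, X_t, P_(X_t)) dB_t,  X_0 = x.
   The condition P2 is what the equation needs for its coefficients to be
   defined along X. *)
Definition mkv_solution (F : R -> set (set Omega)) (d : nat)
    (B : R -> Omega -> 'cV[R]_d) (T : R) (x : 'cV[R]_d)
    (b : coeff R d d 1) (s : coeff R d d d) (X : R -> {RV P >-> 'cV[R]_d}) : Prop :=
  let bX t w := b t (X t w) (distribution P (X t)) in
  let sX t w := s t (X t w) (distribution P (X t)) in
  [/\ forall t : R, t \in `[0, T] -> measurable_wrt (F t) (X t),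
      forall t : R, t \in `[0, T] -> P2 (distribution P (X t)),
      {ae P, forall w, {within `[0, T], continuous (fun t : R => X t w : 'cV[R]_d)}},
      {ae P, forall w, forall i, (@lebesgue_measure R).-integrable `[0, T]
         (fun t : R => (bX t w i 0)%:E)} &
      exists2 I : R -> Omega -> 'cV[R]_d, ito_integral F B T sX I &
        {ae P, forall w, forall t : R, t \in `[0, T] ->
          X t w = x + \col_i (\int[lebesgue_measure]_(r in `[0, t]) bX r w i 0)
                  + I t w}].

End stochastic_basis.

(* Main.v *)
(** The law enters only through W_2(P_U, P_V)^2 <= E|U - V|^2, the joint law of
    (U, V) being a coupling. Splitting
      b_n(X^n) - b(X) = (b_n - b)(X^n) + (b(X^n) - b(X)),
    the first term is small on {|X^n|^2 <= r}; outside, linear growth bounds it by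
    1 + |X^n|^2, and there either |X|^2 > r/4 or |X^n| <= 2 |X^n - X|. Hence
    E sup_(s <= t) |X^n_s - X_s|^2 <= c (e + tail_r + int_0^t E|X^n_s - X_s|^2 ds)
    with c independent of n, tail_r coming from X alone, and Gronwall's lemma
    concludes.

    The Ito integral is only given as a limit in probability of simple integrals.
    Its maximal inequality is proved for the difference of two integrals on the
    event that the clock V = int_0^t |H1 - H2|^2 ds is at most N, with the bound
    c E min(N, V): two simple processes are put on a common grid, their difference
    is switched off once its clock passes N, which keeps it adapted, and a pathwise
    form of Doob's inequality is integrated. Letting N grow removes the truncation.

    Second moments of a solution are bounded in the same way, without stopping
    times: with U_t = int_0^t (1 + |X_s|^2) ds, the function E min(N, U_t) satisfies
    a Gronwall inequality whose constants do not depend on N. *)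

Require Import Defs.
From HB Require Import structures.
From mathcomp Require Import all_boot all_order all_algebra.
From mathcomp Require Import all_classical all_reals all_analysis.
From mathcomp Require Import measurable_realfun ring lra zify.

Set Implicit Arguments.
Unset Strict Implicit.
Unset Printing Implicit Defensive.

Import Order.TTheory GRing.Theory Num.Theory.
Import numFieldNormedType.Exports.

Local Open Scope classical_set_scope.
Local Open Scope ring_scope.

(** * Integrals and matrices *)

(** A supremum over [[0, T]] is uncountable and paths are continuous only almost surely, so its
    measurability is not at hand. Integrals of nonnegative functions are therefore compared in a
    form that asks nothing of the smaller function, the supremum is reduced to a countable dense set
    of times, and where a measurable supremum is wanted the null sets contained in the filtration
    supply it. For the same reason each solution is replaced by a version with continuous paths
    everywhere; it is jointly measurable in time and chance, so Tonelli's theorem applies.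

    Gronwall's lemma asks for a function known in advance to be bounded. A solution comes with a
    finite second moment at each time, but with no bound uniform in time; this is the obstacle that
    the truncation min(N, U_t) removes, being at most N, a bound that leaves no trace in the
    conclusion. Once second moments are uniformly bounded, the distance between two solutions can be
    treated without truncation.

    Constants are not sharp. For instance the variance of a Brownian increment enters only through
    an upper bound with factor 6, obtained by comparing two Gaussian densities. *)

Section nonneg_integral.
Local Open Scope ereal_scope.
Context d (T : measurableType d) (R : realType) (mu : {measure set T -> \bar R}).
Implicit Types (D : set T) (f g : T -> \bar R).

(** The integral of a nonnegative function is a supremum over the simple functions below it, hence
    monotone whether or not [f] and [g] are measurable. *)
Lemma ge0_le_integral_nomeas D f g : (forall x, D x -> 0 <= f x) ->
  (forall x, D x -> f x <= g x) ->
  \int[mu]_(x in D) f x <= \int[mu]_(x in D) g x.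
Proof.
move=> f0 fg; rewrite !(integral_mkcond D) !ge0_integralTE.
- apply: le_ereal_sup => _ [h /= hf <-]; exists h => // x.
  exact/(le_trans (hf x))/lee_restrict.
- by move=> x; apply: erestrict_ge0 => // y Dy; exact: le_trans (f0 y Dy) (fg y Dy).
- by move=> x; exact: erestrict_ge0.
Qed.

(** Raising [g] to [+oo] on the null set where the comparison may fail makes it hold everywhere.
    Only [g] is altered, so measurability is asked of [g] alone; [f] may be a supremum over
    uncountably many times. *)
Lemma ae_ge0_le_integral_nomeas D f g : measurable D -> measurable_fun D g ->
  (forall x, D x -> 0 <= f x) -> (forall x, D x -> 0 <= g x) ->
  {ae mu, forall x, D x -> f x <= g x} ->
  \int[mu]_(x in D) f x <= \int[mu]_(x in D) g x.
Proof.
move=> mD mg f0 g0 [N [mN N0 sN]].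
pose h x := if x \in N then +oo else g x.
have mh : measurable_fun D h.
  apply: measurable_fun_if => //; last exact: measurable_funS mg.
  apply: (@measurable_fun_bool _ _ _ _ true).
  rewrite (_ : _ @^-1` _ = N); first exact: measurableI.
  by apply/seteqP; split => x /= => [/set_mem|/mem_set].
apply: (@le_trans _ _ (\int[mu]_(x in D) h x)).
  apply: ge0_le_integral_nomeas => // x Dx; rewrite /h.
  case: ifPn => [_|/negP xN]; first exact: leey.
  by apply: contrapT => fg; apply: xN; rewrite inE; apply: sN => /= /(_ Dx).
rewrite (@ge0_ae_eq_integral _ _ _ mu D h g)// => [x Dx|].
  by rewrite /h; case: ifPn => // _; exact: g0.
exists N; split => // x /= /not_implyP[Dx]; apply: contra_notP => xN.
by rewrite /h ifN// notin_setE.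
Qed.

End nonneg_integral.

Section matrix_borel.
Context (R : realType).

Lemma measurable_mxcoord m n (i : 'I_m) (j : 'I_n) :
  measurable_fun [set: 'M[R]_(m, n)] (fun M => M i j).
Proof.
apply: (measurability _ (RGenOpens.measurableE R)) => _ [_ [a [b ->] <-]].
rewrite setTI; apply: sub_sigma_algebra.
by apply: open_comp (interval_open _ _) => // x _; exact: coord_continuous.
Qed.

(** The square of [enorm]. It is polynomial in the entries, so estimates and measurability proofs
    avoid square roots. *)
Definition nsq m n (v : 'M[R]_(m, n)) : R := \sum_(i < m) \sum_(j < n) v i j ^+ 2.

Lemma nsq_ge0 m n (v : 'M[R]_(m, n)) : 0 <= nsq v.
Proof. by apply: sumr_ge0 => i _; apply: sumr_ge0 => j _; exact: sqr_ge0. Qed.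

Lemma enorm_ge0 m n (v : 'M[R]_(m, n)) : 0 <= enorm v.
Proof. exact: sqrtr_ge0. Qed.

Lemma enorm_sqr m n (v : 'M[R]_(m, n)) : enorm v ^+ 2 = nsq v.
Proof. by rewrite sqr_sqrtr//; exact: nsq_ge0. Qed.

Lemma nsq0 m n : nsq (0 : 'M[R]_(m, n)) = 0.
Proof. by rewrite /nsq big1// => i _; rewrite big1// => j _; rewrite mxE expr0n. Qed.

Lemma nsqN m n (v : 'M[R]_(m, n)) : nsq (- v) = nsq v.
Proof. by apply: eq_bigr => i _; apply: eq_bigr => j _; rewrite mxE sqrrN. Qed.

Lemma nsqD m n (u v : 'M[R]_(m, n)) : nsq (u + v) <= 2 * (nsq u + nsq v).
Proof.
rewrite mulrDr !mulr_sumr -big_split; apply: ler_sum => i _.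
rewrite !mulr_sumr -big_split; apply: ler_sum => j _.
rewrite mxE -subr_ge0 (_ : _ - _ = (u i j - v i j) ^+ 2) ?sqr_ge0//=; ring.
Qed.

Lemma sqr_coord_le_nsq m n (v : 'M[R]_(m, n)) i j : v i j ^+ 2 <= nsq v.
Proof.
rewrite /nsq (bigD1 i)//= (bigD1 j)//= -addrA lerDl addr_ge0//.
  by apply: sumr_ge0 => k _; exact: sqr_ge0.
by apply: sumr_ge0 => k _; apply: sumr_ge0 => l _; exact: sqr_ge0.
Qed.

Lemma measurable_nsq d (T : measurableType d) (D : set T) m n (f : T -> 'M[R]_(m, n)) :
  (forall i j, measurable_fun D (fun x => f x i j)) ->
  measurable_fun D (fun x => nsq (f x)).
Proof.
move=> mf; apply: measurable_sum => i; apply: measurable_sum => j.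
exact: measurable_funX.
Qed.

End matrix_borel.

(** * Moments of Brownian increments *)

Section normal_moments.
Context (R : realType).
Local Notation mu := (@lebesgue_measure R).
Local Open Scope ereal_scope.

(** The Radon-Nikodym derivative of [normal_prob] and [normal_pdf] have the same integral over every
    measurable set, hence agree almost everywhere. *)
Lemma ge0_integral_normal_prob (m s : R) (f : R -> \bar R) :
  measurable_fun setT f -> (forall y, 0 <= f y) ->
  \int[normal_prob m s]_y f y = \int[mu]_y (f y * (normal_pdf m s y)%:E).
Proof.
move=> mf f0.
have dom : normal_prob m s `<< mu := normal_prob_dominates m s.
rewrite -(Radon_Nikodym_SigmaFinite.change_of_variables dom)//.
pose g := Radon_Nikodym_SigmaFinite.f (normal_prob m s) mu.
have ig : mu.-integrable setT g by exact: Radon_Nikodym_SigmaFinite.f_integrable.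
have ipdf := integrable_normal_pdf m s.
have gE : ae_eq mu setT g (fun y => (normal_pdf m s y)%:E).
  apply: integral_ae_eq => [|||E ET mE]; [by []|by []|exact: measurable_int ipdf|].
  by rewrite -Radon_Nikodym_SigmaFinite.f_integral.
apply: ge0_ae_eq_integral => //.
- by apply: emeasurable_funM => //; exact: measurable_int ig.
- by apply: emeasurable_funM => //; exact: measurable_int ipdf.
- by move=> y _; rewrite mule_ge0// Radon_Nikodym_SigmaFinite.f_ge0.
- by move=> y _; rewrite mule_ge0// lee_fin normal_pdf_ge0.
- exact: ae_eqe_mul2l.
Qed.

(* u <= e^u with u = 3 y^2 / (8 s^2) compares y^2 times the N(0, s^2) density
   with the N(0, 4 s^2) density. *)
Lemma normal_second_moment (s : R) : (0 < s)%R ->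
  \int[normal_prob 0 s]_y (y ^+ 2)%:E <= (6 * s ^+ 2)%:E.
Proof.
move=> s0; rewrite ge0_integral_normal_prob//; last 2 first.
- by apply/measurable_EFinP; exact: measurable_funX.
- by move=> y; rewrite lee_fin sqr_ge0.
have s2 : (0 < 2 * s)%R by rewrite mulr_gt0.
apply: (@le_trans _ _ (\int[mu]_y ((6 * s ^+ 2)%:E * (normal_pdf 0 (2 * s) y)%:E))).
  apply: ge0_le_integral_nomeas => [y _|y _].
    by rewrite mule_ge0// lee_fin ?sqr_ge0 ?normal_pdf_ge0.
  rewrite -!EFinM lee_fin !normal_pdfE ?gt_eqF//= /normal_peak /normal_fun.
  have -> : ((2 * s) ^+ 2 * pi *+ 2 = 2 ^+ 2 * (s ^+ 2 * pi *+ 2) :> R)%R.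
    by rewrite exprMn -!mulrnAr !mulrA.
  rewrite (@sqrtrM _ (2 ^+ 2)) ?sqr_ge0// sqrtr_sqr ger0_norm// invfM.
  set p := (Num.sqrt _)^-1%R.
  have p0 : (0 <= p)%R by rewrite invr_ge0 sqrtr_ge0.
  rewrite subr0.
  have -> : (- y ^+ 2 / (s ^+ 2 *+ 2) =
    - y ^+ 2 / ((2 * s) ^+ 2 *+ 2) - 3 / 8 * (y ^+ 2 / s ^+ 2))%R.
    by field; rewrite gt_eqF.
  rewrite expRD.
  set E := expR (- y ^+ 2 / _); have E0 : (0 <= E)%R by exact: expR_ge0.
  set u := (3 / 8 * (y ^+ 2 / s ^+ 2))%R.
  have u0 : (0 <= u)%R by rewrite mulr_ge0// divr_ge0 ?sqr_ge0.
  (* As u e^(-u) <= 1, the integrand is at most 8/3 s^2 [p * E], that is 16/3 s^2 times the wider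
     density [p * E / 2]; 6 rounds 16/3 up. *)
  have -> : (y ^+ 2 = 8 / 3 * s ^+ 2 * u)%R.
    by rewrite /u; field; rewrite gt_eqF.
  have ue : (u * expR (- u) <= 1)%R.
    rewrite expRN ler_pdivrMr ?expR_gt0// mul1r.
    by apply: le_trans (expR_ge1Dx u); rewrite lerDr.
  have -> : (8 / 3 * s ^+ 2 * u * (p * (E * expR (- u))) =
     8 / 3 * (s ^+ 2 * (p * E)) * (u * expR (- u)))%R by ring.
  have -> : (6 * s ^+ 2 * (2^-1 * p * E) = 3 * (s ^+ 2 * (p * E)))%R by field.
  have q0 : (0 <= s ^+ 2 * (p * E))%R by rewrite mulr_ge0 ?sqr_ge0 ?mulr_ge0.
  have : (0 <= s ^+ 2 * (p * E) * (1 - u * expR (- u)))%R.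
    by rewrite mulr_ge0// subr_ge0.
  by lra.
rewrite ge0_integralZl//; last first.
- by rewrite lee_fin mulr_ge0// sqr_ge0.
- by move=> y _; rewrite lee_fin normal_pdf_ge0.
- by apply/measurable_EFinP; exact: measurable_normal_pdf.
by rewrite integral_normal_pdf mule1.
Qed.

Lemma integrable_normal_id (s : R) : (0 < s)%R ->
  (normal_prob 0 s).-integrable setT (fun y => y%:E).
Proof.
move=> s0; apply/integrableP; split; first exact/measurable_EFinP.
apply: (@le_lt_trans _ _ (\int[normal_prob 0 s]_y (1 + (y ^+ 2)%:E))).
  apply: ge0_le_integral_nomeas => [y _|y _]; first by rewrite abse_ge0.
  rewrite -EFinD lee_fin.
  by case: (ger0P y) => y0; nra.
rewrite ge0_integralD//; last 2 first.
- by move=> y _; rewrite lee_fin sqr_ge0.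
- by apply/measurable_EFinP; exact: measurable_funX.
rewrite lte_add_pinfty//; first by rewrite integral_cst//= mul1e probability_setT ltry.
exact: le_lt_trans (normal_second_moment s0) (ltry _).
Qed.

(** The reflection y -> -y preserves Lebesgue measure and the centred density, so the positive and
    negative parts have equal integrals. *)
Lemma normal_mean (s : R) : (0 < s)%R -> \int[normal_prob 0 s]_y y%:E = 0.
Proof.
move=> s0; rewrite integralE.
have mid : measurable_fun setT (fun y : R => y%:E) by exact/measurable_EFinP.
have := integrable_normal_id s0 => intid.
suff -> : \int[normal_prob 0 s]_y (fun y => y%:E)^\- y =
          \int[normal_prob 0 s]_y (fun y => y%:E)^\+ y.
  by rewrite subee//; exact: integrable_pos_fin_num.
rewrite !ge0_integral_normal_prob//; last 2 first.
- exact: measurable_funepos.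
- exact: measurable_funeneg.
pose g (y : R) := (fun y : R => y%:E)^\+ y * (normal_pdf 0 s y)%:E.
transitivity (\int[mu]_y (g \o -%R) y).
  apply: eq_integral => y _; rewrite /g /= funeposE funenegE -EFinN; congr (_ * _%:E).
  by rewrite !normal_pdfE ?gt_eqF//= /normal_fun !subr0 sqrrN.
have mg : measurable_fun setT g.
  apply: emeasurable_funM; first exact: measurable_funepos.
  by apply/measurable_EFinP; exact: measurable_normal_pdf.
have mN : measurable_fun setT (-%R : measurableTypeR R -> measurableTypeR R).
  exact: oppr_measurable.
rewrite -[LHS](ge0_integral_pushforward mN mu measurableT mg).
  by apply: eq_measure_integral => A mA _; exact: lebesgue_measureN.
by move=> y _; rewrite mule_ge0// lee_fin normal_pdf_ge0.
Qed.

End normal_moments.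

Section brownian_increments.
Context (d0 : measure_display) (Omega : measurableType d0) (R : realType).
Context (P : probability Omega R) (F : R -> set (set Omega)).
Context (hF : usual_filtration P F) (d : nat) (B : R -> Omega -> 'cV[R]_d).
Context (hB : brownian_motion P F B).
Local Open Scope ereal_scope.

Definition sigma_measurable (G : set (set Omega)) (f : Omega -> R) :=
  forall A, measurable A -> G (f @^-1` A).

Lemma filtration_sub (t : R) : (0 <= t)%R -> F t `<=` measurable.
Proof. by case: hF => h _ _ _ /h[]. Qed.

Lemma sigma_measurable_fun (t : R) f : (0 <= t)%R -> sigma_measurable (F t) f ->
  measurable_fun setT f.
Proof. by move=> t0 mf _ A mA; rewrite setTI; apply: (filtration_sub t0); exact: mf. Qed.

Lemma measurable_wrt_coord (G : set (set Omega)) m n (f : Omega -> 'M[R]_(m, n)) i j :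
  measurable_wrt G f -> sigma_measurable G (fun w => f w i j).
Proof.
move=> mf A mA; apply: (mf [set v | A (v i j)]).
by rewrite -[X in measurable X]setTI; exact: measurable_mxcoord.
Qed.

Definition increment (j : 'I_d) (s t : R) (w : Omega) : R := ((B t w - B s w) j 0)%R.

Lemma measurable_increment j s t : (0 <= s)%R -> (0 <= t)%R ->
  measurable_fun setT (increment j s t).
Proof.
move=> s0 t0; have [mB _ _ _] := hB.
rewrite /increment; under eq_fun do rewrite !mxE.
by apply: measurable_funB;
  [apply: (sigma_measurable_fun t0)|apply: (sigma_measurable_fun s0)];
  by apply: measurable_wrt_coord; exact: mB.
Qed.

Lemma increment_indep j s t E A : (0 <= s)%R -> (s < t)%R -> F s E -> measurable A ->
  P (E `&` increment j s t @^-1` A) = P E * normal_prob 0 (Num.sqrt (t - s)) A.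
Proof.
move=> s0 st FE mA; have [_ _ ind law] := hB.
have mC : measurable [set v : 'cV[R]_d | A (v j 0%R)].
  by rewrite -[X in measurable X]setTI; exact: measurable_mxcoord.
rewrite (ind s t E _ s0 st FE mC); congr (_ * _).
have := law s t (fun i => if i == j then A else setT) s0 st.
rewrite (bigD1 j)//= eqxx big1 ?mule1.
  move=> <-; last by move=> i; case: ifP.
  congr (P _); apply/seteqP; split => w /=.
    by move=> Aw i; case: eqP => // ->.
  by move=> /(_ j); rewrite eqxx.
by move=> i /negbTE ->; exact: probability_setT.
Qed.

(** By independence the joint law of [xi] and the increment agrees on rectangles with the product of
    the law of [xi] and the normal law, hence everywhere; Tonelli's theorem then factors the
    integral. *)
Lemma ge0_integral_indep_increment j s t (xi : Omega -> R) (f g : R -> \bar R) :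
  (0 <= s)%R -> (s < t)%R -> sigma_measurable (F s) xi ->
  measurable_fun setT f -> measurable_fun setT g ->
  (forall x, 0 <= f x) -> (forall x, 0 <= g x) ->
  \int[P]_w (f (xi w) * g (increment j s t w)) =
  (\int[P]_w f (xi w)) * \int[normal_prob 0 (Num.sqrt (t - s))]_y g y.
Proof.
move=> s0 st mxi mf mg f0 g0.
have t0 : (0 <= t)%R by rewrite (le_trans s0)// ltW.
have mx := sigma_measurable_fun s0 mxi.
have mb := measurable_increment j s0 t0.
pose N := normal_prob 0 (Num.sqrt (t - s)).
pose X : {mfun Omega >-> R} := HB.pack xi (isMeasurableFun.Build _ _ _ _ xi mx).
pose Z0 (w : Omega) : R * measurableTypeR R := (xi w, increment j s t w).
have mZ : measurable_fun setT Z0.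
  exact: (measurable_fun_pair mx (mb : @measurable_fun _ _ Omega (measurableTypeR R) setT _)).
pose Z : {mfun Omega >-> _} := HB.pack Z0 (isMeasurableFun.Build _ _ _ _ Z0 mZ).
have prodE : forall C, measurable C -> (distribution P X \x N) C = distribution P Z C.
  apply: product_measure_unique => A A' mA mA'.
  exact: (@increment_indep j s t _ _ s0 st (mxi A mA) mA').
have mfg : measurable_fun setT
    (fun z : R * measurableTypeR R => f z.1 * g z.2).
  by apply: emeasurable_funM; exact: measurableT_comp.
have fg0 (z : R * measurableTypeR R) : 0 <= f z.1 * g z.2.
  by rewrite mule_ge0.
rewrite -(ge0_integral_distribution Z mfg fg0).
transitivity (\int[(distribution P X \x N)%E]_z (f z.1 * g z.2)).
  by apply: eq_measure_integral => C mC _; exact/esym/prodE.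
rewrite fubini_tonelli1// /fubini_F/=.
under eq_integral do rewrite ge0_integralZl//.
rewrite ge0_integralZr//; last exact: integral_ge0.
by rewrite (ge0_integral_distribution X mf f0).
Qed.

Lemma increment_sqr_bound j s t (xi : Omega -> R) :
  (0 <= s)%R -> (s <= t)%R -> sigma_measurable (F s) xi ->
  \int[P]_w ((xi w * increment j s t w) ^+ 2)%:E <=
  (6 * (t - s))%:E * \int[P]_w (xi w ^+ 2)%:E.
Proof.
move=> s0; rewrite le_eqVlt => /predU1P[<-|st] mxi.
  rewrite subrr mulr0 mul0e integral0_eq// => w _.
  by rewrite /increment subrr mxE mulr0 expr0n.
have ts : (0 < t - s)%R by rewrite subr_gt0.
under eq_integral do rewrite exprMn EFinM.
have msq : measurable_fun setT (fun x : R => (x ^+ 2)%:E).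
  by apply/measurable_EFinP; exact: measurable_funX.
have sq0 (x : R) : 0 <= (x ^+ 2)%:E by rewrite lee_fin sqr_ge0.
rewrite (ge0_integral_indep_increment _ s0 st mxi msq msq sq0 sq0) muleC.
rewrite lee_wpmul2r ?integral_ge0//.
have := @normal_second_moment R (Num.sqrt (t - s)).
by rewrite sqr_sqrtr ?(ltW ts)// sqrtr_gt0; exact.
Qed.

(** The factorization holds for nonnegative functions, so the product is split: its positive part is
    x^+ y^+ + x^- y^- and its negative part x^+ y^- + x^- y^+. These have the same expectation,
    because the positive and negative parts of a centred normal variable have the same mean. *)
Lemma increment_mean0 j s t (xi : Omega -> R) :
  (0 <= s)%R -> (s <= t)%R -> sigma_measurable (F s) xi ->
  P.-integrable setT (EFin \o xi) ->
  P.-integrable setT (fun w => (xi w * increment j s t w)%:E) /\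
  \int[P]_w (xi w * increment j s t w)%:E = 0.
Proof.
move=> s0; rewrite le_eqVlt => /predU1P[<-|st] mxi ixi.
  rewrite (_ : (fun w => _) = cst 0); first by rewrite integral0; split => //; exact: integrable0.
  by apply/funext => w; rewrite /increment subrr mxE mulr0.
have t0 : (0 <= t)%R by rewrite (le_trans s0)// ltW.
have ts : (0 < Num.sqrt (t - s))%R by rewrite sqrtr_gt0 subr_gt0.
have mx := sigma_measurable_fun s0 mxi.
have mb := measurable_increment j s0 t0.
have mxb : measurable_fun setT (fun w => (xi w * increment j s t w)%:E).
  by apply/measurable_EFinP; exact: measurable_funM.
have iN := integrable_normal_id ts.
have mE : measurable_fun setT (@EFin R) by [].
have mabs : measurable_fun setT (fun x : R => `|x%:E|) by exact: measurableT_comp.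
have int : P.-integrable setT (fun w => (xi w * increment j s t w)%:E).
  apply/integrableP; split => //.
  under eq_integral do rewrite EFinM abseM.
  rewrite (@ge0_integral_indep_increment j s t xi (fun x => `|x%:E|) (fun x => `|x%:E|))//.
  move/integrableP: iN => [_ iN]; move/integrableP: ixi => [_ ixi].
  by rewrite lte_mul_pinfty// ?integral_ge0// ge0_fin_numE// integral_ge0.
split => //.
have mp := measurable_funepos mE; have mn := measurable_funeneg mE.
have pos (x : R) : 0 <= (EFin^\+)%E x by [].
have neg (x : R) : 0 <= (EFin^\-)%E x by [].
have N0 : \int[normal_prob 0 (Num.sqrt (t - s))]_y (EFin^\+)%E y =
    \int[normal_prob 0 (Num.sqrt (t - s))]_y (EFin^\-)%E y.
  have := normal_mean ts; rewrite integralE => /eqP.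
  rewrite sube_eq ?add0e; last 2 first.
    exact: integrable_pos_fin_num.
    by rewrite fin_num_adde_defr.
  by move/eqP.
rewrite integralE; apply/eqP; rewrite sube_eq ?add0e; last 2 first.
- exact: integrable_pos_fin_num.
- by rewrite fin_num_adde_defr.
apply/eqP.
have partE (x y : R) : (maxe (x * y)%:E 0 = maxe x%:E 0 * maxe y%:E 0 + maxe (- x%:E) 0 * maxe (- y%:E) 0) /\
  (maxe (- (x * y)%:E) 0 = maxe x%:E 0 * maxe (- y%:E) 0 + maxe (- x%:E) 0 * maxe y%:E 0).
  have maxE (a : R) : Num.max a 0%R = ((`|a| + a) / 2)%R.
    by case: (lerP a 0) => a0; rewrite ?(ler0_norm a0) ?(gtr0_norm a0); lra.
  by rewrite -!EFinN -!EFin_max -!EFinM -!EFinD !maxE !normrN normrM; split;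
    congr EFin; field.
transitivity (\int[P]_w ((EFin^\+)%E (xi w) * (EFin^\+)%E (increment j s t w) +
      (EFin^\-)%E (xi w) * (EFin^\-)%E (increment j s t w))).
  by apply: eq_integral => w _; rewrite !funeposE !funenegE (partE _ _).1.
transitivity (\int[P]_w ((EFin^\+)%E (xi w) * (EFin^\-)%E (increment j s t w) +
      (EFin^\-)%E (xi w) * (EFin^\+)%E (increment j s t w))); last first.
  by apply: eq_integral => w _; rewrite !funeposE !funenegE (partE _ _).2.
have M (f g : R -> \bar R) : measurable_fun setT f -> measurable_fun setT g ->
   measurable_fun setT (fun w => f (xi w) * g (increment j s t w)).
  by move=> mf mg; apply: emeasurable_funM; exact: measurableT_comp.
rewrite !ge0_integralD//; try by [exact: M|move=> w _; rewrite mule_ge0].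
by rewrite !ge0_integral_indep_increment// N0.
Qed.

End brownian_increments.

(** * Martingale transforms on a grid *)

(* Pathwise form of Doob's inequality: the sum is a martingale when m is one. *)
Lemma running_max_sqr (R : realType) (m s : nat -> R) : m 0%N = 0 -> s 0%N = 0 ->
  (forall k, s k.+1 = Num.max (s k) (m k.+1)) ->
  forall n, s n ^+ 2 <= 4 * m n ^+ 2 + \sum_(k < n) (- 4 * s k * (m k.+1 - m k)).
Proof.
move=> m0 s0 sS n.
(* By summation by parts the right side is the sum of m_(k+1) (s_(k+1) - s_k), and m_(k+1) = s_(k+1)
   whenever s increases; hence it dominates s_n^2 / 2. Completing the square in s_n m_n then
   produces the factor 4. *)
suff H : s n ^+ 2 / 2 <= s n * m n + 4^-1 * \sum_(k < n) (- 4 * s k * (m k.+1 - m k)).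
  by have := sqr_ge0 (s n / 2 - m n); nra.
elim: n => [|n IH]; first by rewrite s0 m0 big_ord0; lra.
rewrite big_ord_recr/= sS; move: IH; set S := \sum_(_ < _) _ => IH.
case: (leP (s n) (m n.+1)) => h; last by lra.
by have := sqr_ge0 (m n.+1 - s n); nra.
Qed.

(** * Square integrable random variables *)

Section square_integrable.
Context (d0 : measure_display) (Omega : measurableType d0) (R : realType).
Context (P : probability Omega R).
Local Open Scope ereal_scope.
Implicit Types f g : Omega -> R.

Definition sq_int f := measurable_fun setT f /\ \int[P]_w (f w ^+ 2)%:E < +oo.

Lemma measurable_sqr f : measurable_fun setT f ->
  measurable_fun setT (fun w => (f w ^+ 2)%:E).
Proof. by move=> mf; apply/measurable_EFinP; exact: measurable_funX. Qed.

Lemma sq_int_le f g (c : R) : measurable_fun setT f -> sq_int g ->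
  (forall w, f w ^+ 2 <= c * g w ^+ 2)%R -> sq_int f.
Proof.
move=> mf [mg ig] fg; split => //.
have cge : forall w, (f w ^+ 2 <= `|c| * g w ^+ 2)%R.
  move=> w; apply: le_trans (fg w) _; rewrite ler_wpM2r ?sqr_ge0//; exact: ler_norm.
apply: (@le_lt_trans _ _ (\int[P]_w (`|c|%:E * (g w ^+ 2)%:E))).
  apply: ge0_le_integral_nomeas => w _; first by rewrite lee_fin sqr_ge0.
  by rewrite -EFinM lee_fin.
rewrite ge0_integralZl//; last by move=> w _; rewrite lee_fin sqr_ge0.
- by rewrite lte_mul_pinfty// ?lee_fin// ge0_fin_numE.
- exact: measurable_sqr.
Qed.

Lemma sq_int0 : sq_int (fun=> 0%R).
Proof.
split; first exact: measurable_cst.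
by rewrite (eq_integral (cst 0)) ?integral0// => w _; rewrite expr0n.
Qed.

Lemma sq_intD f g : sq_int f -> sq_int g -> sq_int (fun w => f w + g w)%R.
Proof.
move=> [mf jf] [mg ig]; split; first exact: measurable_funD.
apply: (@le_lt_trans _ _ (\int[P]_w (2%:E * ((f w ^+ 2)%:E + (g w ^+ 2)%:E)))).
  apply: ge0_le_integral_nomeas => w _; first by rewrite lee_fin sqr_ge0.
  by rewrite -EFinD -EFinM lee_fin; have := sqr_ge0 (f w - g w)%R; nra.
have msf := measurable_sqr mf; have msg := measurable_sqr mg.
rewrite ge0_integralZl//; last 2 first.
- exact: emeasurable_funD.
- by move=> w _; rewrite adde_ge0// lee_fin sqr_ge0.
rewrite ge0_integralD//; try by move=> w _; rewrite lee_fin sqr_ge0.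
rewrite lte_mul_pinfty// ?ge0_fin_numE ?lee_fin//; last by exact: lte_add_pinfty.
Qed.

Lemma sq_int_max f g : sq_int f -> sq_int g -> sq_int (fun w => Num.max (f w) (g w)).
Proof.
move=> [mf jf] [mg ig]; split; first exact: measurable_maxr.
apply: (@le_lt_trans _ _ (\int[P]_w ((f w ^+ 2)%:E + (g w ^+ 2)%:E))).
  apply: ge0_le_integral_nomeas => w _; first by rewrite lee_fin sqr_ge0.
  by rewrite -EFinD lee_fin; case: (leP (f w) (g w)) => _;
    rewrite ?lerDl ?lerDr sqr_ge0.
have msf := measurable_sqr mf; have msg := measurable_sqr mg.
rewrite ge0_integralD//; try by move=> w _; rewrite lee_fin sqr_ge0.
exact: lte_add_pinfty.
Qed.

Lemma sq_int_mulb f g (K : R) : measurable_fun setT f -> (forall w, `|f w| <= K)%R ->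
  sq_int g -> sq_int (fun w => f w * g w)%R.
Proof.
move=> mf fK ig; apply: (@sq_int_le _ g (K ^+ 2)%R) => //.
  by apply: measurable_funM => //; case: ig.
move=> w; rewrite exprMn ler_wpM2r ?sqr_ge0//.
rewrite -[leLHS]real_normK ?num_real// lerXn2r ?nnegrE//.
exact: le_trans (fK w).
Qed.

Lemma sq_int_integrable_sqr f : sq_int f -> P.-integrable setT (fun w => (f w ^+ 2)%:E).
Proof.
move=> [mf jf]; apply/integrableP; split; first exact: measurable_sqr.
by under eq_integral do rewrite gee0_abs ?lee_fin ?sqr_ge0//.
Qed.

Lemma sq_int_integrableM f g : sq_int f -> sq_int g ->
  P.-integrable setT (fun w => (f w * g w)%:E).
Proof.
move=> jf ig; have jfg := sq_intD jf ig.
apply: (@le_integrable _ _ _ P setT _ _ (fun w => (f w ^+ 2)%:E + (g w ^+ 2)%:E)) => //.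
- by apply/measurable_EFinP; apply: measurable_funM; [case: jf|case: ig].
- move=> w _; rewrite -EFinD !abse_EFin lee_fin (ger0_norm (addr_ge0 _ _)) ?sqr_ge0//.
  rewrite normrM -(real_normK (num_real (f w))) -(real_normK (num_real (g w))).
  by have := sqr_ge0 (`|f w| - `|g w|)%R; nra.
- by apply: integrableD => //; exact: sq_int_integrable_sqr.
Qed.

End square_integrable.

(** * Scalar transforms and the discrete Doob inequality *)

Section martingale_transform.
Context (d0 : measure_display) (Omega : measurableType d0) (R : realType).
Context (P : probability Omega R) (F : R -> set (set Omega)).
Context (hF : usual_filtration P F) (d : nat) (B : R -> Omega -> 'cV[R]_d).
Context (hB : brownian_motion P F B).
Local Open Scope ereal_scope.

(** [F t] is a plain set of events. Being a sigma-algebra, it equals the one it generates, so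
    closure properties of measurable functions become closure properties of adapted ones. *)
Lemma sigma_measurableP (t : R) (f : Omega -> R) : (0 <= t)%R ->
  sigma_measurable (F t) f <->
  measurable_fun setT (f : g_sigma_algebraType (F t) -> R).
Proof.
move=> t0; case: hF => /(_ t t0)[sa _] _ _ _.
have E : <<s F t >> = F t by exact: sigma_algebra_id.
split => [mf _ A mA|mf A mA].
  by rewrite setTI /measurable/= E; exact: mf.
by have := mf measurableT A mA; rewrite setTI /measurable/= E.
Qed.

Lemma sigma_measurable_mono s t (f : Omega -> R) : (0 <= s)%R -> (s <= t)%R ->
  sigma_measurable (F s) f -> sigma_measurable (F t) f.
Proof. by move=> s0 st mf A mA; case: hF => _ /(_ s t s0 st) h _ _; apply: h; exact: mf. Qed.

Context (r : nat -> R) (r0 : (0 <= r 0%N)%R) (rS : forall k, (r k <= r k.+1)%R).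

Lemma grid_mono k l : (k <= l)%N -> (r k <= r l)%R.
Proof. by move=> kl; apply: (@homo_leq _ r <=%R) => // y x z; exact: le_trans. Qed.

Lemma grid_ge0 k : (0 <= r k)%R.
Proof. exact: le_trans r0 (grid_mono (leq0n k)). Qed.

Section scalar.
Context (j : 'I_d) (g : nat -> Omega -> R).
Context (mg : forall k, sigma_measurable (F (r k)) (g k)).
Context (bg : forall k, exists K : R, forall w, (`|g k w| <= K)%R).

Definition transform (n : nat) (w : Omega) : R :=
  (\sum_(k < n) g k w * increment B j (r k) (r k.+1) w)%R.

Lemma transformS n w : transform n.+1 w =
  (transform n w + g n w * increment B j (r n) (r n.+1) w)%R.
Proof. by rewrite /transform big_ord_recr. Qed.

Lemma adapted_increment k : sigma_measurable (F (r k.+1)) (increment B j (r k) (r k.+1)).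
Proof.
have [mB _ _ _] := hB; apply/sigma_measurableP; first exact: grid_ge0.
rewrite /increment; under eq_fun do rewrite !mxE.
apply: measurable_funB.
  apply/sigma_measurableP; first exact: grid_ge0.
  by apply: measurable_wrt_coord; apply: mB; exact: grid_ge0.
apply/sigma_measurableP; first exact: grid_ge0.
apply: (sigma_measurable_mono (grid_ge0 k)) => //.
by apply: measurable_wrt_coord; apply: mB; exact: grid_ge0.
Qed.

Lemma adapted_transform n : sigma_measurable (F (r n)) (transform n).
Proof.
elim: n => [|n IH].
  apply/sigma_measurableP => //.
  rewrite (_ : transform 0 = fun=> 0%R); first exact: measurable_cst.
  by apply/funext => w; rewrite /transform big_ord0.
apply/sigma_measurableP; first exact: grid_ge0.
rewrite (_ : transform n.+1 = fun w => transform n w + g n w * increment B j (r n) (r n.+1) w)%R;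
  last by apply/funext => w; exact: transformS.
apply: measurable_funD.
  by apply/(sigma_measurableP _ (grid_ge0 _)); exact: (sigma_measurable_mono (grid_ge0 n)).
apply: measurable_funM; apply/(sigma_measurableP _ (grid_ge0 _)).
  exact: (sigma_measurable_mono (grid_ge0 n)).
exact: adapted_increment.
Qed.

Lemma sq_int_bounded k : sq_int P (g k).
Proof.
have [K hK] := bg k; split; first exact: (sigma_measurable_fun hF (grid_ge0 k)).
apply: (@le_lt_trans _ _ (\int[P]_w (K ^+ 2)%:E)).
  apply: ge0_le_integral_nomeas => w _; first by rewrite lee_fin sqr_ge0.
  rewrite lee_fin -[leLHS]real_normK ?num_real// lerXn2r ?nnegrE//.
  exact: le_trans (hK w).
by rewrite integral_cst//= probability_setT mule1 ltry.
Qed.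

Lemma sq_int_term k (xi : Omega -> R) : sigma_measurable (F (r k)) xi -> sq_int P xi ->
  sq_int P (fun w => xi w * increment B j (r k) (r k.+1) w)%R.
Proof.
move=> mxi [_ ixi]; split.
  apply: measurable_funM; first exact: (sigma_measurable_fun hF (grid_ge0 k)).
  by apply: (measurable_increment hF hB); exact: grid_ge0.
apply: le_lt_trans (increment_sqr_bound hF hB j (grid_ge0 k) (rS k) mxi) _.
rewrite lte_mul_pinfty// ?ge0_fin_numE ?lee_fin//.
- by rewrite mulr_ge0// subr_ge0.
Qed.

Lemma sq_int_transform n : sq_int P (transform n).
Proof.
elim: n => [|n IH].
  by rewrite /transform; under eq_fun do rewrite big_ord0; exact: sq_int0.
rewrite (_ : transform n.+1 = fun w => transform n w + g n w * increment B j (r n) (r n.+1) w)%R;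
  last by apply/funext => w; exact: transformS.
apply: sq_intD => //.
apply: sq_int_term => //; exact: sq_int_bounded.
Qed.

(** The weight [xi * g k] is still known at time [r k], and is integrable as a product of two square
    integrable variables. *)
Lemma transform_term_mean0 k (xi : Omega -> R) : sigma_measurable (F (r k)) xi -> sq_int P xi ->
  P.-integrable setT (fun w => (xi w * (transform k.+1 w - transform k w))%:E) /\
  \int[P]_w (xi w * (transform k.+1 w - transform k w))%:E = 0.
Proof.
move=> mxi ixi.
have E w : (xi w * (transform k.+1 w - transform k w) =
   (xi w * g k w) * increment B j (r k) (r k.+1) w)%R.
  by rewrite transformS addrAC subrr add0r mulrA.
rewrite (_ : (fun w => _) =
  (fun w => ((xi w * g k w) * increment B j (r k) (r k.+1) w)%:E)); last first.
  by apply/funext => w; rewrite E.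
apply: (increment_mean0 hF hB); [exact: grid_ge0|exact: rS| |].
  apply/(sigma_measurableP _ (grid_ge0 _)); apply: measurable_funM;
  by apply/(sigma_measurableP _ (grid_ge0 _)).
by apply: sq_int_integrableM => //; exact: sq_int_bounded.
Qed.

(** Increments over disjoint cells are orthogonal: [transform n] is known at [r n], so the cross
    term has mean zero. *)
Lemma transform_second_moment n : \int[P]_w (transform n w ^+ 2)%:E <=
  \sum_(k < n) (6 * (r k.+1 - r k))%:E * \int[P]_w (g k w ^+ 2)%:E.
Proof.
elim: n => [|n IH].
  rewrite big_ord0 integral0_eq// => w _.
  by rewrite /transform big_ord0 expr0n.
rewrite big_ord_recr/=.
pose D w := (transform n.+1 w - transform n w)%R.
have DE w : D w = (g n w * increment B j (r n) (r n.+1) w)%R.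
  by rewrite /D transformS addrAC subrr add0r.
have [i1 z1] := transform_term_mean0 (adapted_transform n) (sq_int_transform n).
have iD : sq_int P D.
  rewrite (_ : D = fun w => g n w * increment B j (r n) (r n.+1) w)%R;
    last by apply/funext => w; exact: DE.
  by apply: sq_int_term => //; exact: sq_int_bounded.
have i0 := sq_int_integrable_sqr (sq_int_transform n).
have i2 := sq_int_integrable_sqr iD.
have i1' := integrableZl measurableT 2 i1.
have -> : \int[P]_w (transform n.+1 w ^+ 2)%:E =
    \int[P]_w ((transform n w ^+ 2)%:E + 2%:E * (transform n w * D w)%:E + (D w ^+ 2)%:E).
  apply: eq_integral => w _; rewrite -EFinM -!EFinD; congr EFin.
  by rewrite /D; ring.
rewrite integralD//; last exact: integrableD.
rewrite integralD// integralZl// z1 mule0 adde0 leeD//.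
under eq_integral do rewrite DE.
exact: (increment_sqr_bound hF hB j (grid_ge0 n) (rS n) (mg n)).
Qed.

(** It starts at 0, so it is the running maximum of the positive part of [e * transform]. The signs
    [e = 1] and [e = -1] together control the absolute value. *)
Fixpoint running_max (e : R) (n : nat) (w : Omega) : R :=
  if n is m.+1 then Num.max (running_max e m w) (e * transform m.+1 w)%R else 0%R.

Lemma running_maxP e n : sigma_measurable (F (r n)) (running_max e n) /\
  sq_int P (running_max e n).
Proof.
elim: n => [|n [IH1 IH2]] /=.
  by split; [apply/sigma_measurableP => //; exact: measurable_cst|exact: sq_int0].
have me : sigma_measurable (F (r n.+1)) (fun w => e * transform n.+1 w)%R.
  apply/(sigma_measurableP _ (grid_ge0 _)); apply: measurable_funM => //.
  by apply/(sigma_measurableP _ (grid_ge0 _)); exact: adapted_transform.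
split.
  apply/(sigma_measurableP _ (grid_ge0 _)); apply: measurable_maxr.
    by apply/(sigma_measurableP _ (grid_ge0 _)); exact: (sigma_measurable_mono (grid_ge0 n)).
  by apply/(sigma_measurableP _ (grid_ge0 _)).
apply: sq_int_max => //; apply: (@sq_int_mulb _ _ _ _ _ _ `|e|%R) => //.
exact: sq_int_transform.
Qed.

Lemma running_max_ge e k n w : (k <= n)%N -> (e * transform k w <= running_max e n w)%R.
Proof.
elim: n k => [|n IH] k; first by rewrite leqn0 => /eqP ->; rewrite /transform big_ord0 mulr0.
rewrite leq_eqVlt => /predU1P[->|]; first by rewrite /= le_max lexx orbT.
by rewrite ltnS => /IH h /=; rewrite le_max h.
Qed.

(** [running_max_sqr] is integrated: its correction terms are increments of the transform weighted
    by the running maximum, which is adapted and square integrable, so they have mean zero. *)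
Lemma running_max_second_moment e n : (e ^+ 2 = 1)%R ->
  \int[P]_w (running_max e n w ^+ 2)%:E <= 4%:E * \int[P]_w (transform n w ^+ 2)%:E.
Proof.
move=> e1.
pose h k w := (((- 4 * e) * running_max e k w) * (transform k.+1 w - transform k w))%R.
have hP k : P.-integrable setT (EFin \o h k) /\ \int[P]_w (h k w)%:E = 0.
  have [m1 i1] := running_maxP e k.
  have m2 : sigma_measurable (F (r k)) (fun w => (- 4 * e) * running_max e k w)%R.
    apply/(sigma_measurableP _ (grid_ge0 _)); apply: measurable_funM => //.
    by apply/(sigma_measurableP _ (grid_ge0 _)).
  have i2 : sq_int P (fun w => (- 4 * e) * running_max e k w)%R.
    exact: (@sq_int_mulb _ _ _ _ _ _ `|- 4 * e|%R).
  exact: transform_term_mean0 m2 i2.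
have HP m : P.-integrable setT (fun w => (\sum_(k < m) h k w)%:E) /\
    \int[P]_w (\sum_(k < m) h k w)%:E = 0.
  elim: m => [|m [IH1 IH2]].
    rewrite (_ : (fun _ => _) = cst 0); first by rewrite integral0; split => //; exact: integrable0.
    by apply/funext => w; rewrite big_ord0.
  have [h1 h2] := hP m.
  rewrite (_ : (fun _ => _) = (fun w => (\sum_(k < m) h k w)%:E + (h m w)%:E)); last first.
    by apply/funext => w; rewrite big_ord_recr.
  by split; [exact: integrableD|rewrite integralD// IH2 h2 add0e].
have [i1 z1] := HP n; have i2 := sq_int_integrable_sqr (sq_int_transform n).
have i2' := integrableZl measurableT 4 i2.
apply: (@le_trans _ _ (\int[P]_w (4%:E * (transform n w ^+ 2)%:E + (\sum_(k < n) h k w)%:E))).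
  apply: ge0_le_integral_nomeas => w _; first by rewrite lee_fin sqr_ge0.
  rewrite -EFinM -EFinD lee_fin.
  have := @running_max_sqr R (fun k => e * transform k w)%R (fun k => running_max e k w).
  rewrite /transform big_ord0 mulr0 => /(_ erefl erefl (fun=> erefl) n).
  rewrite exprMn e1 mul1r => /le_trans; apply; rewrite lerD2l; apply: ler_sum => k _.
  by rewrite /h /transform -mulrBr mulrCA; lra.
by rewrite integralD// z1 adde0 integralZl.
Qed.

(** 48 = 2 * 4 * 6: the two signs of the running maximum, Doob's factor 4, and the variance bound
    6. *)
Lemma doob_majorant n : exists G : Omega -> R,
  [/\ measurable_fun setT G, forall w, (0 <= G w)%R,
   forall k w, (k <= n)%N -> (transform k w ^+ 2 <= G w)%R &
   \int[P]_w (G w)%:E <=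
     \sum_(k < n) (48 * (r k.+1 - r k))%:E * \int[P]_w (g k w ^+ 2)%:E].
Proof.
have [_ [m1 i1]] := running_maxP 1 n; have [_ [m2 i2]] := running_maxP (-1) n.
exists (fun w => running_max 1 n w ^+ 2 + running_max (-1) n w ^+ 2)%R; split.
- by apply: measurable_funD; exact: measurable_funX.
- by move=> w; rewrite addr_ge0 ?sqr_ge0.
- move=> k w kn.
  have := running_max_ge 1 w kn; have := running_max_ge (-1) w kn.
  rewrite mul1r mulN1r; set a := running_max 1 n w; set b := running_max (-1) n w.
  have [t0|t0] := lerP 0 (transform k w).
    by move=> _ h; have := sqr_ge0 b; nra.
  by move=> h _; have := sqr_ge0 a; nra.
under eq_integral do rewrite EFinD.
rewrite ge0_integralD//; try by [move=> w _; rewrite lee_fin sqr_ge0|exact: measurable_sqr].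
apply: (@le_trans _ _ (8%:E * \int[P]_w (transform n w ^+ 2)%:E)).
  rewrite (_ : 8%:E = 4%:E + 4%:E); last by rewrite -EFinD; congr EFin; lra.
  rewrite ge0_muleDl ?lee_fin// leeD// running_max_second_moment//; first by rewrite expr1n.
  by rewrite sqrrN expr1n.
apply: (@le_trans _ _ (8%:E * \sum_(k < n) (6 * (r k.+1 - r k))%:E * \int[P]_w (g k w ^+ 2)%:E)).
  by rewrite lee_wpmul2l// transform_second_moment.
rewrite ge0_sume_distrr//; last first.
  move=> k _; rewrite mule_ge0 ?lee_fin ?mulr_ge0 ?subr_ge0//.
  by apply: integral_ge0 => w _; rewrite lee_fin sqr_ge0.
apply: lee_sum => k _; rewrite muleA -EFinM.
by rewrite (_ : (8 * (6 * (r k.+1 - r k)) = 48 * (r k.+1 - r k))%R)//; lra.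
Qed.

End scalar.

End martingale_transform.

(** * Matrix integrands and truncation by the clock *)

Section matrix_transform.
Context (d0 : measure_display) (Omega : measurableType d0) (R : realType).
Context (P : probability Omega R) (F : R -> set (set Omega)).
Context (hF : usual_filtration P F) (d : nat) (B : R -> Omega -> 'cV[R]_d).
Context (hB : brownian_motion P F B).
Context (r : nat -> R) (r0 : (0 <= r 0%N)%R) (rS : forall k, (r k <= r k.+1)%R).

Definition adapted_bounded (g : nat -> Omega -> 'M[R]_d) :=
  (forall k i j, sigma_measurable (F (r k)) (fun w => g k w i j)) /\
  (forall k i j, exists K : R, forall w, `|g k w i j| <= K).

Definition mx_transform (g : nat -> Omega -> 'M[R]_d) n w : 'cV[R]_d :=
  \sum_(k < n) g k w *m (B (r k.+1) w - B (r k) w).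

(** The discrete counterpart of int |g|^2 ds, with [g k] in force on the cell from [r k] to
    [r k.+1]. *)
Definition clock (g : nat -> Omega -> 'M[R]_d) n w : R :=
  \sum_(k < n) (r k.+1 - r k) * nsq (g k w).

Local Open Scope ereal_scope.

Lemma clock_ge0 g n w : (0 <= clock g n w)%R.
Proof. by apply: sumr_ge0 => k _; rewrite mulr_ge0 ?subr_ge0// nsq_ge0. Qed.

Lemma clock_mono g k n w : (k <= n)%N -> (clock g k w <= clock g n w)%R.
Proof.
move=> kn; apply: (@homo_leq _ (fun n => clock g n w) <=%R) => //.
  by move=> y x z; exact: le_trans.
by move=> m; rewrite /clock big_ord_recr/= lerDl mulr_ge0 ?subr_ge0// nsq_ge0.
Qed.

Lemma sqr_sum_le n (a : 'I_n -> R) : ((\sum_i a i) ^+ 2 <= n%:R * \sum_i a i ^+ 2)%R.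
Proof.
rewrite expr2 big_distrlr/=.
apply: (@le_trans _ _ (\sum_i \sum_j (a i ^+ 2 / 2 + a j ^+ 2 / 2))%R).
  apply: ler_sum => i _; apply: ler_sum => j _.
  by have := sqr_ge0 (a i - a j)%R; nra.
under [leLHS]eq_bigr do rewrite big_split/= sumr_const card_ord.
rewrite big_split/= sumr_const card_ord sumrMnl -!mulr_suml -mulrnDl.
by rewrite -splitr mulr_natl.
Qed.

Lemma measurable_adapted g k i j : adapted_bounded g ->
  measurable_fun setT (fun w => g k w i j).
Proof. by move=> [mg _]; exact: (sigma_measurable_fun hF (grid_ge0 r0 rS k)). Qed.

Lemma integral_clock g n : adapted_bounded g ->
  \int[P]_w (clock g n w)%:E =
  \sum_(i < d) \sum_(j < d) \sum_(k < n) (r k.+1 - r k)%:E * \int[P]_w (g k w i j ^+ 2)%:E.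
Proof.
move=> ag.
have msq k i j : measurable_fun setT (fun w => (g k w i j ^+ 2)%:E).
  by apply: measurable_sqr; exact: measurable_adapted.
have mz k i j : measurable_fun setT (fun w => (r k.+1 - r k)%:E * (g k w i j ^+ 2)%:E).
  by apply: emeasurable_funM.
have sq0 k i j w : 0 <= (r k.+1 - r k)%:E * (g k w i j ^+ 2)%:E.
  by rewrite mule_ge0 ?lee_fin ?subr_ge0 ?sqr_ge0.
transitivity (\int[P]_w \sum_(i < d) \sum_(j < d) \sum_(k < n)
     (r k.+1 - r k)%:E * (g k w i j ^+ 2)%:E).
  apply: eq_integral => w _; rewrite /clock.
  under [in RHS]eq_bigr do under eq_bigr do rewrite sumEFin.
  under [in RHS]eq_bigr do rewrite sumEFin.
  rewrite sumEFin; congr EFin; rewrite /nsq.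
  under eq_bigr do rewrite mulr_sumr.
  rewrite exchange_big; apply: eq_bigr => i _/=.
  under eq_bigr do rewrite mulr_sumr.
  by rewrite exchange_big.
rewrite ge0_integral_sum//; last 2 first.
- move=> i; apply: emeasurable_sum => j; exact: emeasurable_sum.
- by move=> i w _; apply: sume_ge0 => j _; apply: sume_ge0.
apply: eq_bigr => i _; rewrite ge0_integral_sum//; last 2 first.
- by move=> j; exact: emeasurable_sum.
- by move=> j w _; apply: sume_ge0.
apply: eq_bigr => j _; rewrite ge0_integral_sum//.
apply: eq_bigr => k _; rewrite ge0_integralZl// ?lee_fin ?subr_ge0//.
by move=> w _; rewrite lee_fin sqr_ge0.
Qed.

(** Each entry of the vector transform is a sum of [d] scalar transforms, one per coordinate of [B];
    Cauchy-Schwarz for this sum costs the factor [d]. *)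
Lemma mx_doob_majorant g n : adapted_bounded g -> exists G : Omega -> R,
  [/\ measurable_fun setT G, forall w, (0 <= G w)%R,
   forall k w, (k <= n)%N -> (nsq (mx_transform g k w) <= G w)%R &
   \int[P]_w (G w)%:E <= (48 * d%:R)%:E * \int[P]_w (clock g n w)%:E].
Proof.
move=> ag; have [mg bg] := ag.
have H i j := doob_majorant hF hB r0 rS j (fun k => mg k i j) (fun k => bg k i j) n.
pose G i j := projT1 (cid (H i j)).
have HG i j : [/\ measurable_fun setT (G i j), forall w, (0 <= G i j w)%R,
   forall k w, (k <= n)%N -> (transform B r j (fun k w => g k w i j) k w ^+ 2 <= G i j w)%R &
   \int[P]_w (G i j w)%:E <=
     \sum_(k < n) (48 * (r k.+1 - r k))%:E * \int[P]_w (g k w i j ^+ 2)%:E].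
  exact: projT2 (cid (H i j)).
exists (fun w => d%:R * \sum_(i < d) \sum_(j < d) G i j w)%R; split.
- apply: measurable_funM => //; apply: measurable_sum => i; apply: measurable_sum => j.
  by case: (HG i j).
- move=> w; rewrite mulr_ge0//; apply: sumr_ge0 => i _; apply: sumr_ge0 => j _.
  by case: (HG i j).
- move=> k w kn; rewrite /nsq mulr_sumr; apply: ler_sum => i _.
  rewrite big_ord1.
  have -> : mx_transform g k w i ord0 =
      (\sum_(j < d) transform B r j (fun k w => g k w i j) k w)%R.
    rewrite /mx_transform summxE /transform exchange_big/=; apply: eq_bigr => l _.
    by rewrite mxE; apply: eq_bigr => j _.
  apply: le_trans (sqr_sum_le _) _; rewrite ler_wpM2l//; apply: ler_sum => j _.
  by case: (HG i j) => _ _ /(_ k w kn).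
have mG i j : measurable_fun setT (fun w => (G i j w)%:E).
  by apply/measurable_EFinP; case: (HG i j).
have G0 i j w : 0 <= (G i j w)%:E by rewrite lee_fin; case: (HG i j).
have -> : \int[P]_w (d%:R * \sum_(i < d) \sum_(j < d) G i j w)%:E =
   d%:R%:E * \sum_(i < d) \sum_(j < d) \int[P]_w (G i j w)%:E.
  transitivity (\int[P]_w (d%:R%:E * \sum_(i < d) \sum_(j < d) (G i j w)%:E)).
    apply: eq_integral => w _; rewrite EFinM; congr (_ * _).
    under [in RHS]eq_bigr do rewrite sumEFin.
    by rewrite sumEFin.
  rewrite ge0_integralZl//; last 2 first.
  - by apply: emeasurable_sum => i; exact: emeasurable_sum.
  - by move=> w _; apply: sume_ge0 => i _; apply: sume_ge0.
  congr (_ * _); rewrite ge0_integral_sum//; last 2 first.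
  - by move=> i; exact: emeasurable_sum.
  - by move=> i w _; apply: sume_ge0.
  by apply: eq_bigr => i _; rewrite ge0_integral_sum.
rewrite integral_clock// (mulrC 48%R) EFinM -muleA lee_wpmul2l ?lee_fin//.
have t0 i j k : 0 <= (r k.+1 - r k)%:E * \int[P]_w (g k w i j ^+ 2)%:E.
  rewrite mule_ge0 ?lee_fin ?subr_ge0//.
  by apply: integral_ge0 => w _; rewrite lee_fin sqr_ge0.
have t1 i j : 0 <= \sum_(k < n) (r k.+1 - r k)%:E * \int[P]_w (g k w i j ^+ 2)%:E.
  exact: sume_ge0.
rewrite ge0_sume_distrr; last by move=> i _; exact: sume_ge0.
apply: lee_sum => i _; rewrite ge0_sume_distrr//; apply: lee_sum => j _.
rewrite ge0_sume_distrr//; case: (HG i j) => _ _ _ /le_trans; apply.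
by apply: lee_sum => k _; rewrite EFinM muleA.
Qed.

(* Switching the integrand off when its clock passes N is adapted, because the
   clock at k.+1 only involves the integrand up to step k. *)
Lemma truncated_doob_majorant g n (N : R) : (0 <= N)%R -> adapted_bounded g ->
  exists G : Omega -> R,
  [/\ measurable_fun setT G, forall w, (0 <= G w)%R,
   forall w, (clock g n w <= N)%R ->
     forall k, (k <= n)%N -> (nsq (mx_transform g k w) <= G w)%R &
   \int[P]_w (G w)%:E <= (48 * d%:R)%:E * \int[P]_w (Num.min N (clock g n w))%:E].
Proof.
move=> N0 ag; have [mg bg] := ag.
pose g' k w : 'M[R]_d := if (clock g k.+1 w <= N)%R then g k w else 0%R.
have mclock k l : (k <= l)%N -> sigma_measurable (F (r l)) (clock g k.+1).
  move=> kl; apply/(sigma_measurableP hF _ (grid_ge0 r0 rS _)).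
  apply: measurable_sum => m; apply: measurable_funM => //.
  apply: measurable_nsq => i j; apply/(sigma_measurableP hF _ (grid_ge0 r0 rS _)).
  apply: (sigma_measurable_mono hF (grid_ge0 r0 rS m)) => //.
  by apply: grid_mono => //; rewrite (leq_trans _ kl)// -ltnS.
have ag' : adapted_bounded g'.
  split => [k i j|k i j].
    apply/(sigma_measurableP hF _ (grid_ge0 r0 rS _)).
    rewrite (_ : (fun w => _) = fun w => if (clock g k.+1 w <= N)%R then g k w i j else 0%R);
      last by apply/funext => w; rewrite /g'; case: ifP => //; rewrite mxE.
    apply: measurable_fun_ifT => //; last first.
      by apply/(sigma_measurableP hF _ (grid_ge0 r0 rS _)).
    apply: measurable_fun_ler => //.
    by apply/(sigma_measurableP hF _ (grid_ge0 r0 rS _)); exact: mclock.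
  have [K hK] := bg k i j; exists `|K|%R => w; rewrite /g'; case: ifP => _.
    exact: le_trans (hK w) (ler_norm _).
  by rewrite mxE normr0.
have [G [mG G0 hG iG]] := mx_doob_majorant n ag'.
have lek k w : (k <= n)%N -> (clock g n w <= N)%R -> (clock g k w <= N)%R.
  by move=> kn; apply: le_trans; exact: clock_mono.
exists G; split => //.
  move=> w cN k kn; apply: le_trans (hG k w kn).
  rewrite le_eqVlt; apply/orP; left; apply/eqP; congr nsq.
  apply: eq_bigr => l _; rewrite /g' lek//.
  by rewrite (leq_trans _ kn).
apply: le_trans iG _; rewrite lee_wpmul2l ?lee_fin ?mulr_ge0//.
apply: ge0_le_integral_nomeas => w _; first by rewrite lee_fin clock_ge0.
rewrite lee_fin le_min; apply/andP; split; last first.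
  apply: ler_sum => k _; rewrite ler_wpM2l ?subr_ge0// /g'.
  by case: ifP => // _; rewrite nsq0 nsq_ge0.
(* The truncated clock never exceeds N: if the full clock is at most N it dominates the truncated
   one, and otherwise the last step is switched off and adds nothing. *)
elim: n {G mG G0 hG lek} => [|n IH]; first by rewrite /clock big_ord0.
have [cN|cN] := lerP (clock g n.+1 w) N.
  apply: le_trans cN; apply: ler_sum => k _; rewrite ler_wpM2l ?subr_ge0// /g'.
  by case: ifP => // _; rewrite nsq0 nsq_ge0.
have gn : g' n w = 0%R by rewrite /g' leNgt cN.
by apply: le_trans IH; rewrite /clock big_ord_recr/= gn nsq0 mulr0 addr0.
Qed.

End matrix_transform.

(** * Simple processes on a common grid *)

Section grid.
Context (R : realType).

(** The points are sorted without repetition. Past the last index [nth] returns its default [t], so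
    the grid is constant there: it increases weakly for all [k] and strictly below [n]. *)
Lemma grid_exists (t : R) (l : seq R) : 0 <= t -> (forall s, s \in l -> 0 <= s <= t) ->
  exists (r : nat -> R) (n : nat),
  [/\ r 0%N = 0, r n = t, forall k, r k <= r k.+1,
      forall k, (k < n)%N -> r k < r k.+1 &
      forall s, s \in l -> exists2 k, (k <= n)%N & r k = s].
Proof.
move=> t0 lt.
pose g := sort <=%R (undup [:: 0, t & l]).
have gin s : s \in g -> 0 <= s <= t.
  by rewrite mem_sort mem_undup !inE => /or3P[/eqP->|/eqP->|/lt//]; rewrite ?lexx ?t0.
have srt : sorted <%R g by rewrite lt_sorted_uniq_le sort_uniq undup_uniq/= sort_le_sorted.
have g0 : 0 \in g by rewrite mem_sort mem_undup !inE eqxx.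
have gt : t \in g by rewrite mem_sort mem_undup !inE eqxx orbT.
have sz : (0 < size g)%N by case: g g0 {gin srt gt}.
have szK : (size g).-1.+1 = size g by rewrite prednK.
have strict k : (k < (size g).-1)%N -> nth t g k < nth t g k.+1.
  move=> kn; have kn' : (k.+1 < size g)%N by rewrite -szK ltnS.
  by apply: (sorted_ltn_nth lt_trans) => //; rewrite inE// ltnW.
have mono i j : (i <= j)%N -> (j < size g)%N -> nth t g i <= nth t g j.
  move=> ij jg; move: ij; rewrite leq_eqVlt => /predU1P[->//|ij].
  by apply/ltW/(sorted_ltn_nth lt_trans) => //; rewrite inE// (ltn_trans ij).
exists (nth t g), (size g).-1; split.
- apply/eqP; rewrite eq_le; apply/andP; split.
    have := mono 0%N (index 0 g) isT; rewrite nth_index// index_mem => -> //.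
  by have /gin/andP[] := mem_nth t sz.
- apply/eqP; rewrite eq_le; apply/andP; split.
    have lastlt : ((size g).-1 < size g)%N by rewrite ltn_predL.
    by have /gin/andP[] := mem_nth t lastlt.
  have := mono (index t g) (size g).-1; rewrite nth_index// szK => -> //.
  by rewrite -ltnS szK index_mem.
- move=> k; have [kn|kn] := ltnP k (size g).-1; first exact/ltW/strict.
  have [kg|kg] := ltnP k (size g); last by rewrite !nth_default// ltnW.
  rewrite [leRHS]nth_default; last by rewrite -szK ltnS.
  by have /gin/andP[] := mem_nth t kg.
- exact: strict.
- move=> s sl; have sg : s \in g by rewrite mem_sort mem_undup !inE sl !orbT.
  by exists (index s g); rewrite ?nth_index// -ltnS szK index_mem.
Qed.

End grid.

Section refinement.
Context (d0 : measure_display) (Omega : measurableType d0) (R : realType).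
Context (P : probability Omega R) (F : R -> set (set Omega)).
Context (hF : usual_filtration P F) (d : nat) (B : R -> Omega -> 'cV[R]_d).
Context (hB : brownian_motion P F B).
Implicit Type G : simple_process Omega R d.

Lemma simple_time_mono G i j : simple_wf F G -> (i <= j <= sp_size G)%N ->
  sp_time G i <= sp_time G j.
Proof.
move=> [_ tS _ _]; elim: j => [|j IH]; first by rewrite leqn0 => /andP[/eqP->].
move=> /andP[ij jn]; move: ij; rewrite leq_eqVlt => /predU1P[->//|].
rewrite ltnS => ij; apply: le_trans (tS j jn); apply: IH.
by rewrite ij ltnW.
Qed.

Lemma simple_time_ge0 G i : simple_wf F G -> (i <= sp_size G)%N -> 0 <= sp_time G i.
Proof.
move=> wf iG; have [t0 _ _ _] := wf; apply: le_trans t0 _.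
exact: (simple_time_mono wf).
Qed.

Lemma simple_evalE G s w i j : simple_eval G s w i j =
  \sum_(k < sp_size G) (if sp_time G k < s <= sp_time G k.+1 then sp_val G k w i j else 0).
Proof.
rewrite /simple_eval summxE big_mkcond/=; apply: eq_bigr => k _.
by case: ifP.
Qed.

Lemma measurable_simple_eval G i j : simple_wf F G ->
  measurable_fun setT (fun z : R * Omega => simple_eval G z.1 z.2 i j).
Proof.
move=> wf; have [_ _ mv _] := wf.
under eq_fun do rewrite simple_evalE.
apply: measurable_sum => k; apply: measurable_fun_ifT.
- apply: measurable_and.
    by apply: measurable_fun_ltr => //; exact: measurable_fst.
  by apply: measurable_fun_ler => //; exact: measurable_fst.
- apply: (@measurableT_comp _ _ _ _ _ _ (fun w => sp_val G k w i j)) => //.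
  apply: (sigma_measurable_fun hF (simple_time_ge0 wf (ltnW (ltn_ord k)))).
  by apply: measurable_wrt_coord; exact: mv.
- exact: measurable_cst.
Qed.

Section on_grid.
Context (r : nat -> R) (n : nat) (r0 : r 0%N = 0) (rS : forall k, r k <= r k.+1).
Context (rlt : forall k, (k < n)%N -> r k < r k.+1).

Let r0' : 0 <= r 0%N. Proof. by rewrite r0. Qed.

Lemma grid_lt a b : (b <= n)%N -> (r a < r b) = (a < b)%N.
Proof.
move=> bn; apply/idP/idP => [|ab].
  by apply: contraTT; rewrite -leqNgt -leNgt => /(grid_mono rS).
case: b bn ab => // b bn; rewrite ltnS => ab.
exact: le_lt_trans (grid_mono rS ab) (rlt bn).
Qed.

Lemma grid_le a b : (a <= n)%N -> (r a <= r b) = (a <= b)%N.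
Proof. by move=> an; rewrite leNgt grid_lt// -leqNgt. Qed.

(** Jump times after [r n] are left free: integrals are taken up to [r n] only. *)
Definition on_grid G := forall i, (i <= sp_size G)%N -> sp_time G i <= r n ->
  exists2 k, (k <= n)%N & r k = sp_time G i.

(** A simple process is left-continuous, so its value on the cell []r k, r k.+1]] is read at the
    right end once its jumps lie on the grid. *)
Definition grid_val G k w : 'M[R]_d := if (k < n)%N then simple_eval G (r k.+1) w else 0.

(** Although the value is read at [r k.+1], it is known at [r k]: the terms in force started
    strictly before [r k.+1], and a start on the grid is then at most [r k]. *)
Lemma adapted_bounded_grid_val G : simple_wf F G -> on_grid G ->
  adapted_bounded F r (grid_val G).
Proof.
move=> wf og; have [_ _ mv [M bM]] := wf; split => k i j.
  apply/(sigma_measurableP hF _ (grid_ge0 r0' rS _)); rewrite /grid_val.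
  have [kn|kn] := ltnP k n; last first.
    by rewrite (_ : (fun _ => _) = cst 0)//; apply/funext => w; rewrite mxE.
  under eq_fun do rewrite simple_evalE.
  apply: measurable_sum => m.
  have [/andP[mr _]|_] := boolP (sp_time G m < r k.+1 <= sp_time G m.+1); last first.
    exact: measurable_cst.
  have tr : sp_time G m <= r n.
    by apply: ltW; apply: lt_le_trans mr _; exact: (grid_mono rS).
  have [l ln lm] := og m (ltnW (ltn_ord m)) tr.
  apply/(sigma_measurableP hF _ (grid_ge0 r0' rS _)).
  have lk : r l <= r k by apply: grid_mono => //; rewrite -ltnS -(grid_lt l)// lm.
  apply: (sigma_measurable_mono hF _ lk); first exact: grid_ge0.
  by rewrite lm; apply: measurable_wrt_coord; exact: mv.
exists (\sum_(m < sp_size G) `|M|) => w; rewrite /grid_val.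
case: ifP => kn; last by rewrite mxE normr0 sumr_ge0.
rewrite simple_evalE; apply: le_trans (ler_norm_sum _ _ _) _; apply: ler_sum => m _.
case: ifP => _; last by rewrite normr0.
apply: le_trans (ler_norm M); apply: le_trans (bM m w (ltn_ord m)).
rewrite -[leLHS]sqrtr_sqr /enorm ler_sqrt ?nsq_ge0//; exact: sqr_coord_le_nsq.
Qed.

(** The increment of [B] between consecutive jump times, stopped at [r m], telescopes over the cells
    it covers; exchanging the two sums collects the values in force on each cell. *)
Lemma simple_integral_grid G m w : simple_wf F G -> on_grid G -> (m <= n)%N ->
  simple_integral B G (r m) w =
  \sum_(k < m) grid_val G k w *m (B (r k.+1) w - B (r k) w).
Proof.
move=> wf og mn.
have mingrid i : (i <= sp_size G)%N ->
    exists2 a, (a <= m)%N & r a = Num.min (r m) (sp_time G i).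
  move=> iG; have [h|h] := leP (r m) (sp_time G i); first by exists m.
  have [a an ra] := og i iG (le_trans (ltW h) (grid_mono rS mn)).
  by exists a => //; rewrite -ltnS ltnW// ltnS -(grid_lt a)// ra.
have tele i : (i < sp_size G)%N ->
    B (Num.min (r m) (sp_time G i.+1)) w - B (Num.min (r m) (sp_time G i)) w =
    \sum_(k < m | sp_time G i < r k.+1 <= sp_time G i.+1) (B (r k.+1) w - B (r k) w).
  move=> iG; have [a am ra] := mingrid i (ltnW iG); have [b bm rb] := mingrid i.+1 iG.
  have tS : sp_time G i <= sp_time G i.+1 by case: wf => _ h _ _; exact: h.
  have ab : (a <= b)%N.
    rewrite -(grid_le b) ?(leq_trans am)// ra rb.
    by rewrite le_min !ge_min lexx/= tS orbT.
  rewrite -ra -rb -(telescope_sumr (fun k => B (r k) w) ab).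
  rewrite (big_nat_widen _ _ m)// (big_nat_widenl _ 0%N)// big_mkord.
  apply: eq_bigl => k /=; rewrite andbC; congr (_ && _).
    rewrite -ltnS -(grid_lt a); last exact: leq_trans (ltn_ord k) mn.
    rewrite ra gt_min [r m < _]le_gtF//; exact: (grid_mono rS).
  rewrite -(grid_le b); last exact: leq_trans (ltn_ord k) mn.
  by rewrite rb le_min (grid_mono rS (ltn_ord k)).
rewrite /simple_integral.
under eq_bigr => i _ do rewrite (tele i (ltn_ord i)) mulmx_sumr big_mkcond.
rewrite exchange_big/=; apply: eq_bigr => k _.
rewrite /grid_val (leq_trans (ltn_ord k) mn) /simple_eval mulmx_suml [RHS]big_mkcond/=.
by apply: eq_bigr => i _; case: ifP.
Qed.

Lemma simple_eval_grid G k s w : simple_wf F G -> on_grid G -> (k < n)%N ->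
  r k < s <= r k.+1 -> simple_eval G s w = grid_val G k w.
Proof.
move=> wf og kn /andP[ks sk]; rewrite /grid_val kn /simple_eval; apply: eq_bigl => i.
have onl j : (j <= sp_size G)%N -> sp_time G j < r k.+1 -> sp_time G j <= r k.
  move=> jG jk; have [l ln lE] := og j jG (le_trans (ltW jk) (grid_mono rS kn)).
  by rewrite -lE; apply: grid_mono => //; rewrite -ltnS -(grid_lt l)// lE.
have iG : (i <= sp_size G)%N by exact: ltnW.
congr (_ && _).
  apply/idP/idP => h; first exact: lt_le_trans h sk.
  exact: le_lt_trans (onl _ iG h) ks.
apply/idP/idP => h; last exact: le_trans sk h.
rewrite leNgt; apply/negP => /(onl _ (ltn_ord i)) h'.
by have := le_lt_trans h' ks; rewrite ltNge h.
Qed.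

Local Open Scope ereal_scope.

Lemma integral_simple_grid G1 G2 w : simple_wf F G1 -> simple_wf F G2 ->
  on_grid G1 -> on_grid G2 ->
  \int[lebesgue_measure]_(s in `[0%R, r n])
     (nsq (simple_eval G1 s w - simple_eval G2 s w))%:E =
  (clock r (fun k w => grid_val G1 k w - grid_val G2 k w)%R n w)%:E.
Proof.
move=> wf1 wf2 og1 og2.
pose f s := (nsq (simple_eval G1 s w - simple_eval G2 s w))%:E : \bar R.
have mf D : measurable D -> measurable_fun D f.
  move=> mD; apply: measurable_funTS; apply/measurable_EFinP; apply: measurable_nsq => i j.
  under eq_fun do rewrite mxE [X in (_ + X)%R]mxE.
  have mw : measurable_fun setT (fun s : R => (s, w)) by exact: measurable_fun_pair.
  apply: measurable_funB.
    exact: (measurableT_comp (measurable_simple_eval i j wf1) mw).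
  exact: (measurableT_comp (measurable_simple_eval i j wf2) mw).
have f0 s : 0 <= f s by rewrite lee_fin nsq_ge0.
(* The point 0 belongs to no cell []r k, r k.+1]]; it is dropped as a null set. *)
rewrite -(@integral_itv_obnd_cbnd _ 0%R (BRight (r n)))//; last exact: mf.
suff H m : (m <= n)%N -> \int[lebesgue_measure]_(s in `]0%R, r m]) f s =
   (clock r (fun k w => grid_val G1 k w - grid_val G2 k w)%R m w)%:E by exact: H.
elim: m => [|m IH] mn.
  by rewrite r0 set_itvoc0 integral_set0 /clock big_ord0.
have -> : `]0%R, r m.+1]%classic = `]0%R, r m]%classic `|` `]r m, r m.+1]%classic :> set R.
  rewrite -itv_bndbnd_setU// ?bnd_simp; first exact: (grid_ge0 r0' rS).
  exact: rS.
rewrite ge0_integral_setU//; last 2 first.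
- by apply: mf; exact: measurableU.
- apply/disj_setPLR => s/=; rewrite !in_itv/= => /andP[_ sm]; apply/negP.
  by rewrite negb_and -leNgt sm.
rewrite IH 1?ltnW// /clock big_ord_recr/= EFinD; congr (_ + _).
transitivity (\int[lebesgue_measure]_(s in `]r m, r m.+1])
    (nsq (grid_val G1 m w - grid_val G2 m w))%:E).
  apply: eq_integral => s; rewrite inE/= in_itv/= => sm.
  by rewrite /f !(simple_eval_grid _ _ _ mn sm).
rewrite integral_cst//= lebesgue_measure_itv/= lte_fin rlt//.
by rewrite -EFinD -EFinM mulrC.
Qed.

End on_grid.

Local Open Scope ereal_scope.

(** The grid gathers the jump times of both processes up to [t] and the sample times [qs], so the
    difference is a single transform on it. The final bound does not involve [qs], which allows the
    sample to fill a dense set later. *)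
Lemma simple_pair_majorant G1 G2 (t N : R) (qs : seq R) :
  simple_wf F G1 -> simple_wf F G2 -> (0 <= t)%R -> (0 <= N)%R ->
  (forall q, q \in qs -> (0 <= q <= t)%R) ->
  let V w := \int[lebesgue_measure]_(s in `[0%R, t])
     (nsq (simple_eval G1 s w - simple_eval G2 s w))%:E in
  exists G : Omega -> R,
  [/\ measurable_fun setT G, forall w, (0 <= G w)%R,
   forall w, V w <= N%:E -> forall q, q \in qs ->
     (nsq (simple_integral B G1 q w - simple_integral B G2 q w) <= G w)%R &
   \int[P]_w (G w)%:E <= (48 * d%:R)%:E * \int[P]_w (mine N%:E (V w))].
Proof.
move=> wf1 wf2 t0 N0 qst V.
pose times G := [seq s <- [seq sp_time G i | i <- iota 0 (sp_size G).+1] | (s <= t)%R].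
have timesP G i : (i <= sp_size G)%N -> (sp_time G i <= t)%R -> sp_time G i \in times G.
  move=> iG it; rewrite mem_filter it; apply/mapP; exists i => //.
  by rewrite mem_iota.
have times_in G s : simple_wf F G -> s \in times G -> (0 <= s <= t)%R.
  move=> wf; rewrite mem_filter => /andP[st /mapP[i]]; rewrite mem_iota => iG sE.
  by rewrite st andbT sE; exact: simple_time_ge0.
have lt s : s \in qs ++ times G1 ++ times G2 -> (0 <= s <= t)%R.
  by rewrite !mem_cat => /or3P[/qst|/(times_in _ _ wf1)|/(times_in _ _ wf2)].
have [r [n [r0 rn rS rlt rl]]] := grid_exists t0 lt.
have r0' : (0 <= r 0%N)%R by rewrite r0.
have og1 : on_grid r n G1.
  move=> i iG; rewrite rn => it; apply: rl.
  by rewrite !mem_cat (timesP _ _ iG it) orbT.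
have og2 : on_grid r n G2.
  move=> i iG; rewrite rn => it; apply: rl.
  by rewrite !mem_cat (timesP _ _ iG it) !orbT.
pose g k w := (grid_val r n G1 k w - grid_val r n G2 k w)%R.
have [ad1 b1] := adapted_bounded_grid_val r0 rS rlt wf1 og1.
have [ad2 b2] := adapted_bounded_grid_val r0 rS rlt wf2 og2.
have ag : adapted_bounded F r g.
  split => k i j.
    apply/(sigma_measurableP hF _ (grid_ge0 r0' rS _)).
    rewrite /g; under eq_fun do rewrite mxE [X in (_ + X)%R]mxE.
    apply: measurable_funB; apply/(sigma_measurableP hF _ (grid_ge0 r0' rS _)).
      exact: ad1.
    exact: ad2.
  have [K1 h1] := b1 k i j; have [K2 h2] := b2 k i j; exists (K1 + K2)%R => w.
  by rewrite !mxE; apply: le_trans (ler_normB _ _) _; exact: lerD.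
have VE w : V w = (clock r g n w)%:E.
  by rewrite /V -rn; exact: integral_simple_grid.
have [G [mG G0 hG iG]] := truncated_doob_majorant hF hB r0' rS n N0 ag.
exists G; split => //.
  move=> w; rewrite VE lee_fin => cN q qqs.
  have [|k kn <-] := rl q; first by rewrite mem_cat qqs.
  apply: le_trans (hG w cN k kn); rewrite le_eqVlt; apply/orP; left; apply/eqP.
  congr nsq; rewrite !(@simple_integral_grid r n)// -sumrB; apply: eq_bigr => l _.
  by rewrite -mulmxBl.
apply: le_trans iG _; rewrite le_eqVlt; apply/orP; left; apply/eqP; congr (_ * _).
by apply: eq_integral => w _; rewrite VE EFin_min.
Qed.

End refinement.

(** * Joint measurability and continuous paths *)

Section section_integrals.
Context (d0 : measure_display) (Omega : measurableType d0) (R : realType).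
Context (P : probability Omega R).
Local Notation mu := (@lebesgue_measure R).
Local Open Scope ereal_scope.
Implicit Types (D : set R) (f : R * Omega -> \bar R).

(** Integrands are measurable only on a strip of times, whereas Tonelli's theorem is applied to
    total functions; extension by zero connects the two. *)
Let patchE D f s w : (f \_ (D `*` setT)) (s, w) = ((fun s => f (s, w)) \_ D) s.
Proof.
rewrite /patch; have [sD|sD] := boolP (s \in D).
  by rewrite ifT// in_setX sD in_setT.
by rewrite ifF// in_setX (negbTE sD).
Qed.

Let patch_integral D f w :
  \int[mu]_(s in D) f (s, w) = \int[mu]_s (f \_ (D `*` setT)) (s, w).
Proof. by rewrite integral_mkcond; apply: eq_integral => s _; rewrite patchE. Qed.

Let patch_measurable D f : measurable D -> measurable_fun (D `*` setT) f ->
  measurable_fun setT (f \_ (D `*` setT)).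
Proof. by move=> mD mf; apply/(measurable_restrictT _ _).1 => //; exact: measurableX. Qed.

Let patch_ge0 D f : (forall z, D z.1 -> 0 <= f z) -> forall z, 0 <= (f \_ (D `*` setT)) z.
Proof. by move=> f0 z; apply: erestrict_ge0 => y [Dy _]; exact: f0. Qed.

Lemma measurable_section_integral D f : measurable D ->
  measurable_fun (D `*` setT) f -> (forall z, D z.1 -> 0 <= f z) ->
  measurable_fun setT (fun w => \int[mu]_(s in D) f (s, w)).
Proof.
move=> mD mf f0; under eq_fun do rewrite patch_integral.
apply: (@measurable_fun_fubini_tonelli_G _ _ (measurableTypeR R) Omega R mu).
  exact: patch_measurable.
exact: patch_ge0.
Qed.

Lemma measurable_section_expectation D f : measurable D ->
  measurable_fun (D `*` setT) f -> (forall z, D z.1 -> 0 <= f z) ->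
  measurable_fun D (fun s => \int[P]_w f (s, w)).
Proof.
move=> mD mf f0; apply/(measurable_restrictT _ _).2 => //.
rewrite (_ : _ \_ D = fun s => \int[P]_w (f \_ (D `*` setT)) (s, w)).
  apply: (@measurable_fun_fubini_tonelli_F _ _ (measurableTypeR R) Omega R P).
    exact: patch_measurable.
  exact: patch_ge0.
apply/funext => s; rewrite {1}/patch; case: ifPn => sD.
  by apply: eq_integral => w _; rewrite patchE /patch sD.
by under eq_integral do rewrite patchE /patch (negbTE sD); rewrite integral0.
Qed.

Lemma tonelli_on D f : measurable D ->
  measurable_fun (D `*` setT) f -> (forall z, D z.1 -> 0 <= f z) ->
  \int[P]_w \int[mu]_(s in D) f (s, w) = \int[mu]_(s in D) \int[P]_w f (s, w).
Proof.
move=> mD mf f0; under eq_integral do rewrite patch_integral.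
rewrite -(@fubini_tonelli _ _ (measurableTypeR R) Omega R mu P); last 2 first.
- exact: patch_measurable.
- exact: patch_ge0.
rewrite [RHS]integral_mkcond; apply: eq_integral => s _; rewrite [RHS]/patch.
case: ifPn => sD.
  by apply: eq_integral => w _; rewrite patchE /patch sD.
by under eq_integral do rewrite patchE /patch (negbTE sD); rewrite integral0.
Qed.

Lemma measurable_section D f w : measurable D -> measurable_fun (D `*` setT) f ->
  measurable_fun D (fun s => f (s, w)).
Proof.
move=> mD mf; apply/(measurable_restrictT _ _).2 => //.
rewrite (_ : _ \_ D = (f \_ (D `*` setT)) \o (fun s => (s, w))); last first.
  by apply/funext => s /=; rewrite patchE.
apply: measurableT_comp; first exact: patch_measurable.
exact: measurable_fun_pair.
Qed.

End section_integrals.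

Section continuous_paths.
Context (R : realType).

Lemma within_continuous_coord (A : set R) m n (f : R -> 'M[R]_(m, n)) i j :
  {within A, continuous f} -> {within A, continuous (fun s => f s i j)}.
Proof.
move=> cf s.
apply: (@cvg_comp _ _ _ (f : subspace A -> _) (fun M => M i j) _ (nbhs (f s))).
  exact: cf.
exact: coord_continuous.
Qed.

Lemma within_continuous_nsq (A : set R) m n (f : R -> 'M[R]_(m, n)) :
  (forall i j, {within A, continuous (fun s => f s i j)}) ->
  {within A, continuous (fun s => nsq (f s))}.
Proof.
move=> cf s; apply: cvg_big => [|i _]; first exact: add_continuous.
apply: cvg_big => [|j _]; first exact: add_continuous.
by apply: cvgM; exact: cf.
Qed.

Lemma within_continuous_enorm (A : set R) m n (f : R -> 'M[R]_(m, n)) :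
  (forall i j, {within A, continuous (fun s => f s i j)}) ->
  {within A, continuous (fun s => enorm (f s))}.
Proof.
move=> cf s; apply: (@cvg_comp _ _ _ ((fun s => nsq (f s)) : subspace A -> _) Num.sqrt _ (nbhs (nsq (f s)))).
  exact: within_continuous_nsq.
exact: sqrt_continuous.
Qed.

(** The nonnegative rationals cut off at [t], enumerated through [unpickle]; a code of no pair
    defaults to the fraction 0/1. The cut-off makes [t] itself a member. *)
Definition dense_seq (t : R) (i : nat) : R :=
  let ab := odflt (0%N, 0%N) (unpickle i) in Num.min t (ab.1%:R / ab.2.+1%:R).

Lemma dense_seq_in t i : 0 <= t -> dense_seq t i \in `[0, t].
Proof. by move=> t0; rewrite in_itv/= le_min t0 divr_ge0//= ge_min lexx. Qed.

Lemma dense_seq_last t : exists i, dense_seq t i = t.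
Proof.
exists (pickle ((Num.truncn t).+1, 0%N)); rewrite /dense_seq pickleK/= divr1.
by rewrite min_l// ltW// truncnS_gt.
Qed.

Lemma dense_seqP t s e : s \in `[0, t] -> 0 < e -> exists i, `|s - dense_seq t i| < e.
Proof.
rewrite in_itv/= => /andP[s0 st] e0.
have [b be] : exists b : nat, b.+1%:R^-1 < e.
  exists (Num.truncn e^-1); rewrite invf_plt ?posrE//.
  by rewrite truncnS_gt// num_real.
pose a := Num.truncn (s * b.+1%:R).
have sb0 : 0 <= s * b.+1%:R by rewrite mulr_ge0.
have /andP[a1 a2] : a%:R <= s * b.+1%:R < a.+1%:R by exact: truncn_itv.
exists (pickle (a, b)); rewrite /dense_seq pickleK/=.
have as_ : a%:R / b.+1%:R <= s by rewrite ler_pdivrMr.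
rewrite min_r ?(le_trans as_)// ger0_norm ?subr_ge0//.
apply: lt_trans be; rewrite ltrBlDl -[X in _ < _ + X]mul1r -mulrDl.
by rewrite ltr_pdivlMr// natr1.
Qed.

Local Open Scope ereal_scope.

Lemma ereal_sup_dense (t : R) (f : R -> R) : (0 <= t)%R ->
  {within `[0%R, t], continuous f} ->
  ereal_sup [set (f s)%:E | s in `[0%R, t]] =
  ereal_sup (range (fun i => (f (dense_seq t i))%:E)).
Proof.
move=> t0 cf; apply/eqP; rewrite eq_le; apply/andP; split; last first.
  apply: le_ereal_sup => _ [i _ <-]; exists (dense_seq t i) => //.
  exact: dense_seq_in.
apply: ub_ereal_sup => _ [s /= st <-].
apply/lee_addgt0Pr => e e0.
move/subspace_continuousP: cf => /(_ s st) /cvgrPdist_lt /(_ e e0).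
rewrite near_withinE => /nbhs_ballP[/= a a0 /= ha].
have [i si] := dense_seqP st a0.
have := ha (dense_seq t i) si (dense_seq_in i t0) => h.
apply: (@le_trans _ _ ((f (dense_seq t i))%:E + e%:E)).
  by rewrite -EFinD lee_fin -lerBlDl ltW// (le_lt_trans (ler_norm _) h).
by rewrite leeD2r//; apply: ereal_sup_ubound; exists i.
Qed.

End continuous_paths.

Section jointly_measurable.
Context (d0 : measure_display) (Omega : measurableType d0) (R : realType).

Lemma measurable_continuous_process (Y : R -> Omega -> R) :
  (forall s, measurable_fun setT (Y s)) -> (forall w, continuous (Y ^~ w)) ->
  measurable_fun setT (fun z : R * Omega => Y z.1 z.2).
Proof.
move=> mY cY.
pose p (m : nat) (s : R) : R := (Num.floor (m.+1%:R * s))%:~R / m.+1%:R.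
apply: (@measurable_fun_cvg _ _ _ _ (fun m (z : R * Omega) => Y (p m z.1) z.2)).
  move=> m _ A mA; rewrite setTI.
  rewrite (_ : _ @^-1` A = \bigcup_(k in [set: int])
     ([set s : R | Num.floor (m.+1%:R * s) = k] `*` [set w | A (Y (k%:~R / m.+1%:R) w)])).
    apply: countable_bigcupT_measurable => // k; apply: measurableX.
      rewrite (_ : [set s | _] = `[k%:~R / m.+1%:R, (k + 1)%:~R / m.+1%:R[%classic)//.
      apply/seteqP; split => s /=; rewrite in_itv/= ler_pdivrMr// ltr_pdivlMr// mulrC.
        by move=> <-; rewrite floor_itv ?num_real.
      by move=> h; apply: floor_def.
    by rewrite -[X in measurable X]setTI; exact: mY.
  apply/seteqP; split => [z /= Az|z [k _ [/= fk Ak]]]; last by rewrite /p fk.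
  by exists (Num.floor (m.+1%:R * z.1)).
move=> z _; apply: (@cvg_comp _ _ _ (p ^~ z.1) (Y ^~ z.2) _ (nbhs z.1)); last exact: cY.
apply/cvgrPdist_lt => e e0; near=> m.
have m0 : (0 : R) < m.+1%:R by [].
have /andP[h1 h2] := @floor_itv R (m.+1%:R * z.1).
have pz : p m z.1 <= z.1 by rewrite /p ler_pdivrMr// [leRHS]mulrC.
rewrite ger0_norm ?subr_ge0//.
apply: (@lt_le_trans _ _ m.+1%:R^-1).
  rewrite ltrBlDl -[X in _ < _ + X]mul1r -mulrDl ltr_pdivlMr// [ltLHS]mulrC.
  by rewrite intrD in h2.
apply: ltW; near: m; exact: near_infty_natSinv_lt (PosNum e0).
Unshelve. all: by end_near. Qed.

End jointly_measurable.

(** * The maximal inequality for Ito integrals *)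

Section ito_estimate.
Context (d0 : measure_display) (Omega : measurableType d0) (R : realType).
Context (P : probability Omega R) (F : R -> set (set Omega)).
Context (hF : usual_filtration P F) (d : nat) (B : R -> Omega -> 'cV[R]_d).
Context (hB : brownian_motion P F B).
Implicit Type G : simple_process Omega R d.
Local Notation mu := (@lebesgue_measure R).

Lemma usual_complete : measure_is_complete P.
Proof.
move=> N hN; apply: (filtration_sub hF (lexx 0)).
by case: hF => _ _ _; apply.
Qed.

(** Only the time [T] of the definition is used: the generating rectangles are measurable, and
    measurable sets are closed under complement in the strip and countable union. *)
Lemma progressive_measurable (T : R) m n (H : R -> Omega -> 'M[R]_(m, n)) i j : 0 <= T ->
  progressive F T H ->
  measurable_fun (`[0, T] `*` setT) (fun z : R * Omega => H z.1 z.2 i j).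
Proof.
move=> T0 /(_ T) pH _ A mA.
have TT : T \in `[0, T] by rewrite in_itv/= T0 lexx.
have mA' : measurable [set v : 'M[R]_(m, n) | A (v i j)].
  by rewrite -[X in measurable X]setTI; exact: measurable_mxcoord.
have := pH TT _ mA'; apply; split.
  split; first exact: measurable0.
    by move=> C mC; apply: measurableD => //; exact: measurableX.
  by move=> C mC; exact: bigcupT_measurable.
move=> _ [C [E [mC _ FE ->]]]; apply: measurableX => //.
exact: (filtration_sub hF T0).
Qed.

Lemma continuous_min (T c : R) (f : R -> R) : 0 <= c ->
  {within [set s : R | 0 <= s], continuous f} ->
  {within `[0, T], continuous (fun s => f (Num.min s c))}.
Proof.
move=> c0 /subspace_continuousP cf; apply/subspace_continuousP => s sT.
have s0 : 0 <= s by move: sT; rewrite /= in_itv/= => /andP[].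
have m0 : 0 <= Num.min s c by rewrite le_min s0 c0.
apply/cvgrPdist_lt => e e0.
move/cvgrPdist_lt: (cf _ m0) => /(_ e e0); rewrite !near_withinE.
move=> /nbhs_ballP[a /= a0 ha]; apply/nbhs_ballP; exists a => // s' /= ss' s'T.
have s'0 : 0 <= s' by move: s'T; rewrite /= in_itv/= => /andP[].
apply: ha => /=; last by rewrite le_min s'0 c0.
move: ss'; rewrite /ball/=; apply: le_lt_trans.
have [h1|h1] := leP s c; have [h2|h2] := leP s' c;
  rewrite ?subrr ?normr0 ?normr_ge0//.
  rewrite [leLHS]ler0_norm ?[leRHS]ler0_norm; lra.
rewrite [leLHS]ger0_norm ?[leRHS]ger0_norm; lra.
Qed.

Lemma simple_integral_coordE G t w i : simple_integral B G t w i 0 =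
  \sum_(k < sp_size G) \sum_(j < d) sp_val G k w i j *
    (B (Num.min t (sp_time G k.+1)) w j 0 - B (Num.min t (sp_time G k)) w j 0).
Proof.
rewrite /simple_integral summxE; apply: eq_bigr => k _.
by rewrite mxE; apply: eq_bigr => j _; rewrite !mxE.
Qed.

Lemma continuous_simple_integral G (T : R) w i : simple_wf F G ->
  {within [set s : R | 0 <= s], continuous (B ^~ w)} ->
  {within `[0, T], continuous (fun t => simple_integral B G t w i 0)}.
Proof.
move=> wf cB.
have cBj c j : 0 <= c -> {within `[0, T], continuous (fun s => B (Num.min s c) w j 0)}.
  move=> c0; apply: (@continuous_min _ _ (fun s => B s w j 0)) => //.
  exact: within_continuous_coord.
rewrite (_ : (fun t => _) = (fun t => \sum_(k < sp_size G) \sum_(j < d) sp_val G k w i j *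
    (B (Num.min t (sp_time G k.+1)) w j 0 - B (Num.min t (sp_time G k)) w j 0)));
  last by apply/funext => t; exact: simple_integral_coordE.
move=> s; apply: cvg_big => [|k _]; first exact: add_continuous.
apply: cvg_big => [|j _]; first exact: add_continuous.
apply: cvgM; first exact: cvg_cst.
apply: cvgB; apply: cBj; apply: (simple_time_ge0 wf) => //; exact: ltnW.
Qed.

Lemma measurable_simple_integral G t i : simple_wf F G -> 0 <= t ->
  measurable_fun setT (fun w => simple_integral B G t w i 0).
Proof.
move=> wf t0; under eq_fun do rewrite simple_integral_coordE.
have mB c j : 0 <= c -> measurable_fun setT (fun w => B c w j 0).
  move=> c0; apply: (sigma_measurable_fun hF c0).
  by apply: measurable_wrt_coord; case: hB => h _ _ _; exact: h.
have [_ _ mv _] := wf.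
apply: measurable_sum => k; apply: measurable_sum => j; apply: measurable_funM.
  apply: (sigma_measurable_fun hF (simple_time_ge0 wf (ltnW (ltn_ord k)))).
  by apply: measurable_wrt_coord; exact: mv.
by apply: measurable_funB; apply: mB; rewrite le_min t0 (simple_time_ge0 wf)// ltnW.
Qed.

Lemma measurable_enorm (D : set Omega) m n (f : Omega -> 'M[R]_(m, n)) :
  (forall i j, measurable_fun D (fun x => f x i j)) ->
  measurable_fun D (fun x => enorm (f x)).
Proof.
move=> mf; apply: (@measurableT_comp _ _ _ _ _ _ (@Num.sqrt R)).
  by apply: continuous_measurable_fun => x; exact: sqrt_continuous.
exact: measurable_nsq.
Qed.

Local Open Scope ereal_scope.

Lemma measurable_dense_sup (t : R) (Z : R -> Omega -> R) : (0 <= t)%R ->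
  (forall s, s \in `[0%R, t] -> measurable_fun setT (Z s)) ->
  measurable_fun setT (fun w => ereal_sup (range (fun i => (Z (dense_seq t i) w)%:E))).
Proof.
move=> t0 mZ.
rewrite (_ : (fun w => _) = fun w => esups (fun i => (Z (dense_seq t i) w)%:E) 0%N).
  apply: measurable_fun_esups => i; apply/measurable_EFinP; apply: mZ.
  exact: dense_seq_in.
apply/funext => w; rewrite /esups; congr ereal_sup.
by apply/seteqP; split => [_ [i _ <-]|_ [i _ <-]]; exists i.
Qed.

(** Almost surely the supremum equals a countable one, and completeness of the measure carries
    measurability across the null set. *)
Lemma measurable_path_sup (t : R) (Z : R -> Omega -> R) : (0 <= t)%R ->
  (forall s, s \in `[0%R, t] -> measurable_fun setT (Z s)) ->
  {ae P, forall w, {within `[0%R, t], continuous (Z ^~ w)}} ->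
  measurable_fun setT (fun w => ereal_sup [set (Z s w)%:E | s in `[0%R, t]]).
Proof.
move=> t0 mZ cZ.
apply: (ae_measurable_fun usual_complete _ (measurable_dense_sup t0 mZ)).
apply: filterS cZ => w cw _.
by rewrite (@ereal_sup_dense _ t (Z ^~ w)).
Qed.

Lemma cvg_prob0_small (Z : nat -> Omega -> \bar R) (e h : R) : cvg_prob0 P Z ->
  (0 < e)%R -> (0 < h)%R -> \forall k \near \oo, P [set w | e%:E < Z k w] < h%:E.
Proof.
move=> cZ e0 h0.
have nh : nbhs (0 : \bar R) [set y | y < h%:E].
  by apply: open_nbhs_nbhs; split; [exact: open_ereal_lt_ereal|rewrite /= lte_fin].
exact: (cZ e e0 _ nh).
Qed.

Definition quad_var (H1 H2 : R -> Omega -> 'M[R]_d) (t : R) (w : Omega) : \bar R :=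
  \int[mu]_(s in `[0%R, t]) (nsq (H1 s w - H2 s w))%:E.

Lemma quad_var_ge0 H1 H2 t w : 0 <= quad_var H1 H2 t w.
Proof. by apply: integral_ge0 => s _; rewrite lee_fin nsq_ge0. Qed.

Section joint.
Context (T : R) (H1 H2 : R -> Omega -> 'M[R]_d) (t : R).
Context (tT : (t <= T)%R).
Context (mH1 : forall i j, measurable_fun (`[0%R, T] `*` setT)
  (fun z : R * Omega => H1 z.1 z.2 i j)).
Context (mH2 : forall i j, measurable_fun (`[0%R, T] `*` setT)
  (fun z : R * Omega => H2 z.1 z.2 i j)).

Lemma measurable_nsq_diff : measurable_fun (`[0%R, t] `*` setT)
  (fun z : R * Omega => (nsq (H1 z.1 z.2 - H2 z.1 z.2))%:E).
Proof.
have sub : `[0%R, t] `*` [set: Omega] `<=` `[0%R, T] `*` [set: Omega].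
  move=> [s w] [/= + _]; rewrite in_itv/= => /andP[s0 st]; split => //=.
  by rewrite in_itv/= s0 (le_trans st).
apply/measurable_EFinP; apply: measurable_nsq => i j.
have mD : measurable (`[0%R, T]%classic `*` [set: Omega] : set (R * Omega)) by exact: measurableX.
rewrite (_ : (fun _ => _) = fun z : R * Omega => H1 z.1 z.2 i j - H2 z.1 z.2 i j)%R;
  last by apply/funext => z; rewrite !mxE.
by apply: measurable_funB; [exact: measurable_funS (mH1 i j)|exact: measurable_funS (mH2 i j)].
Qed.

Lemma measurable_quad_var : measurable_fun setT (quad_var H1 H2 t).
Proof.
have mD : measurable (`[0%R, t]%classic : set R) by [].
apply: (measurable_section_integral mD measurable_nsq_diff).
by move=> z _; rewrite lee_fin nsq_ge0.
Qed.

Lemma measurable_nsq_diff_section w :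
  measurable_fun `[0%R, t] (fun s => (nsq (H1 s w - H2 s w))%:E).
Proof. exact: (measurable_section w _ measurable_nsq_diff). Qed.

End joint.

Lemma measurable_on_simple_eval (T : R) G : simple_wf F G -> forall i j,
  measurable_fun (`[0%R, T] `*` setT) (fun z : R * Omega => simple_eval G z.1 z.2 i j).
Proof. by move=> wf i j; apply: measurable_funTS; exact: (measurable_simple_eval hF). Qed.

Lemma nsq_diff3 m n (a1 a2 h1 h2 : 'M[R]_(m, n)) :
  (nsq (a1 - a2) <= 2 * nsq (h1 - h2) + 4 * nsq (a1 - h1) + 4 * nsq (a2 - h2))%R.
Proof.
have -> : (a1 - a2 = (h1 - h2) + ((a1 - h1) - (a2 - h2)))%R.
  by rewrite opprB addrACA addKr addrCA subrr addr0.
apply: le_trans (nsqD _ _) _.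
have := nsqD (a1 - h1) (- (a2 - h2)); rewrite nsqN; lra.
Qed.

Section two_integrals.
Context (T : R) (hT : (0 <= T)%R).
Context (H1 H2 : R -> Omega -> 'M[R]_d) (I1 I2 : R -> Omega -> 'cV[R]_d).
Context (hI1 : ito_integral P F B T H1 I1) (hI2 : ito_integral P F B T H2 I2).

Lemma ito_integrand_measurable (H : R -> Omega -> 'M[R]_d) I i j :
  ito_integral P F B T H I ->
  measurable_fun (`[0%R, T] `*` setT) (fun z : R * Omega => H z.1 z.2 i j).
Proof. by case=> pH _ _ _; exact: progressive_measurable. Qed.

Lemma ito_measurable (H : R -> Omega -> 'M[R]_d) I t i j : ito_integral P F B T H I ->
  t \in `[0%R, T] -> measurable_fun setT (fun w => I t w i j).
Proof.
case=> _ mI _ _ tT; have t0 : (0 <= t)%R by move: tT; rewrite in_itv/= => /andP[].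
by apply: (sigma_measurable_fun hF t0); apply: measurable_wrt_coord; exact: mI.
Qed.

Lemma measurable_sup_error (H : R -> Omega -> 'M[R]_d) I G :
  ito_integral P F B T H I -> simple_wf F G ->
  measurable_fun setT (fun w => ereal_sup
    [set (enorm (simple_integral B G t w - I t w))%:E | t in `[0%R, T]]).
Proof.
move=> hI wf; apply: measurable_path_sup => //.
  move=> s sT; apply: measurable_enorm => i j; rewrite (ord1 j).
  under eq_fun do rewrite mxE [X in (_ + X)%R]mxE.
  apply: measurable_funB; last exact: (ito_measurable _ _ hI).
  by apply: measurable_simple_integral => //; move: sT; rewrite in_itv/= => /andP[].
have [_ _ cI _] := hI; have [_ cB _ _] := hB.
apply: filterS2 cI cB => w cI [_ cB].
apply: within_continuous_enorm => i j; rewrite (ord1 j).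
rewrite (_ : (fun s => _) = (fun s => simple_integral B G s w i 0 - I s w i 0)%R); last first.
  by apply/funext => s; rewrite !mxE.
have c1 := @continuous_simple_integral G T w i wf cB.
have c2 := @within_continuous_coord R _ _ _ _ i 0%R cI.
by move=> s; apply: cvgB; [exact: c1|exact: c2].
Qed.

(** [Y] stands for a capped maximum of |I1 - I2|^2 over finitely many times. Both integrals are
    replaced by simple ones, close to them outside an event [E] of small probability; on [E] the cap
    [K] keeps the contribution small. 192 = 48 * 2 * 2: comparing the integrals costs one factor 2,
    comparing the clocks the other. *)
Lemma ito_bounded (t : R) (qs : seq R) (N K : R) (Y : Omega -> R) : (0 <= t <= T)%R ->
  (forall q, q \in qs -> (0 <= q <= t)%R) -> (0 <= N)%R ->
  measurable_fun setT Y -> (forall w, 0 <= Y w <= K)%R ->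
  (forall w C, (0 <= C)%R -> (forall q, q \in qs -> (nsq (I1 q w - I2 q w) <= C)%R) ->
    (Y w <= C)%R) ->
  \int[P]_(w in [set w | quad_var H1 H2 t w <= N%:E]) (Y w)%:E <=
  (192 * d%:R)%:E * \int[P]_w (mine N%:E (quad_var H1 H2 t w)).
Proof.
move=> /andP[t0 tT] qst N0 mY YK Ymax.
set V := quad_var H1 H2 t.
have mH1 i j := ito_integrand_measurable i j hI1.
have mH2 i j := ito_integrand_measurable i j hI2.
have mV : measurable_fun setT V by exact: (measurable_quad_var tT).
have V0 w : 0 <= V w by exact: quad_var_ge0.
have [_ _ _ [G1 [wf1 cS1 cU1]]] := hI1.
have [_ _ _ [G2 [wf2 cS2 cU2]]] := hI2.
pose S H (G : simple_process Omega R d) w := \int[mu]_(s in `[0%R, T])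
  (enorm (simple_eval G s w - H s w) ^+ 2)%:E.
pose U I (G : simple_process Omega R d) w := ereal_sup
  [set (enorm (simple_integral B G t w - I t w))%:E | t in `[0%R, T]].
have SE H G w : S H G w = quad_var (simple_eval G) H T w.
  by apply: eq_integral => s _; rewrite enorm_sqr.
have mS1 k : measurable_fun setT (S H1 (G1 k)).
  rewrite (_ : S H1 (G1 k) = quad_var (simple_eval (G1 k)) H1 T);
    last by apply/funext => w; exact: SE.
  apply: (measurable_quad_var (lexx T)) => // i j.
  exact: measurable_on_simple_eval.
have mS2 k : measurable_fun setT (S H2 (G2 k)).
  rewrite (_ : S H2 (G2 k) = quad_var (simple_eval (G2 k)) H2 T);
    last by apply/funext => w; exact: SE.
  apply: (measurable_quad_var (lexx T)) => // i j.
  exact: measurable_on_simple_eval.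
have mU1 k : measurable_fun setT (U I1 (G1 k)) by exact: (measurable_sup_error hI1).
have mU2 k : measurable_fun setT (U I2 (G2 k)) by exact: (measurable_sup_error hI2).
have mgt (f : Omega -> \bar R) (e : R) : measurable_fun setT f -> measurable [set w | e%:E < f w].
  by move=> mf; rewrite -[X in measurable X]setTI; exact: emeasurable_fun_o_infty.
pose v := \int[P]_w (mine N%:E (V w)).
have v0 : 0 <= v by apply: integral_ge0 => w _; rewrite le_min lee_fin N0 V0.
have mmin (c : R) (f : Omega -> \bar R) : measurable_fun setT f ->
    measurable_fun setT (fun w => mine c%:E (f w)).
  by move=> mf; apply: measurable_mine.
have vN : v <= N%:E.
  apply: (@le_trans _ _ (\int[P]_w N%:E)).
    apply: ge0_le_integral_nomeas => w _; first by rewrite le_min lee_fin N0 V0.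
    by rewrite ge_min lexx.
  by rewrite integral_cst//= probability_setT mule1.
have vfin : v \is a fin_num by rewrite ge0_fin_numE// (le_lt_trans vN) ?ltry.
have K0 : (0 <= K)%R by have /andP[] := YK point; exact: le_trans.
(* [e] is the accuracy of the simple approximations and [h] bounds the probability of each of the
   four events on which one of them fails. *)
have main (e h : R) : (0 < e)%R -> (0 < h)%R ->
  \int[P]_(w in [set w | V w <= N%:E]) (Y w)%:E <=
  (2 * (48 * d%:R * (2 * fine v + 8 * e + (2 * N + 8 * e) * (4 * h))) + 8 * e ^+ 2 + K * (4 * h))%:E.
  move=> e0 h0.
  have e8 : (0 <= 8 * e)%R by rewrite mulr_ge0// ltW.
  have M0 w : 0 <= 2%:E * mine N%:E (V w) by rewrite mule_ge0// le_min lee_fin N0 V0.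
  have /filter_ex[k [[k1 k2] [k3 k4]]] :
      \forall k \near \oo, (P [set w | e%:E < S H1 (G1 k) w] < h%:E /\
         P [set w | e%:E < U I1 (G1 k) w] < h%:E) /\
        (P [set w | e%:E < S H2 (G2 k) w] < h%:E /\
         P [set w | e%:E < U I2 (G2 k) w] < h%:E).
    by apply: filterS2 (filterI (cvg_prob0_small cS1 e0 h0) (cvg_prob0_small cU1 e0 h0))
      (filterI (cvg_prob0_small cS2 e0 h0) (cvg_prob0_small cU2 e0 h0)) => k.
  pose E := ([set w | e%:E < S H1 (G1 k) w] `|` [set w | e%:E < U I1 (G1 k) w]) `|`
    ([set w | e%:E < S H2 (G2 k) w] `|` [set w | e%:E < U I2 (G2 k) w]).
  have mE : measurable E by apply: measurableU; apply: measurableU; exact: mgt.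
  have PE : P E <= (4 * h)%:E.
    have -> : (4 * h)%:E = (h%:E + h%:E) + (h%:E + h%:E).
      by rewrite -!EFinD; congr EFin; lra.
    apply: le_trans (measureU2 _ _ _) _; [by apply: measurableU; exact: mgt..|].
    apply: leeD; apply: le_trans (measureU2 _ _ _) _; try exact: mgt.
      exact: leeD (ltW k1) (ltW k2).
    exact: leeD (ltW k3) (ltW k4).
  have nE w : ~ E w -> [/\ S H1 (G1 k) w <= e%:E, U I1 (G1 k) w <= e%:E,
      S H2 (G2 k) w <= e%:E & U I2 (G2 k) w <= e%:E].
    by move=> nE; split; rewrite leNgt; apply/negP => h'; apply: nE;
      [left; left|left; right|right; left|right; right].
  pose W w := quad_var (simple_eval (G1 k)) (simple_eval (G2 k)) t w.
  have mW : measurable_fun setT W.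
    by apply: (measurable_quad_var tT) => i j; exact: measurable_on_simple_eval.
  have W0 w : 0 <= W w by exact: quad_var_ge0.
  have WV w : ~ E w -> W w <= 2%:E * V w + (8 * e)%:E.
    move=> /nE[s1 _ s2 _].
    have q1 : quad_var (simple_eval (G1 k)) H1 t w <= e%:E.
      apply: le_trans s1; rewrite SE; apply: ge0_subset_integral => //.
      - apply: (measurable_nsq_diff_section (lexx T)) => // i j.
        exact: measurable_on_simple_eval.
      - by move=> s _; rewrite lee_fin nsq_ge0.
      - exact: subset_itvl.
    have q2 : quad_var (simple_eval (G2 k)) H2 t w <= e%:E.
      apply: le_trans s2; rewrite SE; apply: ge0_subset_integral => //.
      - apply: (measurable_nsq_diff_section (lexx T)) => // i j.
        exact: measurable_on_simple_eval.
      - by move=> s _; rewrite lee_fin nsq_ge0.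
      - exact: subset_itvl.
    have m0 := measurable_nsq_diff_section tT mH1 mH2 w.
    have m1 : measurable_fun `[0%R, t] (fun s => (nsq (simple_eval (G1 k) s w - H1 s w))%:E).
      by apply: (measurable_nsq_diff_section tT) => // i j; exact: measurable_on_simple_eval.
    have m2 : measurable_fun `[0%R, t] (fun s => (nsq (simple_eval (G2 k) s w - H2 s w))%:E).
      by apply: (measurable_nsq_diff_section tT) => // i j; exact: measurable_on_simple_eval.
    apply: (@le_trans _ _ (\int[mu]_(s in `[0%R, t]) (2%:E * (nsq (H1 s w - H2 s w))%:E +
        (4%:E * (nsq (simple_eval (G1 k) s w - H1 s w))%:E +
         4%:E * (nsq (simple_eval (G2 k) s w - H2 s w))%:E)))).
      apply: ge0_le_integral_nomeas => s _; first by rewrite lee_fin nsq_ge0.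
      by rewrite -!EFinM -!EFinD lee_fin addrA; exact: nsq_diff3.
    rewrite ge0_integralD//; last 4 first.
    - by move=> s _; rewrite mule_ge0// lee_fin nsq_ge0.
    - exact: emeasurable_funM.
    - by move=> s _; rewrite adde_ge0// mule_ge0// lee_fin nsq_ge0.
    - by apply: emeasurable_funD; exact: emeasurable_funM.
    rewrite ge0_integralZl//; last by move=> s _; rewrite lee_fin nsq_ge0.
    rewrite leeD2l// ge0_integralD//; last 4 first.
    - by move=> s _; rewrite mule_ge0// lee_fin nsq_ge0.
    - exact: emeasurable_funM.
    - by move=> s _; rewrite mule_ge0// lee_fin nsq_ge0.
    - exact: emeasurable_funM.
    rewrite !ge0_integralZl//; try by move=> s _; rewrite lee_fin nsq_ge0.
    have -> : (8 * e)%:E = 4%:E * e%:E + 4%:E * e%:E.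
      by rewrite -!EFinM -EFinD; congr EFin; lra.
    by apply: leeD; rewrite lee_wpmul2l.
  (* Off [E], a clock of at most N for the given integrands keeps the simple clock at most [N'], so
     the truncated inequality is used at this level. *)
  pose N' := (2 * N + 8 * e)%R.
  have N'0 : (0 <= N')%R by rewrite addr_ge0// mulr_ge0// ltW.
  have [G [mG G0 hG iG]] := simple_pair_majorant hF hB (wf1 k) (wf2 k) t0 N'0 qst.
  pose e1 := (\1_E : Omega -> R).
  have me1 : measurable_fun setT e1 by exact: measurable_indic.
  have me1E : measurable_fun setT (fun w => (e1 w)%:E) by exact/measurable_EFinP.
  have e10 w : [set: Omega] w -> 0 <= (e1 w)%:E by rewrite lee_fin /e1 indicE.
  have ie1 (c : R) : (0 <= c)%R -> \int[P]_w (c * e1 w)%:E <= (c * (4 * h))%:E.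
    move=> c0; under eq_integral do rewrite EFinM.
    rewrite ge0_integralZl//.
    by rewrite integral_indic// setIT EFinM lee_wpmul2l.
  have iW : \int[P]_w (mine N'%:E (W w)) <=
      (2 * fine v + 8 * e + N' * (4 * h))%:E.
    apply: (@le_trans _ _ (\int[P]_w ((2%:E * mine N%:E (V w) + (8 * e)%:E) + (N' * e1 w)%:E))).
      apply: ge0_le_integral_nomeas => w _; first by rewrite le_min lee_fin N'0 W0.
      rewrite /e1 indicE; have [wE|wE] := boolP (w \in E).
        rewrite mulr1; apply: (@le_trans _ _ N'%:E); first by rewrite ge_min lexx.
        by rewrite leeDr// adde_ge0.
      rewrite mulr0 adde0; have /WV wv : ~ E w by move/negP: wE; rewrite inE.
      have [NV|NV] := leP N%:E (V w).
        by rewrite -EFinM -EFinD ge_min lexx.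
      by rewrite ge_min wv orbT.
    rewrite ge0_integralD//; last 4 first.
    - by move=> w _; rewrite adde_ge0.
    - by apply: emeasurable_funD => //; apply: emeasurable_funM => //; exact: mmin.
    - by move=> w _; rewrite lee_fin mulr_ge0.
    - by apply/measurable_EFinP; exact: measurable_funM.
    rewrite [leRHS]EFinD; apply: leeD; last exact: ie1.
    rewrite ge0_integralD//; last by apply: emeasurable_funM => //; exact: mmin.
    rewrite integral_cst//= probability_setT mule1 [leRHS]EFinD leeD2r//.
    rewrite ge0_integralZl//; last 2 first.
    - exact: mmin.
    - by move=> w _; rewrite le_min lee_fin N0 V0.
    rewrite -/v -{1}(fineK vfin).
    rewrite -EFinM.
    exact: lexx.
  have e28 : (0 <= 8 * e ^+ 2)%R by rewrite mulr_ge0// sqr_ge0.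
  have GG0 w : 0 <= 2%:E * (G w)%:E by rewrite mule_ge0// lee_fin.
  have G20 w : 0 <= 2%:E * (G w)%:E + (8 * e ^+ 2)%:E.
    by rewrite -EFinM -EFinD lee_fin addr_ge0// mulr_ge0.
  rewrite integral_mkcond.
  apply: (@le_trans _ _ (\int[P]_w ((2%:E * (G w)%:E + (8 * e ^+ 2)%:E) + (K * e1 w)%:E))).
    apply: ge0_le_integral_nomeas => w _.
      by apply: erestrict_ge0 => w' _; rewrite lee_fin; case/andP: (YK w').
    have RHS0 := G20 w.
    rewrite /patch; case: ifPn => wN; last first.
      by rewrite adde_ge0// lee_fin mulr_ge0.
    rewrite inE/= in wN.
    rewrite /e1 indicE; have [wE|wE] := boolP (w \in E).
      by rewrite mulr1 (@le_trans _ _ K%:E)// ?leeDr// lee_fin; case/andP: (YK w).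
    rewrite mulr0 adde0; have nEw : ~ E w by move/negP: wE; rewrite inE.
    have wv := WV w nEw; have [_ u1 _ u2] := nE w nEw.
    have WN : W w <= N'%:E.
      by apply: le_trans wv _; rewrite /N' [leRHS]EFinD leeD2r// [leRHS]EFinM lee_wpmul2l.
    rewrite -EFinM -EFinD lee_fin; apply: Ymax.
      by rewrite addr_ge0// mulr_ge0.
    move=> q qqs; have /andP[q0 qt] := qst q qqs.
    have qT : q \in `[0%R, T] by rewrite in_itv/= q0 (le_trans qt).
    have := hG w WN q qqs => hGq.
    have b1 : (nsq (simple_integral B (G1 k) q w - I1 q w) <= e ^+ 2)%R.
      rewrite -enorm_sqr lerXn2r ?nnegrE ?enorm_ge0 ?(ltW e0)// -lee_fin.
      by apply: le_trans u1; apply: ereal_sup_ubound; exists q.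
    have b2 : (nsq (simple_integral B (G2 k) q w - I2 q w) <= e ^+ 2)%R.
      rewrite -enorm_sqr lerXn2r ?nnegrE ?enorm_ge0 ?(ltW e0)// -lee_fin.
      by apply: le_trans u2; apply: ereal_sup_ubound; exists q.
    apply: le_trans (nsq_diff3 _ _ (simple_integral B (G1 k) q w) (simple_integral B (G2 k) q w)) _.
    rewrite -(nsqN (I1 q w - _)) -(nsqN (I2 q w - _)) !opprB; lra.
  rewrite ge0_integralD//; last 3 first.
  - by apply: emeasurable_funD => //; apply: emeasurable_funM => //; exact/measurable_EFinP.
  - by move=> w _; rewrite lee_fin mulr_ge0.
  - by apply/measurable_EFinP; exact: measurable_funM.
  rewrite [leRHS]EFinD; apply: leeD; last exact: ie1.
  rewrite ge0_integralD//; last by apply: emeasurable_funM => //; exact/measurable_EFinP.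
  rewrite integral_cst//= probability_setT mule1 [leRHS]EFinD leeD2r//.
  rewrite ge0_integralZl//; last 2 first.
  - exact/measurable_EFinP.
  - by move=> w _; rewrite lee_fin.
  rewrite [leRHS]EFinM lee_wpmul2l//; apply: le_trans iG _.
  by rewrite [leRHS]EFinM lee_wpmul2l// lee_fin mulr_ge0.
rewrite -/v -(fineK vfin) -EFinM; apply/lee_addgt0Pr => dl dl0.
have : (192 * d%:R = 4 * (48 * d%:R) :> R)%R by lra.
move: main; have : (0 <= 48 * d%:R :> R)%R by rewrite mulr_ge0.
move: (48 * d%:R)%R => D D0 main ->.
(* [e] and [h] are chosen so that the error terms of [main] in each of them add up to at most
   [dl / 2]; [e <= 1] replaces 8 e^2 by 8 e and 2 N + 8 e by 2 N + 8. *)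
have c1 : (0 < 16 * D + 8)%R by lra.
pose e := Num.min 1%R (dl / 2 / (16 * D + 8))%R.
have e0 : (0 < e)%R by rewrite lt_min ltr01 !divr_gt0.
have e1 : (e <= 1)%R by rewrite ge_min lexx.
have e2 : (e * (16 * D + 8) <= dl / 2)%R by rewrite -ler_pdivlMr// ge_min lexx orbT.
have c3 : (0 <= D * (2 * N + 8))%R by rewrite mulr_ge0//; lra.
have c2 : (0 < 8 * (D * (2 * N + 8)) + 4 * K + 1)%R by lra.
pose h := (dl / 2 / (8 * (D * (2 * N + 8)) + 4 * K + 1))%R.
have h0 : (0 < h)%R by rewrite !divr_gt0.
have h1 : (h * (8 * (D * (2 * N + 8)) + 4 * K + 1) <= dl / 2)%R by rewrite divfK// gt_eqF.
apply: le_trans (main e h e0 h0) _; rewrite -EFinD lee_fin.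
have a1 : (D * (2 * N + 8 * e) * h <= D * (2 * N + 8) * h)%R.
  by rewrite ler_wpM2r ?(ltW h0)// ler_wpM2l//; lra.
have a2 : (e ^+ 2 <= e)%R by rewrite expr2 ler_piMr// ltW.
move: (fine v) e h a1 a2 e1 e2 h1 e0 h0 => v' e h a1 a2 e1 e2 h1 e0 h0.
lra.
Qed.

End two_integrals.
End ito_estimate.

(** * Removing the localization *)

Section exhaustion.
Context (d0 : measure_display) (Omega : measurableType d0) (R : realType).
Context (P : probability Omega R).
Local Open Scope ereal_scope.

(** Monotone convergence along the sets {U <= n}, which cover almost every point because [U] is
    almost surely finite. *)
Lemma integral_exhaustion (S U : Omega -> \bar R) (M : \bar R) :
  measurable_fun setT S -> measurable_fun setT U -> (forall w, 0 <= S w) ->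
  {ae P, forall w, U w < +oo} ->
  (forall n, \int[P]_(w in [set w | U w <= n%:R%:E]) S w <= M) -> \int[P]_w S w <= M.
Proof.
move=> mS mU S0 fin hM.
have mA n : measurable [set w | U w <= n%:R%:E].
  by rewrite -[X in measurable X]setTI; exact: emeasurable_fun_infty_c.
pose f n := S \_ [set w | U w <= n%:R%:E].
have f0 n w : 0 <= f n w by apply: erestrict_ge0.
have fmono w : {homo f ^~ w : m n / (m <= n)%N >-> m <= n}.
  apply/nondecreasing_seqP => n; rewrite /f /patch; case: ifPn => [|_]; last by case: ifP.
  rewrite inE/= => Un; rewrite ifT// inE/=; apply: le_trans Un _.
  by rewrite lee_fin ler_nat.
have mf n : measurable_fun setT (f n).
  by apply/(measurable_restrictT _ _).1 => //; exact: measurable_funTS.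
apply: (@le_trans _ _ (\int[P]_w limn (f ^~ w))).
  apply: ae_ge0_le_integral_nomeas => //.
  - apply: (emeasurable_fun_cvg f) => // w _.
    by apply: ereal_nondecreasing_is_cvgn; exact: fmono.
  - move=> w _; apply: lime_ge; first exact: ereal_nondecreasing_is_cvgn.
    exact: nearW.
  apply: filterS fin => w Uw _.
  have [n Un] : exists n : nat, U w <= n%:R%:E.
    move: Uw; case: (U w) => [r _| |_]; last by exists 0%N; rewrite leNye.
      by exists (Num.truncn r).+1; rewrite lee_fin ltW// truncnS_gt.
    by rewrite ltxx.
  have -> : S w = f n w by rewrite /f /patch ifT// inE.
  rewrite (cvg_lim _ (ereal_nondecreasing_cvgn (fmono w)))//.
  by apply: ereal_sup_ubound; exists n.
rewrite monotone_convergence//.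
apply: lime_le.
  apply: ereal_nondecreasing_is_cvgn; apply/nondecreasing_seqP => m.
  by apply: ge0_le_integral_nomeas => w _ //; exact: fmono.
by apply: nearW => n; rewrite /f -integral_mkcond.
Qed.

End exhaustion.

Fixpoint prefix_max (R : realType) (z : nat -> R) (m : nat) : R :=
  if m is k.+1 then Num.max (prefix_max z k) (z k) else 0.

Lemma prefix_max_ge (R : realType) (z : nat -> R) i m : (i < m)%N ->
  z i <= prefix_max z m.
Proof.
elim: m => // m IH; rewrite ltnS leq_eqVlt => /predU1P[->|/IH h] /=.
  by rewrite le_max lexx orbT.
by rewrite le_max h.
Qed.

Lemma prefix_max_le (R : realType) (z : nat -> R) m c : 0 <= c ->
  (forall i, (i < m)%N -> z i <= c) -> prefix_max z m <= c.
Proof.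
move=> c0; elim: m => // m IH zc /=.
by rewrite ge_max zc// andbT IH// => i im; rewrite zc// ltnW.
Qed.

Lemma prefix_max_ge0 (R : realType) (z : nat -> R) m : 0 <= prefix_max z m.
Proof. by elim: m => //= m IH; rewrite le_max IH. Qed.

(* locked, since unification would expand the unary numeral 192 *)
Definition ito_constant (R : realType) (d : nat) : R := locked (192 * d%:R).

Lemma ito_constant_ge0 (R : realType) d : 0 <= ito_constant R d.
Proof. by rewrite /ito_constant -lock mulr_ge0. Qed.

Section ito_sup.
Context (d0 : measure_display) (Omega : measurableType d0) (R : realType).
Context (P : probability Omega R) (F : R -> set (set Omega)).
Context (hF : usual_filtration P F) (d : nat) (B : R -> Omega -> 'cV[R]_d).
Context (hB : brownian_motion P F B).
Local Notation mu := (@lebesgue_measure R).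
Local Open Scope ereal_scope.

Lemma progressive0 (T : R) : (0 <= T)%R ->
  progressive F T (fun (_ : R) (_ : Omega) => (0%R : 'M[R]_d)).
Proof.
move=> T0 t; rewrite in_itv/= => /andP[t0 _] A mA.
set D := (_ `*` _); have [A0|A0] := pselect (A 0%R).
  rewrite (_ : _ `&` _ = D `\` set0).
    move=> G [/= [G0 GC _] _]; exact: GC.
  by rewrite setD0; apply/seteqP; split => [z []|z Dz].
rewrite (_ : _ `&` _ = set0); last by apply/seteqP; split => [z []|z].
by move=> G [/= [G0 _ _] _].
Qed.

Definition simple0 : simple_process Omega R d :=
  SimpleProcess 0 (fun=> 0%R) (fun _ _ => 0%R).

(** Comparison with the zero integral turns estimates for differences into estimates for a single
    integral. *)
Lemma ito_integral0 (T : R) : (0 <= T)%R ->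
  ito_integral P F B T (fun _ _ => 0%R) (fun _ _ => 0%R).
Proof.
move=> T0; split; first exact: progressive0.
- move=> t; rewrite in_itv/= => /andP[t0 _] A mA.
  have [sF _] : sigma_algebra setT (F t) /\ F t `<=` measurable.
    by case: hF => h _ _ _; exact: h.
  have [F0 FC _] := sF.
  have [A0|A0] := pselect (A 0%R).
    rewrite (_ : _ @^-1` _ = setT `\` set0); first exact: FC.
    by rewrite setD0; apply/seteqP; split => w.
  by rewrite (_ : _ @^-1` _ = set0)//; apply/seteqP; split => w.
- by apply: aeW => w; apply: continuous_subspaceT => s; exact: cvg_cst.
have cvg0 (Z : nat -> Omega -> \bar R) : (forall k w, Z k w <= 0) -> cvg_prob0 P Z.
  move=> Z0 e e0; rewrite (_ : (fun k => _) = cst 0); first exact: cvg_cst.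
  apply/funext => k; rewrite (_ : [set w | _] = set0) ?measure0//.
  apply/seteqP; split => // w /= h; have := lt_le_trans h (Z0 k w).
  by rewrite lte_fin ltNge (ltW e0).
exists (fun=> simple0); split.
- by move=> _; split => //; exists 0%R.
- apply: cvg0 => _ w; rewrite integral0_eq// => s _.
  by rewrite enorm_sqr /simple_eval big_ord0 subr0 nsq0.
- apply: cvg0 => _ w; apply: ub_ereal_sup => _ [s _ <-].
  by rewrite /simple_integral big_ord0 subr0 /enorm -/(nsq 0) nsq0 sqrtr0.
Qed.

Section pair.
Context (T : R) (hT : (0 <= T)%R).
Context (H1 H2 : R -> Omega -> 'M[R]_d) (I1 I2 : R -> Omega -> 'cV[R]_d).
Context (hI1 : ito_integral P F B T H1 I1) (hI2 : ito_integral P F B T H2 I2).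
Context (t : R) (htT : (0 <= t <= T)%R).

Let t0 : (0 <= t)%R. Proof. by case/andP: htT. Qed.
Let tT : (t <= T)%R. Proof. by case/andP: htT. Qed.
Let V := quad_var H1 H2 t.

Let mV : measurable_fun setT V.
Proof.
apply: (measurable_quad_var tT) => i j; first exact: (ito_integrand_measurable hF hT i j hI1).
exact: (ito_integrand_measurable hF hT i j hI2).
Qed.

Let Z s w := nsq (I1 s w - I2 s w).

Let mZ s : s \in `[0%R, t] -> measurable_fun setT (Z s).
Proof.
rewrite in_itv/= => /andP[s0 st]; have sT : s \in `[0%R, T].
  by rewrite in_itv/= s0 (le_trans st).
apply: measurable_nsq => i j; rewrite (_ : (fun _ => _) = fun w => I1 s w i j - I2 s w i j)%R;
  last by apply/funext => w; rewrite !mxE.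
by apply: measurable_funB; [exact: (ito_measurable hF i j hI1)|exact: (ito_measurable hF i j hI2)].
Qed.

Let S w := ereal_sup (range (fun i => (Z (dense_seq t i) w)%:E)).

Let mS : measurable_fun setT S.
Proof. exact: measurable_dense_sup. Qed.

Let mA (N : R) : measurable [set w | V w <= N%:E].
Proof. by rewrite -[X in measurable X]setTI; exact: emeasurable_fun_infty_c. Qed.

(** [Y m] is the maximum over the first [m] dense times, capped at [m]. It is bounded, as
    [ito_bounded] requires, its estimate is the same for all [m], and its limit dominates the
    supremum. *)
Lemma ito_dense_sup_localized (N : R) : (0 <= N)%R ->
  \int[P]_(w in [set w | V w <= N%:E]) S w <=
  (ito_constant R d)%:E * \int[P]_w (mine N%:E (V w)).
Proof.
rewrite /ito_constant -lock => N0.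
pose M m w := prefix_max (fun i => Z (dense_seq t i) w) m.
pose Y m w := Num.min m%:R (M m w).
have Z0 s w : (0 <= Z s w)%R by exact: nsq_ge0.
have M0 m w : (0 <= M m w)%R by exact: prefix_max_ge0.
have MS m w : (M m w <= M m.+1 w)%R by rewrite /M/= le_max lexx.
have mM m : measurable_fun setT (M m).
  elim: m => [|m IH].
    exact: measurable_cst.
  by apply: measurable_maxr => //; apply: mZ; exact: dense_seq_in.
have mY m : measurable_fun setT (Y m) by exact: measurable_minr.
have YS m w : (Y m w <= Y m.+1 w)%R.
  by rewrite le_min !ge_min MS ler_nat leqnSn/= orbT.
have Ymono w : {homo (fun n => (Y n w)%:E) : m n / (m <= n)%N >-> m <= n}.
  by apply/nondecreasing_seqP => m; rewrite lee_fin.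
have Y0 m w : 0 <= (Y m w)%:E by rewrite lee_fin le_min M0 ler0n.
have SY w : S w <= limn (fun m => (Y m w)%:E).
  rewrite (cvg_lim _ (ereal_nondecreasing_cvgn (Ymono w)))//.
  apply: ub_ereal_sup => _ [i _ <-].
  (* Large enough to include the [i]-th time and to leave its value uncapped. *)
  pose m := maxn i.+1 (Num.truncn (Z (dense_seq t i) w)).+1.
  apply: (@le_trans _ _ (Y m w)%:E); last by apply: ereal_sup_ubound; exists m.
  rewrite lee_fin le_min; apply/andP; split.
    apply: ltW; apply: lt_le_trans (truncnS_gt _) _ => //.
    by rewrite ler_nat leq_maxr.
  have im : (i < m)%N by rewrite leq_maxl.
  exact: (prefix_max_ge (fun i => Z (dense_seq t i) w)).
apply: (@le_trans _ _ (\int[P]_(w in [set w | V w <= N%:E]) limn (fun m => (Y m w)%:E))).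
  apply: ge0_le_integral_nomeas => w _ //.
  apply: le_trans (_ : (Z (dense_seq t 0) w)%:E <= _); first by rewrite lee_fin.
  by apply: ereal_sup_ubound; exists 0%N.
rewrite monotone_convergence//; last first.
  by move=> m; apply: measurable_funTS; exact/measurable_EFinP.
apply: lime_le.
  apply: ereal_nondecreasing_is_cvgn; apply/nondecreasing_seqP => m.
  by apply: ge0_le_integral_nomeas => w _ //; rewrite lee_fin.
apply: nearW => m.
apply: (ito_bounded hF hB hT hI1 hI2 (qs := [seq dense_seq t i | i <- iota 0 m]) (K := m%:R)) => //.
- by move=> q /mapP[i _ ->]; have := dense_seq_in i t0; rewrite in_itv.
- by move=> w; rewrite -lee_fin Y0/= ge_min lexx.
move=> w C C0 hC; rewrite ge_min; apply/orP; right.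
apply: prefix_max_le => // i im; apply: hC; apply/mapP; exists i => //.
by rewrite mem_iota.
Qed.

(** The time [t] itself occurs in the dense sequence. *)
Lemma ito_localized (N : R) : (0 <= N)%R ->
  \int[P]_(w in [set w | V w <= N%:E]) (nsq (I1 t w - I2 t w))%:E <=
  (ito_constant R d)%:E * \int[P]_w (mine N%:E (V w)).
Proof.
move=> N0; apply: le_trans (ito_dense_sup_localized N0).
apply: ge0_le_integral_nomeas => w _; first by rewrite lee_fin nsq_ge0.
by have [i it] := dense_seq_last t; apply: ereal_sup_ubound; exists i => //; rewrite it.
Qed.

(** A finite expectation makes [V] almost surely finite, so the sets {V <= n} exhaust the space,
    while min(n, V) <= V bounds every stage alike. *)
Lemma ito_sup_estimate : \int[P]_w V w < +oo ->
  \int[P]_w ereal_sup [set (nsq (I1 s w - I2 s w))%:E | s in `[0%R, t]] <=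
  (ito_constant R d)%:E * \int[P]_w V w.
Proof.
move=> V_fin.
have V0 w : 0 <= V w by exact: quad_var_ge0.
have S0 w : 0 <= S w.
  apply: le_trans (_ : (Z (dense_seq t 0) w)%:E <= _); first by rewrite lee_fin nsq_ge0.
  by apply: ereal_sup_ubound; exists 0%N.
have fin : {ae P, forall w, V w < +oo}.
  have iV : P.-integrable setT V.
    by apply/integrableP; split => //; under eq_integral do rewrite gee0_abs//.
  apply: filterS (integrable_ae measurableT iV) => w /(_ I).
  by rewrite ge0_fin_numE.
apply: (@le_trans _ _ (\int[P]_w S w)).
  apply: ae_ge0_le_integral_nomeas => //.
    move=> w _; apply: le_trans (_ : (Z 0%R w)%:E <= _); first by rewrite lee_fin nsq_ge0.
    by apply: ereal_sup_ubound; exists 0%R => //=; rewrite in_itv/= lexx.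
  have [_ _ c1 _] := hI1; have [_ _ c2 _] := hI2.
  apply: filterS2 c1 c2 => w c1 c2 _.
  rewrite (@ereal_sup_dense _ t (Z ^~ w))//.
  apply: (@continuous_subspaceW _ _ _ `[0%R, T]); first exact: subset_itvl.
  apply: within_continuous_nsq => i j.
  rewrite (_ : (fun s => _) = (fun s => I1 s w i j - I2 s w i j)%R);
    last by apply/funext => s; rewrite !mxE.
  have k1 := @within_continuous_coord R _ _ _ _ i j c1.
  have k2 := @within_continuous_coord R _ _ _ _ i j c2.
  by move=> s; apply: cvgB; [exact: k1|exact: k2].
apply: (integral_exhaustion mS mV) => // n.
apply: le_trans (ito_dense_sup_localized _) _ => //.
rewrite lee_wpmul2l ?lee_fin ?ito_constant_ge0//.
apply: ge0_le_integral_nomeas => w _; first by rewrite le_min V0 lee_fin ler0n.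
by rewrite ge_min lexx orbT.
Qed.

End pair.
End ito_sup.

(** * Gronwall estimates *)

Section real_integrals.
Context (R : realType).
Local Notation mu := (@lebesgue_measure R).
Local Open Scope ereal_scope.

(* 2 m |h| <= m^2 + h^2 with m = |int h| / t, so that h need not be square
   integrable *)
Lemma sqr_Rintegral_le (t : R) (h : R -> R) : (0 < t)%R ->
  measurable_fun `[0%R, t] h ->
  ((\int[mu]_(s in `[0%R, t]) h s)%R ^+ 2)%:E <=
  t%:E * \int[mu]_(s in `[0%R, t]) (h s ^+ 2)%:E.
Proof.
move=> t0 mh; set a := (\int[mu]_(s in _) h s)%R.
have mhE : measurable_fun `[0%R, t] (fun s => (h s)%:E) by exact/measurable_EFinP.
have habs : `|a|%:E <= \int[mu]_(s in `[0%R, t]) `|(h s)%:E|.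
  apply: le_trans (le_abse_integral mu _ mhE) => //.
  by rewrite /a /Rintegral; case: (integral _ _ _) => [r||]//=; rewrite normr0 ?leey.
pose m := (`|a| / t)%R.
have m0 : (0 <= m)%R by rewrite divr_ge0// ltW.
have msq : measurable_fun `[0%R, t] (fun s => (h s ^+ 2)%:E).
  by apply/measurable_EFinP; exact: measurable_funX.
have main : (2 * m * `|a|)%:E <= (m ^+ 2 * t)%:E + \int[mu]_(s in `[0%R, t]) (h s ^+ 2)%:E.
  apply: (@le_trans _ _ (\int[mu]_(s in `[0%R, t]) ((2 * m)%:E * `|(h s)%:E|))).
    rewrite ge0_integralZl//; last 2 first.
    - exact: measurableT_comp.
    - by rewrite lee_fin mulr_ge0.
    by rewrite EFinM lee_wpmul2l// lee_fin mulr_ge0.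
  apply: (@le_trans _ _ (\int[mu]_(s in `[0%R, t]) ((m ^+ 2)%:E + (h s ^+ 2)%:E))).
    apply: ge0_le_integral_nomeas => s _; first by rewrite mule_ge0// lee_fin mulr_ge0.
    rewrite abse_EFin -EFinM -EFinD lee_fin -(real_normK (num_real (h s))).
    by have := sqr_ge0 (m - `|h s|)%R; nra.
  rewrite ge0_integralD//; last 2 first.
  - by move=> s _; rewrite lee_fin sqr_ge0.
  - by move=> s _; rewrite lee_fin sqr_ge0.
  rewrite integral_cst//= lebesgue_measure_itv/= lte_fin t0.
  by rewrite -EFinD subr0 -EFinM.
have maE : (m * t = `|a|)%R by rewrite divfK// gt_eqF.
move: main; case: (integral _ _ _) => [r| |].
- rewrite -EFinD -EFinM !lee_fin => main.
  rewrite -(real_normK (num_real a)) -maE; move: main; rewrite -maE; nra.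
- by rewrite gt0_muley ?leey.
- by rewrite addeNy leeNy_eq.
Qed.

(** The supremum [W] of u(t) e^(-2ct) is finite because [u] is bounded. Inserting u(s) <= W e^(2cs)
    under the integral gives W <= a + W/2, as c times the integral of e^(2cs) is at most e^(2ct) /
    2; hence W <= 2a. The bound [K] is absent from the conclusion. *)
Lemma gronwall (T a c K : R) (u : R -> \bar R) : (0 <= a)%R -> (0 < c)%R -> (0 <= T)%R ->
  measurable_fun `[0%R, T] u -> (forall s, s \in `[0%R, T] -> 0 <= u s <= K%:E) ->
  (forall t, t \in `[0%R, T] ->
     u t <= a%:E + c%:E * \int[mu]_(s in `[0%R, t]) u s) ->
  forall t, t \in `[0%R, T] -> u t <= (2 * a * expR (2 * c * t))%:E.
Proof.
move=> a0 c0 T0 mu_ uK hu.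
have ufin t : t \in `[0%R, T] -> u t = (fine (u t))%:E.
  move=> tT; have /andP[u0 uKt] := uK t tT.
  by rewrite fineK// ge0_fin_numE// (le_lt_trans uKt) ?ltry.
pose v t := (fine (u t) * expR (- (2 * c * t)))%R.
pose W := sup [set v t | t in `[0%R, T]].
have T0T : 0%R \in `[0%R, T] by rewrite in_itv/= lexx.
have K0 : (0 <= K)%R.
  by have /andP[h1 h2] := uK _ T0T; rewrite -lee_fin (le_trans h1 h2).
have fK t : t \in `[0%R, T] -> (0 <= fine (u t) <= K)%R.
  by move=> tT; have := uK t tT; rewrite {1 2}(ufin t tT) !lee_fin.
have hs : has_sup [set v t | t in `[0%R, T]].
  split; first by exists (v 0%R); exists 0%R.
  exists K => _ [t tT <-]; rewrite /v; have /andP[f0 fKt] := fK t tT.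
  apply: le_trans fKt; rewrite ler_piMr// -expR0 ler_expR oppr_le0.
  by move: tT; rewrite /= in_itv/= => /andP[t0 _]; rewrite !mulr_ge0// ltW.
have vW t : t \in `[0%R, T] -> (v t <= W)%R.
  by move=> tT; apply: sup_upper_bound => //; exists t.
have W0 : (0 <= W)%R.
  apply: le_trans (vW 0%R T0T); rewrite /v mulr_ge0 ?expR_ge0//.
  by case/andP: (fK _ T0T).
have c2 : (0 < 2 * c)%R by rewrite mulr_gt0.
have intexp t : (0 <= t)%R ->
    \int[mu]_(s in `[0%R, t]) (W * expR (2 * c * s))%:E <=
    (W * expR (2 * c * t) / (2 * c))%:E.
  rewrite le_eqVlt => /predU1P[<-|t0].
    rewrite set_itv1 integral_set1 lee_fin divr_ge0//; last exact: ltW.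
    by rewrite mulr_ge0// expR_ge0.
  have cexp : continuous (fun s : R => W * expR (2 * c * s))%R.
    move=> s; apply: cvgM; first exact: cvg_cst.
    apply: (@cvg_comp _ _ _ (fun s : R => 2 * c * s)%R expR _ (nbhs (2 * c * s)%R)).
      by apply: cvgM; [exact: cvg_cst|exact: cvg_id].
    exact: continuous_expR.
  have dF (s : R) : is_derive s 1%R (fun s : R => W * expR (2 * c * s) / (2 * c))%R
      (W * expR (2 * c * s))%R.
    have d1 : is_derive s 1%R (fun s : R => 2 * c * s)%R (2 * c)%R.
      by apply: is_derive_eq; rewrite /GRing.scale/= mulr1.
    have d2 := is_derive1_comp (is_derive_expR (2 * c * s)%R) d1.
    have -> : (fun s : R => W * expR (2 * c * s) / (2 * c))%R =
       ((W / (2 * c)) \*: (expR \o (fun s : R => 2 * c * s)))%R.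
      by apply/funext => y /=; rewrite /GRing.scale/= mulrAC.
    apply: is_derive_eq; rewrite /GRing.scale/=; field; rewrite gt_eqF//.
  rewrite (@continuous_FTC2 _ _ (fun s => W * expR (2 * c * s) / (2 * c))%R)//.
  - by rewrite -EFinB lee_fin lerBlDr lerDl divr_ge0 ?(ltW c2)// mulr_ge0 ?expR_ge0.
  - exact: continuous_subspaceT.
  - have cF (s : R) : {for s, continuous (fun s => W * expR (2 * c * s) / (2 * c))%R}.
      by apply/differentiable_continuous/derivable1_diffP; apply: ex_derive; exact: dF.
    split; first by move=> s _; apply: ex_derive; exact: dF.
      exact: cvg_at_right_filter (cF _).
    exact: cvg_at_left_filter (cF _).
  - by move=> s _; rewrite derive1E; exact: derive_val.
have vW2 t : t \in `[0%R, T] -> (v t <= a + W / 2)%R.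
  move=> tT; have := tT; rewrite in_itv/= => /andP[t0 tT'].
  have sub s : s \in `[0%R, t] -> s \in `[0%R, T].
    by rewrite !in_itv/= => /andP[-> st]; rewrite (le_trans st).
  have := hu t tT; rewrite {1}(ufin t tT) => h1.
  have h2 : (fine (u t))%:E <= a%:E + c%:E * (W * expR (2 * c * t) / (2 * c))%:E.
    apply: le_trans h1 _; rewrite leeD2l// lee_wpmul2l ?lee_fin ?(ltW c0)//.
    apply: le_trans (intexp t t0); apply: ge0_le_integral_nomeas => s /= st.
      by case/andP: (uK s (sub s st)).
    rewrite (ufin s (sub s st)) lee_fin.
    have := vW s (sub s st); rewrite /v expRN -ler_pdivrMr ?invr_gt0 ?expR_gt0// invrK//.
  rewrite -EFinM -EFinD lee_fin in h2.
  rewrite /v expRN ler_pdivrMr ?expR_gt0//; apply: le_trans h2 _.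
  have e1 : (1 <= expR (2 * c * t))%R 
    by rewrite -[leLHS]expR0 ler_expR; apply: mulr_ge0 => //; exact: ltW.
  have -> : (c * (W * expR (2 * c * t) / (2 * c)) = W / 2 * expR (2 * c * t))%R.
    by field; rewrite gt_eqF.
  by rewrite [leRHS]mulrDl lerD2r ler_peMr.
have WW : (W <= a + W / 2)%R.
  by apply: sup_le_ub; [case: hs|move=> _ [t tT <-]; exact: vW2].
move=> t tT; rewrite (ufin t tT) lee_fin.
have := vW t tT; rewrite /v expRN ler_pdivrMr ?expR_gt0// => /le_trans; apply.
by rewrite ler_wpM2r ?expR_ge0//; lra.
Qed.

(* Uf s <= N exactly up to the time at which Uf reaches N. *)
Lemma min_clock_le (f : R -> R) (t N : R) : continuous f -> (forall s, 0 <= f s)%R ->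
  (0 <= t)%R -> (0 <= N)%R ->
  mine N%:E (\int[mu]_(s in `[0%R, t]) (f s)%:E) <=
  \int[mu]_(s in `[0%R, t])
    (if \int[mu]_(r in `[0%R, s]) (f r)%:E <= N%:E then (f s)%:E else 0).
Proof.
move=> cf f0 t0 N0.
have mf D : measurable D -> measurable_fun D (fun s => (f s)%:E).
  by move=> mD; apply: measurable_funTS; apply/measurable_EFinP; exact: continuous_measurable_fun.
pose Uf s := \int[mu]_(r in `[0%R, s]) (f r)%:E.
have Umono s s' : (s <= s')%R -> Uf s <= Uf s'.
  move=> ss'; apply: ge0_subset_integral => //; first exact: mf.
    by move=> r _; rewrite lee_fin.
  exact: subset_itvl.
have if0 s : 0 <= (if Uf s <= N%:E then (f s)%:E else 0) by case: ifP => // _; rewrite lee_fin.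
have [UN|UN] := leP (Uf t) N%:E.
  apply: ge0_le_integral_nomeas => s; first by rewrite lee_fin.
  rewrite /= in_itv/= => /andP[_ st]; rewrite ifT//.
  exact: le_trans (Umono _ _ st) UN.
have int : mu.-integrable `[0%R, t] (EFin \o f).
  apply: continuous_compact_integrable; first exact: segment_compact.
  exact: continuous_subspaceT.
pose Rf s := (\int[mu]_(r in `[0%R, s]) f r)%R.
have RfE s : (s <= t)%R -> Uf s = (Rf s)%:E.
  move=> st; rewrite /Rf /Rintegral fineK//.
  apply: integrable_fin_num => //; apply: (integrableS _ _ _ int) => //.
  exact: subset_itvl.
have cR : {within `[0%R, t], continuous Rf} by exact: parameterized_integral_continuous.
have Rf0 : Rf 0%R = 0%R by rewrite /Rf set_itv1 Rintegral_set1.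
have NR : (N <= Rf t)%R by rewrite -lee_fin -RfE// ltW.
(* [c] is the time at which the clock reaches N. Up to [c] the condition on the right holds, so the
   right side is at least the clock at [c]. *)
have [|c cin cN] := @IVT R Rf 0%R t N t0 cR.
  by rewrite Rf0 min_l ?(le_trans N0)// max_r ?(le_trans N0)// N0.
move: cin; rewrite in_itv/= => /andP[c0 ct].
rewrite -{1}cN -RfE//.
apply: (@le_trans _ _ (\int[mu]_(s in `[0%R, c]) (if Uf s <= N%:E then (f s)%:E else 0))).
  apply: ge0_le_integral_nomeas => s; first by rewrite lee_fin.
  rewrite /= in_itv/= => /andP[_ sc]; rewrite ifT//.
  by apply: le_trans (Umono _ _ sc) _; rewrite RfE// cN.
rewrite integral_mkcond [leRHS]integral_mkcond; apply: ge0_le_integral_nomeas => s _.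
  by apply: erestrict_ge0 => s' _.
rewrite /patch; case: ifPn => sc; last by case: ifPn => // _; exact: if0.
have st : s \in `[0%R, t]%classic.
  by move: sc; rewrite !inE/= !in_itv/= => /andP[s0 sc]; rewrite s0 (le_trans sc).
by rewrite st.
Qed.

End real_integrals.

(** * Second moments of solutions *)

Section regular_version.
Context (d0 : measure_display) (Omega : measurableType d0) (R : realType).
Context (P : probability Omega R) (d : nat).

(** The projection of the line onto [0, T]; composing with it extends a path to all times. *)
Definition clamp (T s : R) : R := Num.max 0 (Num.min s T).

Lemma clamp_in (T s : R) : 0 <= T -> clamp T s \in `[0, T].
Proof. by move=> T0; rewrite in_itv/= le_max lexx/= ge_max T0 ge_min lexx orbT. Qed.

Lemma clamp_id (T s : R) : s \in `[0, T] -> clamp T s = s.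
Proof. by rewrite in_itv/= => /andP[s0 sT]; rewrite /clamp min_l// max_r. Qed.

Lemma clamp_dist (T s s' : R) : 0 <= T -> `|clamp T s - clamp T s'| <= `|s - s'|.
Proof.
move=> T0; rewrite /clamp.
have [h1|h1] := leP s T; have [h2|h2] := leP s' T;
have [h3|h3] := leP 0 s; have [h4|h4] := leP 0 s'; rewrite ?(max_r T0) ?subrr ?normr0 ?normr_ge0//;
do ?[by rewrite ger0_norm ?[leRHS]ger0_norm; lra
     |by rewrite ler0_norm ?[leRHS]ler0_norm; lra
     |by lra].
Qed.

Lemma continuous_clamp (T : R) (f : R -> R) : 0 <= T ->
  {within `[0, T], continuous f} -> continuous (fun s => f (clamp T s)).
Proof.
move=> T0 /subspace_continuousP cf s; apply/cvgrPdist_lt => e e0.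
move/cvgrPdist_lt: (cf _ (clamp_in s T0)) => /(_ e e0); rewrite !near_withinE.
move=> /nbhs_ballP[a /= a0 ha]; apply/nbhs_ballP; exists a => // s' /= ss'.
apply: ha => /=; last exact: clamp_in.
by apply: le_lt_trans ss'; exact: clamp_dist.
Qed.

(** Joint measurability is proved for paths continuous at all times and for all outcomes. The
    version is 0 on the exceptional null set, and time is clamped elsewhere. *)
Lemma regular_version (T : R) (X : R -> Omega -> 'cV[R]_d) : 0 <= T ->
  (forall s i, measurable_fun setT (fun w => X s w i 0)) ->
  {ae P, forall w, {within `[0, T], continuous (fun t : R => X t w : 'cV[R]_d)}} ->
  exists Y : R -> Omega -> 'cV[R]_d,
  [/\ forall s i, measurable_fun setT (fun w => Y s w i 0),
      forall w i, continuous (fun s => Y s w i 0) &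
      {ae P, forall w, forall t, t \in `[0, T] -> X t w = Y t w}].
Proof.
move=> T0 mX [N [mN N0 sN]].
exists (fun s w => if w \in N then 0 else X (clamp T s) w); split.
- move=> s i; rewrite (_ : (fun _ => _) = fun w => if w \in N then 0 else X (clamp T s) w i 0);
    last by apply/funext => w; case: ifP => // _; rewrite mxE.
  apply: measurable_fun_ifT => //.
  apply: (@measurable_fun_bool _ _ _ _ true).
  rewrite (_ : _ @^-1` _ = N) ?setTI//.
  by apply/seteqP; split => x /= => [/set_mem|/mem_set].
- move=> w i; have [wN|wN] := boolP (w \in N).
    by move=> s; exact: cvg_cst.
  apply: (continuous_clamp (f := fun s => X s w i 0)) => //.
  have : {within `[0, T], continuous (fun t : R => X t w : 'cV[R]_d)}.
    by apply: contrapT => h; move/negP: wN; apply; rewrite inE; exact: sN.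
  by move=> cX; exact: (@within_continuous_coord R _ _ _ _ i 0 cX).
exists N; split => // w /= h; apply: contrapT => wN; apply: h => t tT.
by rewrite ifN ?clamp_id// notin_setE.
Qed.

End regular_version.

Section process_clock.
Context (d0 : measure_display) (Omega : measurableType d0) (R : realType).
Context (P : probability Omega R) (d : nat).
Context (Y : R -> Omega -> 'cV[R]_d).
Context (mY : forall s i, measurable_fun setT (fun w => Y s w i 0)).
Context (cY : forall w i, continuous (fun s => Y s w i 0)).
Local Notation mu := (@lebesgue_measure R).
Local Open Scope ereal_scope.

Definition growth (s : R) (w : Omega) : R := (1 + nsq (Y s w))%R.

Lemma growth_ge1 s w : (1 <= growth s w)%R.
Proof. by rewrite lerDl nsq_ge0. Qed.

Lemma growth_ge0 s w : (0 <= growth s w)%R.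
Proof. exact: le_trans (growth_ge1 s w). Qed.

Lemma measurable_nsq_process s : measurable_fun setT (fun w => nsq (Y s w)).
Proof. by apply: measurable_nsq => i j; rewrite (ord1 j). Qed.

Lemma continuous_nsq_process w : continuous (fun s => nsq (Y s w)).
Proof.
move=> s; apply: cvg_big => [|i _]; first exact: add_continuous.
apply: cvg_big => [|j _]; first exact: add_continuous.
by rewrite (ord1 j); apply: cvgM; exact: cY.
Qed.

Lemma continuous_growth w : continuous (growth ^~ w).
Proof. by move=> s; apply: cvgD; [exact: cvg_cst|exact: continuous_nsq_process]. Qed.

Lemma measurable_growth : measurable_fun setT (fun z : R * Omega => growth z.1 z.2).
Proof.
apply: (@measurable_continuous_process _ _ R growth); last exact: continuous_growth.
by move=> s; apply: measurable_funD => //; exact: measurable_nsq_process.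
Qed.

(** By linear growth it dominates, up to constants, both the clock of the stochastic integral and
    the squared drift. It is finite for every outcome, since paths are continuous. *)
Definition growth_clock (t : R) (w : Omega) : \bar R :=
  \int[mu]_(s in `[0%R, t]) (growth s w)%:E.

Lemma growth_clock_ge0 t w : 0 <= growth_clock t w.
Proof. by apply: integral_ge0 => s _; rewrite lee_fin growth_ge0. Qed.

Lemma growth_section w D : measurable D -> measurable_fun D (fun s => (growth s w)%:E).
Proof.
move=> mD; apply: measurable_funTS; apply/measurable_EFinP.
by apply: continuous_measurable_fun; exact: continuous_growth.
Qed.

Lemma integrable_growth t w : mu.-integrable `[0%R, t] (EFin \o growth ^~ w).
Proof.
apply: continuous_compact_integrable; first exact: segment_compact.
by apply: continuous_subspaceT; exact: continuous_growth.
Qed.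

Lemma growth_clock_fin t w : growth_clock t w \is a fin_num.
Proof. by apply: integrable_fin_num => //; exact: integrable_growth. Qed.

Lemma measurable_growth_clock t : measurable_fun setT (growth_clock t).
Proof.
have mD : measurable (`[0%R, t]%classic : set R) by [].
have mg : measurable_fun (`[0%R, t]%classic `*` setT) (fun z : R * Omega => (growth z.1 z.2)%:E).
  by apply: measurable_funTS; apply/measurable_EFinP; exact: measurable_growth.
apply: (measurable_section_integral mD mg).
by move=> z _; rewrite lee_fin growth_ge0.
Qed.

Lemma continuous_growth_clock (T : R) w : (0 <= T)%R ->
  continuous (fun s => fine (growth_clock (clamp T s) w)).
Proof.
move=> T0; apply: (continuous_clamp (f := fun s => fine (growth_clock s w))) => //.
apply: (@parameterized_integral_continuous R 0%R T (growth ^~ w) T0).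
exact: integrable_growth.
Qed.

Lemma measurable_growth_clock_joint (T : R) : (0 <= T)%R ->
  measurable_fun (`[0%R, T] `*` setT) (fun z : R * Omega => growth_clock z.1 z.2).
Proof.
move=> T0.
have mj : measurable_fun setT (fun z : R * Omega => fine (growth_clock (clamp T z.1) z.2)).
  apply: (@measurable_continuous_process _ _ R (fun s w => fine (growth_clock (clamp T s) w))).
    by move=> s; apply: measurableT_comp => //; exact: measurable_growth_clock.
  by move=> w; exact: continuous_growth_clock.
apply: (@eq_measurable_fun _ _ _ _ _
  (fun z : R * Omega => (fine (growth_clock (clamp T z.1) z.2))%:E)).
  move=> [s w]; rewrite inE => -[/= sT _]; rewrite clamp_id// fineK//.
  exact: growth_clock_fin.
by apply: measurable_funTS; apply/measurable_EFinP.
Qed.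

(* E[min(N, U_t)] grows at most at the rate at which U_s does on {U_s <= N}. *)
Lemma expected_clock_le (t N : R) : (0 <= t)%R -> (0 <= N)%R ->
  \int[P]_w mine N%:E (growth_clock t w) <=
  \int[mu]_(s in `[0%R, t]) \int[P]_(w in [set w | growth_clock s w <= N%:E]) (growth s w)%:E.
Proof.
move=> t0 N0.
pose f (z : R * Omega) := if growth_clock z.1 z.2 <= N%:E then (growth z.1 z.2)%:E else 0.
have f0 z : 0 <= f z by rewrite /f; case: ifP => // _; rewrite lee_fin growth_ge0.
have mD : measurable (`[0%R, t]%classic : set R) by [].
have mf : measurable_fun (`[0%R, t]%classic `*` setT) f.
  have mDT : measurable (`[0%R, t]%classic `*` setT : set (R * Omega)) by exact: measurableX.
  apply: measurable_fun_if => //.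
    apply: (@measurable_fun_bool _ _ _ _ true).
    have := emeasurable_fun_infty_c mDT (measurable_growth_clock_joint t0) N%:E.
    by congr (measurable _); apply/seteqP; split => z.
  by apply: measurable_funTS; apply/measurable_EFinP; exact: measurable_growth.
apply: (@le_trans _ _ (\int[P]_w \int[mu]_(s in `[0%R, t]) f (s, w))).
  apply: ge0_le_integral_nomeas => w _.
    by rewrite le_min lee_fin N0 growth_clock_ge0.
  exact: (min_clock_le (@continuous_growth w) (growth_ge0 ^~ w)).
rewrite (tonelli_on P mD mf)//; apply: ge0_le_integral_nomeas => s _.
  by apply: integral_ge0 => w _.
rewrite [leRHS]integral_mkcond; apply: ge0_le_integral_nomeas => w _; first exact: f0.
rewrite /f /patch; case: ifPn => /= h; first by rewrite mem_set.
by case: ifP => // _; rewrite lee_fin growth_ge0.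
Qed.

End process_clock.

Section drift.
Context (R : realType) (d : nat).
Local Notation mu := (@lebesgue_measure R).
Local Open Scope ereal_scope.

Lemma nsq_Rintegral_le (t : R) (f : R -> 'cV[R]_d) (g : R -> \bar R) : (0 < t)%R ->
  (forall i, measurable_fun `[0%R, t] (fun s => f s i 0%R)) ->
  (forall s, s \in `[0%R, t] -> (nsq (f s))%:E <= g s) ->
  (nsq (\col_i (\int[mu]_(s in `[0%R, t]) f s i 0)%R))%:E <=
  t%:E * \int[mu]_(s in `[0%R, t]) g s.
Proof.
move=> t0 mf fg.
apply: (@le_trans _ _ (t%:E * \int[mu]_(s in `[0%R, t]) (nsq (f s))%:E)); last first.
  rewrite lee_wpmul2l ?lee_fin ?(ltW t0)//; apply: ge0_le_integral_nomeas => s st.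
    by rewrite lee_fin nsq_ge0.
  exact: fg.
have sq0 i s : 0 <= (f s i 0%R ^+ 2)%:E by rewrite lee_fin sqr_ge0.
have -> : \int[mu]_(s in `[0%R, t]) (nsq (f s))%:E =
    \sum_(i < d) \int[mu]_(s in `[0%R, t]) (f s i 0%R ^+ 2)%:E.
  rewrite -ge0_integral_sum//; last first.
    by move=> i; apply/measurable_EFinP; apply: measurable_funX; exact: mf.
  apply: eq_integral => s _; rewrite sumEFin; congr EFin.
  by apply: eq_bigr => i _; rewrite big_ord1.
rewrite ge0_sume_distrr; last by move=> i _; exact: integral_ge0.
rewrite /nsq -sumEFin; apply: lee_sum => i _; rewrite big_ord1 mxE.
exact: sqr_Rintegral_le.
Qed.

End drift.

Section solution_moments.
Context (d0 : measure_display) (Omega : measurableType d0) (R : realType).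
Context (P : probability Omega R) (F : R -> set (set Omega)).
Context (hF : usual_filtration P F) (d : nat) (B : R -> Omega -> 'cV[R]_d).
Context (hB : brownian_motion P F B).
Context (T : R) (hT : 0 < T) (x : 'cV[R]_d).
Local Notation mu := (@lebesgue_measure R).

Lemma growth_sqr (c e1 e2 r : R) : 0 <= e1 -> 0 <= e2 -> 0 <= r -> 0 <= c ->
  e1 + e2 <= c * (1 + r) -> e2 ^+ 2 <= 2 * c ^+ 2 * (1 + r ^+ 2).
Proof.
move=> e10 e20 r0 c0 h.
have h2 : e2 <= c * (1 + r) by lra.
apply: (@le_trans _ _ ((c * (1 + r)) ^+ 2)).
  by rewrite lerXn2r ?nnegrE// mulr_ge0// addr_ge0.
rewrite exprMn (_ : 2 * c ^+ 2 * (1 + r ^+ 2) = c ^+ 2 * (2 * (1 + r ^+ 2))); last by ring.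
rewrite ler_wpM2l ?sqr_ge0//.
by have := sqr_ge0 (1 - r); nra.
Qed.

Section one_solution.
Context (b : coeff R d d 1) (sg : coeff R d d d) (X : R -> {RV P >-> 'cV[R]_d}).
Context (hX : mkv_solution F B T x b sg X) (hg : linear_growth T b sg).

Local Notation bX := (fun t w => b t (X t w) (distribution P (X t))).
Local Notation sX := (fun t w => sg t (X t w) (distribution P (X t))).

Lemma measurable_solution s i : measurable_fun setT (fun w => X s w i 0).
Proof.
exact: (measurableT_comp (@measurable_mxcoord R d 1 i 0) (measurable_funPT (X s))).
Qed.

Lemma solution_coeff_growth : exists2 K : R, 0 < K & forall t w, t \in `[0, T] ->
  nsq (bX t w) <= K * (1 + nsq (X t w)) /\ nsq (sX t w) <= K * (1 + nsq (X t w)).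
Proof.
have [C C0 hC] := hg; have [_ hP2 _ _ _] := hX.
exists (2 * C ^+ 2); first by rewrite mulr_gt0// exprn_gt0.
move=> t w tT; have h := hC t (X t w) _ tT (hP2 t tT).
rewrite -!enorm_sqr; split.
  rewrite addrC in h.
  exact: (growth_sqr (enorm_ge0 _) (enorm_ge0 _) (enorm_ge0 _) (ltW C0) h).
exact: (growth_sqr (enorm_ge0 _) (enorm_ge0 _) (enorm_ge0 _) (ltW C0) h).
Qed.

Local Open Scope ereal_scope.

(** Linear growth gives V_t <= K U_t for the clock V of the stochastic integral. Hence {U_t <= N}
    lies, up to a null set, in {V_t <= K N}, where the localized estimate holds, and min(K N, V_t)
    <= K min(N, U_t) closes the inequality in terms of U alone. *)
Lemma solution_moment : exists2 M : R, (0 <= M)%R & forall t, t \in `[0%R, T] ->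
  \int[P]_w (nsq (X t w))%:E <= M%:E.
Proof.
have T0 := ltW hT.
have [_ hP2 cX ibX [I hI XE]] := hX.
have [Y [mY cY XY]] := regular_version T0 measurable_solution cX.
have [K K0 hK] := solution_coeff_growth.
pose U := growth_clock Y.
have U0 t w : 0 <= U t w by exact: growth_clock_ge0.
have mU t : measurable_fun setT (U t) by exact: measurable_growth_clock.
pose I0 (t : R) (w : Omega) : 'cV[R]_d := 0%R.
pose H0 (t : R) (w : Omega) : 'M[R]_d := 0%R.
have hI0 : ito_integral P F B T H0 I0 by exact: ito_integral0.
pose V t := quad_var sX H0 t.
have sub t s : t \in `[0%R, T] -> s \in `[0%R, t] -> s \in `[0%R, T].
  by rewrite !in_itv/= => /andP[_ tT] /andP[-> st]; exact: le_trans st tT.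
have VU : {ae P, forall w, forall t, t \in `[0%R, T] -> V t w <= K%:E * U t w}.
  apply: filterS XY => w XY t tT.
  rewrite /U /growth_clock -ge0_integralZl//; last 3 first.
  - exact: growth_section.
  - by move=> s _; rewrite lee_fin growth_ge0.
  - by rewrite lee_fin ltW.
  apply: ge0_le_integral_nomeas => s st; first by rewrite lee_fin nsq_ge0.
  rewrite -EFinM lee_fin /H0 subr0 /growth -XY; last exact: sub st.
  by have [_] := hK s w (sub _ _ tT st).
pose D t w : 'cV[R]_d := \col_i (\int[mu]_(r in `[0%R, t]) bX r w i 0%R)%R.
have DU : {ae P, forall w, forall t, t \in `[0%R, T] ->
    (nsq (D t w))%:E <= (T * K)%:E * U t w}.
  apply: filterS2 XY ibX => w XY ibX t tT.
  have := tT; rewrite in_itv/= => /andP[t0 tT'].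
  move: t0; rewrite le_eqVlt => /predU1P[t0|t0].
    have -> : D t w = 0%R.
      by apply/matrixP => i j; rewrite !mxE -t0 set_itv1 Rintegral_set1.
    by rewrite nsq0 mule_ge0// lee_fin mulr_ge0// ltW.
  have mb i : measurable_fun `[0%R, t] (fun s => bX s w i 0%R).
    have /measurable_int/measurable_EFinP mb := ibX i.
    by apply: measurable_funS mb => //; exact: subset_itvl.
  apply: le_trans (@nsq_Rintegral_le R d t (fun s => bX s w)
    (fun s => (K * growth Y s w)%:E) t0 mb _) _.
    move=> s st; rewrite lee_fin /growth -XY; last exact: sub st.
    by have [] := hK s w (sub _ _ tT st).
  under eq_integral do rewrite EFinM.
  rewrite ge0_integralZl//; last 3 first.
  - exact: growth_section.
  - by move=> s _; rewrite lee_fin growth_ge0.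
  - by rewrite lee_fin ltW.
  rewrite EFinM -muleA; apply: lee_wpmul2r; last by rewrite lee_fin.
  by rewrite mule_ge0 ?lee_fin ?(ltW K0)//; exact: (U0 t w).
(* The weights come from |x + D + I|^2 <= 4 |x|^2 + 4 |D|^2 + 2 |I|^2, with |D|^2 at most T K U; the
   added 1 makes positivity immediate. *)
pose c := (4 * (T * K) + 2 * (ito_constant R d * K) + 1)%R.
have TK0 : (0 <= T * K)%R by rewrite mulr_ge0// ltW.
have dK0 : (0 <= ito_constant R d * K)%R by rewrite mulr_ge0 ?ito_constant_ge0// ltW.
have c0 : (0 < c)%R by rewrite ltr_wpDl// addr_ge0// mulr_ge0.
pose a := (1 + 4 * nsq x)%R.
have a0 : (0 <= a)%R by rewrite addr_ge0// mulr_ge0// nsq_ge0.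
pose u N t := \int[P]_w mine N%:E (U t w).
have mA (N : R) t : measurable [set w | U t w <= N%:E].
  by rewrite -[X in measurable X]setTI; exact: emeasurable_fun_infty_c.
have mmin (N : R) t : measurable_fun setT (fun w => mine N%:E (U t w)) by exact: measurable_mine.
have min0 (N : R) t w : (0 <= N)%R -> 0 <= mine N%:E (U t w).
  by move=> N0; rewrite le_min lee_fin N0 U0.
have u0 (N : R) t : (0 <= N)%R -> 0 <= u N t by move=> N0; apply: integral_ge0 => w _; exact: min0.
have mI t i j : t \in `[0%R, T] -> measurable_fun setT (fun w => I t w i j).
  by move=> tT; exact: (ito_measurable hF i j hI).
have step (N t : R) : (0 <= N)%R -> t \in `[0%R, T] ->
    \int[P]_(w in [set w | U t w <= N%:E]) (growth Y t w)%:E <= a%:E + c%:E * u N t.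
  move=> N0 tT.
  have tT' : (0 <= t <= T)%R by move: tT; rewrite in_itv.
  have KN0 : (0 <= K * N)%R by rewrite mulr_ge0// ltW.
  have Iest : \int[P]_(w in [set w | U t w <= N%:E]) (nsq (I t w))%:E <=
      (ito_constant R d * K)%:E * u N t.
    apply: (@le_trans _ _ ((ito_constant R d)%:E * \int[P]_w (mine (K * N)%:E (V t w)))); last first.
      rewrite [(ito_constant R d * K)%:E]EFinM -[leRHS]muleA lee_wpmul2l ?lee_fin ?ito_constant_ge0//.
      rewrite /u -ge0_integralZl//; last 2 first.
      - by move=> w _; exact: min0.
      - by rewrite lee_fin ltW.
      apply: ae_ge0_le_integral_nomeas => //.
      - exact: emeasurable_funM.
      - by move=> w _; rewrite le_min lee_fin KN0 quad_var_ge0.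
      - by move=> w _; rewrite mule_ge0 ?min0// lee_fin ltW.
      apply: filterS VU => w /(_ t tT) VU _.
      have [NU|NU] := leP N%:E (U t w); first by rewrite -EFinM ge_min lexx.
      by rewrite ge_min VU orbT.
    apply: le_trans (ito_localized hF hB T0 hI hI0 tT' KN0).
    rewrite integral_mkcond [leRHS]integral_mkcond.
    have mV : measurable_fun setT (V t).
      have /andP[t0 tTT] := tT'; apply: (measurable_quad_var tTT) => i j.
        exact: (ito_integrand_measurable hF T0 i j hI).
      exact: (ito_integrand_measurable hF T0 i j hI0).
    have mnI : measurable_fun setT (fun w => (nsq (I t w - I0 t w))%:E).
      apply/measurable_EFinP; apply: measurable_nsq => i j.
      by rewrite /I0; under eq_fun do rewrite subr0; exact: mI.
    apply: ae_ge0_le_integral_nomeas => //.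
    - apply/(measurable_restrictT _ _).1; last exact: measurable_funTS.
      by rewrite -[X in measurable X]setTI; exact: emeasurable_fun_infty_c.
    - by move=> w _; apply: erestrict_ge0 => w' _; rewrite lee_fin nsq_ge0.
    - by move=> w _; apply: erestrict_ge0 => w' _; rewrite lee_fin nsq_ge0.
    apply: filterS VU => w /(_ t tT) VU _; rewrite /patch.
    case: ifPn => [|_]; last by case: ifP => // _; rewrite lee_fin nsq_ge0.
    rewrite inE/= => UN; rewrite ifT ?subr0// inE/=.
    by apply: le_trans VU _; rewrite EFinM lee_wpmul2l// lee_fin ltW.
  rewrite integral_mkcond in Iest.
  have mR : measurable_fun setT ((fun w => (nsq (I t w))%:E) \_ [set w | U t w <= N%:E]).
    apply/(measurable_restrictT _ _).1 => //; apply: measurable_funTS.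
    by apply/measurable_EFinP; apply: measurable_nsq => i j; exact: mI.
  have R0 w : 0 <= ((fun w => (nsq (I t w))%:E) \_ [set w | U t w <= N%:E]) w.
    by apply: erestrict_ge0 => w' _; rewrite lee_fin nsq_ge0.
  rewrite integral_mkcond.
  apply: (@le_trans _ _ (\int[P]_w (a%:E + ((4 * (T * K))%:E * mine N%:E (U t w) +
     2%:E * ((fun w => (nsq (I t w))%:E) \_ [set w | U t w <= N%:E]) w)))).
    have rhs0 w : 0 <= a%:E + ((4 * (T * K))%:E * mine N%:E (U t w) +
       2%:E * ((fun w => (nsq (I t w))%:E) \_ [set w | U t w <= N%:E]) w).
      by rewrite adde_ge0 ?lee_fin// adde_ge0// mule_ge0 ?min0// lee_fin mulr_ge0.
    apply: ae_ge0_le_integral_nomeas => //.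
    - apply: emeasurable_funD => //; apply: emeasurable_funD; exact: emeasurable_funM.
    - by move=> w _; apply: erestrict_ge0 => w' _; rewrite lee_fin growth_ge0.
    apply: filterS3 XY XE DU => w XY XE DU _; rewrite {1}/patch.
    case: ifPn => UN; last exact: rhs0.
    rewrite /patch UN; rewrite inE/= in UN.
    rewrite min_r// /growth -XY// XE//.
    have := DU t tT; have Ufin : U t w \is a fin_num by exact: growth_clock_fin.
    rewrite -(fineK Ufin) -!EFinM -!EFinD !lee_fin -/(D t w) => DUw.
    have := nsqD (x + D t w) (I t w); have := nsqD x (D t w); rewrite /a; lra.
  have m4 : 0 <= (4 * (T * K))%:E by rewrite lee_fin mulr_ge0.
  rewrite ge0_integralD//; last 2 first.
  - by move=> w _; rewrite adde_ge0// mule_ge0 ?min0.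
  - by apply: emeasurable_funD; exact: emeasurable_funM.
  rewrite integral_cst//= probability_setT mule1 leeD2l//.
  rewrite ge0_integralD//; last 4 first.
  - by move=> w _; rewrite mule_ge0 ?min0.
  - exact: emeasurable_funM.
  - by move=> w _; rewrite mule_ge0.
  - exact: emeasurable_funM.
  rewrite !ge0_integralZl//; last by move=> w _; exact: min0.
  have -> : c%:E * u N t = (4 * (T * K))%:E * u N t + (2 * (ito_constant R d * K))%:E * u N t + u N t.
    rewrite -[in X in _ + _ + X](mul1e (u N t)) -!ge0_muleDl ?lee_fin ?addr_ge0
      ?mulr_ge0 ?ito_constant_ge0 ?(ltW T0) ?(ltW K0)//.
  rewrite -[leLHS]adde0; apply: leeD; last exact: u0.
  by apply: leeD => //; rewrite [X in _ <= X * _]EFinM -muleA lee_wpmul2l.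
(* Gronwall's bound at time [T], free of N; the constant [a] has become [a * T] by integration in
   time. *)
pose A := (2 * (a * T) * expR (2 * c * T))%R.
have A0 : (0 <= A)%R by rewrite mulr_ge0 ?expR_ge0// mulr_ge0// mulr_ge0.
have uA (N t : R) : (0 <= N)%R -> t \in `[0%R, T] -> u N t <= A%:E.
  move=> N0 tT.
  have mu_N : measurable_fun `[0%R, T] (u N).
    apply: (@measurable_section_expectation _ _ R P `[0%R, T]
      (fun z : R * Omega => mine N%:E (U z.1 z.2))) => //.
      by apply: measurable_mine => //; exact: measurable_growth_clock_joint.
    by move=> z _; exact: min0.
  have uN s : s \in `[0%R, T] -> 0 <= u N s <= N%:E.
    move=> _; rewrite u0//=; apply: (@le_trans _ _ (\int[P]_w N%:E)).
      apply: ge0_le_integral_nomeas => w _; first exact: min0.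
      by rewrite ge_min lexx.
    by rewrite integral_cst//= probability_setT mule1.
  have aT0 : (0 <= a * T)%R by rewrite mulr_ge0.
  apply: le_trans (gronwall aT0 c0 T0 mu_N uN _ tT) _; last first.
    rewrite lee_fin ler_wpM2l ?mulr_ge0// ler_expR ler_wpM2l ?mulr_ge0 ?(ltW c0)//.
    by move: tT; rewrite in_itv/= => /andP[].
  move=> s sT; have := sT; rewrite in_itv/= => /andP[s0 sT'].
  apply: le_trans (expected_clock_le P mY cY s0 N0) _.
  have mus : measurable_fun `[0%R, s] (u N).
    by apply: measurable_funS mu_N => //; exact: subset_itvl.
  apply: (@le_trans _ _ (\int[mu]_(r in `[0%R, s]) (a%:E + c%:E * u N r))).
    apply: ge0_le_integral_nomeas => r rs.
      by apply: integral_ge0 => w _; rewrite lee_fin growth_ge0.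
    by apply: step => //; exact: sub rs.
  rewrite ge0_integralD//; last 2 first.
  - by move=> r _; rewrite mule_ge0 ?u0// lee_fin ltW.
  - exact: emeasurable_funM.
  rewrite ge0_integralZl//; last 2 first.
  - by move=> r _; exact: u0.
  - by rewrite lee_fin ltW.
  rewrite leeD2r// integral_cst//= lebesgue_measure_itv/= lte_fin.
  case: ifPn => _; last by rewrite mule0 lee_fin.
  by rewrite -EFinD subr0 -EFinM lee_fin ler_wpM2l.
exists (a + c * A)%R; first by rewrite addr_ge0// mulr_ge0// ltW.
move=> t tT; apply: (@le_trans _ _ (\int[P]_w (growth Y t w)%:E)).
  apply: ae_ge0_le_integral_nomeas => //.
  - by apply/measurable_EFinP; apply: measurable_funD => //; exact: measurable_nsq_process.
  - by move=> w _; rewrite lee_fin nsq_ge0.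
  - by move=> w _; rewrite lee_fin growth_ge0.
  by apply: filterS XY => w XY _; rewrite lee_fin XY// /growth lerDr.
apply: (@integral_exhaustion _ _ _ P _ (U t)) => //.
- by apply/measurable_EFinP; apply: measurable_funD => //; exact: measurable_nsq_process.
- by move=> w; rewrite lee_fin growth_ge0.
- by apply: aeW => w; rewrite -ge0_fin_numE ?U0//; exact: growth_clock_fin.
move=> n; apply: le_trans (step _ _ _ tT) _ => //.
by rewrite [leRHS]EFinD leeD2l// [(c * A)%:E]EFinM lee_wpmul2l ?lee_fin ?(ltW c0)// uA.
Qed.

End one_solution.
End solution_moments.

(** * Stability of the coefficients and of the solutions *)

Section laws.
Context (d0 : measure_display) (Omega : measurableType d0) (R : realType).
Context (P : probability Omega R) (d : nat).
Implicit Types X Y : {RV P >-> 'cV[R]_d}.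
Local Notation Rd := 'cV[R]_d.

Lemma W2_distribution_le X Y :
  (W2 (distribution P X) (distribution P Y) <=
   (\int[P]_w (nsq (X w - Y w))%:E) `^ 2^-1)%E.
Proof.
pose Z (w : Omega) : Rd * Rd := (X w, Y w).
have mZ : measurable_fun setT Z by exact: measurable_fun_pair.
pose isZ := isMeasurableFun.Build _ _ _ _ Z mZ.
pose ZM : {RV P >-> (Rd * Rd)%type} := HB.pack Z isZ.
apply: ereal_inf_lbound; exists (distribution P ZM).
  move=> A mA; rewrite /distribution /pushforward/=; split; congr (P _);
    by apply/seteqP; split => w //= [].
rewrite ge0_integral_distribution; last 2 first.
- apply/measurable_EFinP; under eq_fun do rewrite enorm_sqr.
  apply: measurable_nsq => i j.
  rewrite (_ : (fun _ => _) = fun z : Rd * Rd => z.1 i j - z.2 i j);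
    last by apply/funext => z; rewrite !mxE.
  by apply: measurable_funB; apply: measurableT_comp (measurable_mxcoord i j) _.
- by move=> z; rewrite lee_fin sqr_ge0.
by congr (_ `^ _)%E; apply: eq_integral => w _ /=; rewrite enorm_sqr.
Qed.

(** [z] is a real bound on E|X - Y|^2; the extended-valued [W2] is replaced by the number
    [Num.sqrt z] before squaring. *)
Lemma lipschitz_nsq (T L : R) m k (f : coeff R d m k) t y y' X Y z :
  0 < L -> lipschitz_with T L f -> t \in `[0, T] ->
  P2 (distribution P X) -> P2 (distribution P Y) ->
  (\int[P]_w (nsq (X w - Y w))%:E <= z%:E)%E ->
  nsq (f t y (distribution P X) - f t y' (distribution P Y)) <=
  2 * L ^+ 2 * (nsq (y - y') + z).
Proof.
move=> L0 hL tT hX hY hz.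
have z0 : 0 <= z.
  by rewrite -lee_fin (le_trans _ hz)//; apply: integral_ge0 => w _; rewrite lee_fin nsq_ge0.
have hW : (W2 (distribution P X) (distribution P Y) <= (Num.sqrt z)%:E)%E.
  apply: le_trans (W2_distribution_le X Y) _; rewrite -powR12_sqrt// -poweR_EFin.
  apply: gt0_ler_poweR => //; rewrite ?in_itv/= ?leey ?andbT ?lee_fin ?z0 ?invr_ge0//.
  by apply: integral_ge0 => w _; rewrite lee_fin nsq_ge0.
have := hL t y y' _ _ tT hX hY => h.
have {}h : enorm (f t y (distribution P X) - f t y' (distribution P Y)) <=
    L * (enorm (y - y') + Num.sqrt z).
  rewrite -lee_fin; apply: le_trans h _.
  by rewrite EFinM lee_wpmul2l ?lee_fin ?(ltW L0)// EFinD leeD2l.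
rewrite -enorm_sqr; apply: (@le_trans _ _ ((L * (enorm (y - y') + Num.sqrt z)) ^+ 2)).
  by rewrite lerXn2r ?nnegrE ?enorm_ge0// mulr_ge0 ?(ltW L0)// addr_ge0 ?enorm_ge0.
rewrite exprMn -enorm_sqr -[X in _ <= _ * (_ + X)]sqr_sqrtr//.
rewrite (_ : 2 * L ^+ 2 * _ = L ^+ 2 * (2 * (enorm (y - y') ^+ 2 + Num.sqrt z ^+ 2))); last by ring.
rewrite ler_wpM2l ?sqr_ge0//.
by have := sqr_ge0 (enorm (y - y') - Num.sqrt z); nra.
Qed.

End laws.

(** * Gaps between coefficients *)

Section coefficient_gaps.
Context (R : realType) (d : nat).

(** A product of segments is compact as a set of row vectors, and transposition is continuous. *)
Lemma compact_box (q : R) : compact [set y : 'cV[R]_d | forall i, y i 0 \in `[-q, q]].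
Proof.
have cT : continuous (fun v : 'rV[R]_d => v^T).
  move=> v A [E hE EA]; exists (fun i j => E j i); first by move=> i j; have := hE j i; rewrite mxE.
  by move=> u hu; apply: EA => i j; rewrite mxE; exact: hu.
have cK : compact [set v : 'rV[R]_d | forall i, `[-q, q]%classic (v ord0 i)].
  by apply: (@rV_compact R d (fun=> `[-q, q]%classic)) => i; exact: segment_compact.
have := continuous_compact (continuous_subspaceT cT) cK.
congr compact; apply/seteqP; split => [_ [v hv <-] i|y hy] /=; first by rewrite mxE; exact: hv.
exists y^T; last by rewrite trmxK.
by move=> i /=; rewrite mxE; exact: hy.
Unshelve. all: by end_near. Qed.

Lemma uniform_coeff_gap (T : R) (b : coeff R d d 1) (s : coeff R d d d)
    (bn : nat -> coeff R d d 1) (sn : nat -> coeff R d d d) (r e : R) :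
  (forall K : set 'cV[R]_d, compact K -> K !=set0 ->
    ereal_sup [set ereal_sup [set ereal_sup
        [set (enorm (bn n t y mu - b t y mu) + enorm (sn n t y mu - s t y mu))%:E
        | mu in @P2 R d] | y in K] | t in `[0%R, T]] @[n --> \oo] --> 0%E) ->
  0 < e -> \forall n \near \oo, forall t y mu, t \in `[0, T] -> P2 mu -> nsq y <= r ->
    nsq (bn n t y mu - b t y mu) <= e /\ nsq (sn n t y mu - s t y mu) <= e.
Proof.
(* The box of half-width [q] contains {|y|^2 <= r}, since the square root of |r| is at most 1 + |r|.
   As e' <= 1, a norm below e' has its square below e. *)
move=> h e0; pose q := 1 + `|r|; pose e' := Num.min 1 e.
have e'0 : 0 < e' by rewrite lt_min ltr01.
have K0 : [set y : 'cV[R]_d | forall i, y i 0 \in `[-q, q]] !=set0.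
  by exists 0 => i; rewrite mxE in_itv/= oppr_le0 andbb addr_ge0.
have := h _ (@compact_box q) K0 => {}h.
have nh : nbhs (0%E : \bar R) [set y | (y < e'%:E)%E].
  by apply: open_nbhs_nbhs; split; [exact: open_ereal_lt_ereal|rewrite /= lte_fin].
have [N _ hN] := h _ nh; exists N => // n /hN /= hn t y mu tT hmu yr.
have : ((enorm (bn n t y mu - b t y mu) + enorm (sn n t y mu - s t y mu))%:E < e'%:E)%E.
  apply: le_lt_trans hn; apply: le_trans; last first.
    by apply: ereal_sup_ubound; exists t => //; reflexivity.
  apply: le_trans; last first.
    apply: ereal_sup_ubound; exists y; last reflexivity.
    move=> i; rewrite in_itv/= -ler_norml.
    have := le_trans (sqr_coord_le_nsq y i 0) (le_trans yr (ler_norm r)).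
    rewrite -real_normK ?num_real// /q; have := normr_ge0 (y i 0); nra.
  by apply: ereal_sup_ubound; exists mu.
rewrite lte_fin => hs.
have [h1 h2] := (enorm_ge0 (bn n t y mu - b t y mu), enorm_ge0 (sn n t y mu - s t y mu)).
have e'1 : e' <= 1 by rewrite ge_min lexx.
have e'e : e' <= e by rewrite ge_min lexx orbT.
rewrite -!enorm_sqr; split; nra.
Qed.

Definition tail m n (r : R) (y : 'M[R]_(m, n)) : R := if nsq y <= r then 0 else nsq y.

Lemma tail_ge0 m n r (y : 'M[R]_(m, n)) : 0 <= tail r y.
Proof. by rewrite /tail; case: ifP => // _; exact: nsq_ge0. Qed.

Lemma tail_le m n r (y : 'M[R]_(m, n)) : tail r y <= nsq y.
Proof. by rewrite /tail; case: ifP => // _; exact: nsq_ge0. Qed.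

(* If |y'|^2 > r then either |y|^2 > r/4, or |y'| <= 2 |y' - y|. *)
Lemma coeff_gap m k (a c b : 'M[R]_(m, k)) (y y' : 'cV[R]_d) (K M e r z : R) :
  0 <= K -> 0 <= M -> 0 <= e -> 0 <= z -> 1 <= r ->
  nsq a <= K * (1 + nsq y') -> nsq c <= K * (1 + nsq y') ->
  (nsq y' <= r -> nsq (a - c) <= e) -> nsq (c - b) <= M * (nsq (y' - y) + z) ->
  nsq (a - b) <= (2 + 64 * K + 2 * M) * (e + tail (r / 4) y + nsq (y' - y) + z).
Proof.
move=> K0 M0 e0 z0 r1 aK cK ace cbM.
have N0 := nsq_ge0 (y' - y); have t0 := tail_ge0 (r / 4) y; have ny := nsq_ge0 y.
have acK := nsqD a (- c); rewrite nsqN in acK.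
have := nsqD (a - c) (c - b); rewrite addrA subrK => h.
have hac : nsq (a - c) <= e + 4 * K * (8 * nsq (y' - y) + 4 * tail (r / 4) y).
  have [yr|yr] := leP (nsq y') r.
    by apply: le_trans (ace yr) _; rewrite lerDl mulr_ge0// ?mulr_ge0// addr_ge0// mulr_ge0.
  have y'D : nsq y' <= 2 * (nsq (y' - y) + nsq y) by have := nsqD (y' - y) y; rewrite subrK.
  (* Here 1 <= r < |y'|^2, so the left side is at most 2 |y'|^2; this absorbs the constant 1 of the
     linear growth. *)
  have y'b : 1 + nsq y' <= 8 * nsq (y' - y) + 4 * tail (r / 4) y.
    by move: t0; rewrite /tail; case: (leP (nsq y) (r / 4)) => hr t0; lra.
  have := ler_wpM2l K0 y'b; lra.
set N := nsq (y' - y) in N0 cbM hac *; set t := tail _ y in t0 hac *.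
have p1 : 0 <= K * e by rewrite mulr_ge0.
have p2 : 0 <= K * z by rewrite mulr_ge0.
have p3 : 0 <= K * t by rewrite mulr_ge0.
have p4 : 0 <= K * N by rewrite mulr_ge0.
have p5 : 0 <= M * e by rewrite mulr_ge0.
have p6 : 0 <= M * t by rewrite mulr_ge0.
lra.
Qed.

End coefficient_gaps.

(** * Expected gap along two processes *)

Section stability.
Context (d0 : measure_display) (Omega : measurableType d0) (R : realType).
Context (P : probability Omega R) (d : nat) (T : R) (hT : 0 < T).
Local Notation mu := (@lebesgue_measure R).
Local Open Scope ereal_scope.

Section versions.
Context (Y Y' : R -> Omega -> 'cV[R]_d).
Context (mY : forall s i, measurable_fun setT (fun w => Y s w i 0%R)).
Context (cY : forall w i, continuous (fun s => Y s w i 0%R)).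
Context (mY' : forall s i, measurable_fun setT (fun w => Y' s w i 0%R)).
Context (cY' : forall w i, continuous (fun s => Y' s w i 0%R)).

Definition sqr_dist (s : R) (w : Omega) : R := nsq (Y' s w - Y s w).

Lemma measurable_sqr_dist_time s : measurable_fun setT (sqr_dist s).
Proof.
apply: measurable_nsq => i j; rewrite (ord1 j).
rewrite (_ : (fun _ => _) = fun w => Y' s w i 0 - Y s w i 0)%R;
  last by apply/funext => w; rewrite !mxE.
exact: measurable_funB.
Qed.

Lemma measurable_sqr_dist : measurable_fun setT (fun z : R * Omega => sqr_dist z.1 z.2).
Proof.
apply: (@measurable_continuous_process _ _ R sqr_dist); first exact: measurable_sqr_dist_time.
move=> w; apply: (@continuous_nsq_process _ _ R _ (fun s w => Y' s w - Y s w)%R) => {}w i s.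
rewrite (_ : (fun _ => _) = fun s => Y' s w i 0 - Y s w i 0)%R;
  last by apply/funext => ?; rewrite !mxE.
by apply: cvgB; [exact: cY'|exact: cY].
Qed.

Lemma measurable_tail r : measurable_fun setT (fun z : R * Omega => tail r (Y z.1 z.2)).
Proof.
have mn : measurable_fun setT (fun z : R * Omega => nsq (Y z.1 z.2)).
  apply: (@measurable_continuous_process _ _ R (fun s w => nsq (Y s w))).
    by move=> s; exact: measurable_nsq_process.
  by move=> w; exact: continuous_nsq_process.
by apply: measurable_fun_ifT => //; exact: measurable_fun_ler.
Qed.

Definition mean_sqr_dist (s : R) : \bar R := \int[P]_w (sqr_dist s w)%:E.

Lemma mean_sqr_dist_ge0 s : 0 <= mean_sqr_dist s.
Proof. by apply: integral_ge0 => w _; rewrite lee_fin nsq_ge0. Qed.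

Lemma measurable_mean_sqr_dist : measurable_fun setT mean_sqr_dist.
Proof.
apply: (@measurable_section_expectation _ _ R P setT
  (fun z : R * Omega => (sqr_dist z.1 z.2)%:E)) => //.
  by rewrite setXTT; apply/measurable_EFinP; exact: measurable_sqr_dist.
by move=> z _; rewrite lee_fin nsq_ge0.
Qed.

Definition mean_tail (r s : R) : \bar R := \int[P]_w (tail r (Y s w))%:E.

Lemma mean_tail_ge0 r s : 0 <= mean_tail r s.
Proof. by apply: integral_ge0 => w _; rewrite lee_fin tail_ge0. Qed.

Lemma measurable_mean_tail r : measurable_fun setT (mean_tail r).
Proof.
apply: (@measurable_section_expectation _ _ R P setT
  (fun z : R * Omega => (tail r (Y z.1 z.2))%:E)) => //.
  by rewrite setXTT; apply/measurable_EFinP; exact: measurable_tail.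
by move=> z _; rewrite lee_fin tail_ge0.
Qed.

Let mean_cst (v : \bar R) : \int[P]_w v = v.
Proof. by rewrite integral_cst//= probability_setT mule1. Qed.

Let adde3_ge0 (a b c : \bar R) : 0 <= a -> 0 <= b -> 0 <= c -> 0 <= a + b + c.
Proof. by move=> a0 b0 c0; rewrite adde_ge0// adde_ge0. Qed.

Let adde4_ge0 (a b c e : \bar R) : 0 <= a -> 0 <= b -> 0 <= c -> 0 <= e -> 0 <= a + b + c + e.
Proof. by move=> a0 b0 c0 e0; rewrite adde_ge0// adde3_ge0. Qed.

Section gap.
Context (c e r : R) (c0 : (0 <= c)%R) (e0 : (0 <= e)%R).

(** The bound of [coeff_gap] along the two processes, the mean squared distance standing for the
    contribution of the laws. *)
Definition gap_bound (z : R * Omega) : \bar R :=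
  c%:E * (e%:E + (tail r (Y z.1 z.2))%:E + (sqr_dist z.1 z.2)%:E + mean_sqr_dist z.1).

Lemma gap_bound_ge0 z : 0 <= gap_bound z.
Proof.
apply: mule_ge0; first by rewrite lee_fin.
by apply: adde4_ge0; rewrite ?lee_fin ?tail_ge0 ?nsq_ge0 ?mean_sqr_dist_ge0.
Qed.

Lemma measurable_gap_bound : measurable_fun setT gap_bound.
Proof.
apply: emeasurable_funM => //; apply: emeasurable_funD; last first.
  exact: measurableT_comp measurable_mean_sqr_dist measurable_fst.
apply: emeasurable_funD; last by apply/measurable_EFinP; exact: measurable_sqr_dist.
by apply: emeasurable_funD => //; apply/measurable_EFinP; exact: measurable_tail.
Qed.

(** The squared distance and its mean have the same expectation, whence the factor 2. The terms in
    [e] and in the tail are integrated up to [T], so that they are constant in [t] for Gronwall's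
    lemma. *)
Lemma expected_gap_bound t : (0 <= t <= T)%R ->
  \int[P]_w \int[mu]_(s in `[0%R, t]) gap_bound (s, w) <=
  c%:E * ((e * T)%:E + \int[mu]_(s in `[0%R, T]) mean_tail r s +
          2%:E * \int[mu]_(s in `[0%R, t]) mean_sqr_dist s).
Proof.
move=> /andP[t0 tT].
have mD : measurable (`[0%R, t]%classic : set R) by [].
have mg : measurable_fun (`[0%R, t]%classic `*` setT) gap_bound.
  by apply: measurable_funTS; exact: measurable_gap_bound.
rewrite (tonelli_on P mD mg); last by move=> z _; exact: gap_bound_ge0.
have mtail := measurable_mean_tail r; have msq := measurable_mean_sqr_dist.
have mt s : measurable_fun setT (fun w => (tail r (Y s w))%:E).
  apply/measurable_EFinP; apply: measurable_fun_ifT => //; last exact: measurable_nsq_process.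
  by apply: measurable_fun_ler => //; exact: measurable_nsq_process.
have ms s : measurable_fun setT (fun w => (sqr_dist s w)%:E).
  by apply/measurable_EFinP; exact: measurable_sqr_dist_time.
have t0' s w : 0 <= (tail r (Y s w))%:E by rewrite lee_fin tail_ge0.
have s0' s w : 0 <= (sqr_dist s w)%:E by rewrite lee_fin nsq_ge0.
have m0 := mean_sqr_dist_ge0; have k0 := mean_tail_ge0 r.
have e0' : 0 <= e%:E by [].
under eq_integral => s _.
  rewrite /gap_bound/= ge0_integralZl//; last 2 first.
  - by apply: emeasurable_funD => //; apply: emeasurable_funD => //; exact: emeasurable_funD.
  - by move=> w _; exact: adde4_ge0.
  rewrite ge0_integralD//; last 2 first.
  - by move=> w _; exact: adde3_ge0.
  - by apply: emeasurable_funD => //; exact: emeasurable_funD.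
  rewrite ge0_integralD//; last 2 first.
  - by move=> w _; exact: adde_ge0.
  - exact: emeasurable_funD.
  rewrite ge0_integralD//.
  rewrite -/(mean_sqr_dist s) -/(mean_tail r s) !mean_cst.
  over.
have mtail' := measurable_funTS (D := `[0%R, t]%classic) mtail.
have msq' := measurable_funTS (D := `[0%R, t]%classic) msq.
rewrite ge0_integralZl//; last 2 first.
- by apply: emeasurable_funD => //; apply: emeasurable_funD => //; exact: emeasurable_funD.
- by move=> s _; exact: adde4_ge0.
rewrite lee_wpmul2l//.
rewrite ge0_integralD//; last 2 first.
- by move=> s _; exact: adde3_ge0.
- by apply: emeasurable_funD => //; exact: emeasurable_funD.
rewrite ge0_integralD//; last 2 first.
- by move=> s _; exact: adde_ge0.
- exact: emeasurable_funD.
rewrite ge0_integralD//.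
rewrite -addeA; apply: leeD; last by rewrite (_ : 2%:E = 1 + 1 :> \bar R)// ge0_muleDl// !mul1e.
apply: leeD.
  rewrite integral_cst//= lebesgue_measure_itv/= lte_fin.
  case: ifPn => _; last by rewrite mule0 lee_fin mulr_ge0// ltW.
  by rewrite -EFinD subr0 -EFinM lee_fin ler_wpM2l.
apply: ge0_subset_integral => //; first exact: measurable_funTS.
exact: subset_itvl.
Qed.

End gap.
End versions.
End stability.

(** * Distance between two solutions *)

Section two_solutions.
Context (d0 : measure_display) (Omega : measurableType d0) (R : realType).
Context (P : probability Omega R) (F : R -> set (set Omega)).
Context (hF : usual_filtration P F) (d : nat) (B : R -> Omega -> 'cV[R]_d).
Context (hB : brownian_motion P F B).
Context (T : R) (hT : 0 < T) (x : 'cV[R]_d).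
Local Notation mu := (@lebesgue_measure R).

Context (b : coeff R d d 1) (sg : coeff R d d d) (X : R -> {RV P >-> 'cV[R]_d}).
Context (hX : mkv_solution F B T x b sg X) (hg : linear_growth T b sg).
Context (Y : R -> Omega -> 'cV[R]_d).
Context (mY : forall s i, measurable_fun setT (fun w => Y s w i 0)).
Context (cY : forall w i, continuous (fun s => Y s w i 0)).
Context (XY : {ae P, forall w, forall t, t \in `[0, T] -> X t w = Y t w}).

Context (L K : R) (L0 : 0 < L) (K0 : 0 < K).
Context (lb : lipschitz_with T L b) (ls : lipschitz_with T L sg).

(** [c1] is the constant of [coeff_gap] with M = 2 L^2 from [lipschitz_nsq]. In [c2], the drift
    contributes 2 T and the stochastic integral 2 [ito_constant R d]. [stability_constant] is what
    Gronwall's lemma leaves at rate 2 [c2]. None of them depends on the perturbed coefficients,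
    which makes the estimate uniform in n. *)
Let c1 : R := 2 + 64 * K + 2 * (2 * L ^+ 2).
Let c2 : R := (2 * T + 2 * ito_constant R d) * c1.

Definition stability_constant : R := c2 * (1 + 2 * (2 * c2) * T * expR (2 * (2 * c2) * T)).

Context (b' : coeff R d d 1) (sg' : coeff R d d d) (X' : R -> {RV P >-> 'cV[R]_d}).
Context (hX' : mkv_solution F B T x b' sg' X') (hg' : linear_growth T b' sg').
Context (e r : R) (e0 : 0 <= e) (r1 : 1 <= r).
Context (hK : forall t y nu, t \in `[0, T] -> P2 nu ->
  [/\ nsq (b t y nu) <= K * (1 + nsq y), nsq (sg t y nu) <= K * (1 + nsq y),
      nsq (b' t y nu) <= K * (1 + nsq y) & nsq (sg' t y nu) <= K * (1 + nsq y)]).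
Context (he : forall t y nu, t \in `[0, T] -> P2 nu -> nsq y <= r ->
  nsq (b' t y nu - b t y nu) <= e /\ nsq (sg' t y nu - sg t y nu) <= e).
Local Open Scope ereal_scope.

Local Notation bX := (fun t w => b t (X t w) (distribution P (X t))).
Local Notation sX := (fun t w => sg t (X t w) (distribution P (X t))).
Local Notation bX' := (fun t w => b' t (X' t w) (distribution P (X' t))).
Local Notation sX' := (fun t w => sg' t (X' t w) (distribution P (X' t))).

Let T0 : (0 <= T)%R := ltW hT.

Let sub t s : t \in `[0%R, T] -> s \in `[0%R, t] -> s \in `[0%R, T].
Proof.
by rewrite !in_itv/= => /andP[_ tT] /andP[-> st]; exact: le_trans st tT.
Qed.

Let c1_gt0 : (0 < c1)%R.
Proof. by rewrite /c1 -addrA ltr_pwDl// addr_ge0// !mulr_ge0// ltW. Qed.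

Let c2_gt0 : (0 < c2)%R.
Proof.
apply: mulr_gt0 c1_gt0; rewrite ltr_pwDl ?mulr_gt0//.
by apply: mulr_ge0 => //; exact: ito_constant_ge0.
Qed.

Lemma stability_constant_gt0 : (0 < stability_constant)%R.
Proof.
apply: (mulr_gt0 c2_gt0); rewrite ltr_pwDl// mulr_ge0 ?expR_ge0// mulr_ge0//.
by rewrite mulr_ge0// mulr_ge0// (ltW c2_gt0).
Qed.

Section with_version.
Context (Y' : R -> Omega -> 'cV[R]_d).
Context (mY' : forall s i, measurable_fun setT (fun w => Y' s w i 0%R)).
Context (cY' : forall w i, continuous (fun s => Y' s w i 0%R)).
Context (XY' : {ae P, forall w, forall t, t \in `[0%R, T] -> X' t w = Y' t w}).

Local Notation zeta := (mean_sqr_dist P Y Y').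

Let measurable_dist s : measurable_fun setT (fun w => nsq (X' s w - X s w)).
Proof.
apply: measurable_nsq => i j; rewrite (ord1 j).
rewrite (_ : (fun _ => _) = fun w => X' s w i 0 - X s w i 0)%R;
  last by apply/funext => w; rewrite !mxE.
by apply: measurable_funB; exact: measurable_solution.
Qed.

Lemma mean_sqr_distE s : s \in `[0%R, T] ->
  zeta s = \int[P]_w (nsq (X' s w - X s w))%:E.
Proof.
move=> sT; apply: ae_eq_integral => //.
- by apply/measurable_EFinP; exact: measurable_sqr_dist_time.
- exact/measurable_EFinP.
by apply: filterS2 XY XY' => w h h' _; rewrite /sqr_dist h// h'.
Qed.

(** This is the a priori bound that Gronwall's lemma asks for; it also lets the mean squared
    distance be treated as a real number. *)
Lemma mean_sqr_dist_bound : exists2 M : R, (0 <= M)%R &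
  forall s, s \in `[0%R, T] -> zeta s <= M%:E.
Proof.
have [M M0 hM] := solution_moment hF hB hT hX hg.
have [M' M'0 hM'] := solution_moment hF hB hT hX' hg'.
exists (2 * M' + 2 * M)%R; first by rewrite addr_ge0 ?mulr_ge0.
move=> s sT; rewrite mean_sqr_distE//.
have mn (Z : {RV P >-> 'cV[R]_d}) : measurable_fun setT (fun w => (nsq (Z w))%:E).
  apply/measurable_EFinP; apply: measurable_nsq => i j; rewrite (ord1 j).
  exact: (measurable_solution (fun=> Z) 0%R).
apply: (@le_trans _ _ (\int[P]_w (2%:E * (nsq (X' s w))%:E + 2%:E * (nsq (X s w))%:E))).
  apply: ge0_le_integral_nomeas => w _; first by rewrite lee_fin nsq_ge0.
  rewrite -!EFinM -EFinD lee_fin; have := nsqD (X' s w) (- X s w)%R; rewrite nsqN; lra.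
rewrite ge0_integralD//; last 4 first.
- by move=> w _; rewrite mule_ge0// lee_fin nsq_ge0.
- exact: emeasurable_funM.
- by move=> w _; rewrite mule_ge0// lee_fin nsq_ge0.
- exact: emeasurable_funM.
rewrite !ge0_integralZl//; last 2 first.
- by move=> w _; rewrite lee_fin nsq_ge0.
- by move=> w _; rewrite lee_fin nsq_ge0.
rewrite [leRHS]EFinD; apply: leeD; rewrite [leRHS]EFinM lee_wpmul2l//; first exact: hM'.
exact: hM.
Qed.

Let zeta_fin s : s \in `[0%R, T] -> zeta s \is a fin_num.
Proof.
move=> sT; have [M _ hM] := mean_sqr_dist_bound.
by rewrite ge0_fin_numE ?mean_sqr_dist_ge0// (le_lt_trans (hM s sT))// ltry.
Qed.

Local Notation gapY := (gap_bound P Y Y' c1 e (r / 4)).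

(** The intermediate term in [coeff_gap] is the unperturbed coefficient at [X'] and its own law:
    [he] compares two coefficients at the same arguments, and [lb], [ls] move the arguments. *)
Lemma coefficients_gap : {ae P, forall w, forall s, s \in `[0%R, T] ->
  (nsq (bX' s w - bX s w))%:E <= gapY (s, w) /\
  (nsq (sX' s w - sX s w))%:E <= gapY (s, w)}.
Proof.
apply: filterS2 XY XY' => w h h' s sT.
have [_ hP _ _ _] := hX; have [_ hP' _ _ _] := hX'.
have Z0 : 0 <= zeta s by exact: mean_sqr_dist_ge0.
have z0 : (0 <= fine (zeta s))%R by exact: fine_ge0.
have zP : \int[P]_w (nsq (X' s w - X s w))%:E <= (fine (zeta s))%:E.
  by rewrite fineK ?zeta_fin// -mean_sqr_distE.
have [kb ks kb' ks'] := hK (X' s w) sT (hP' s sT).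
rewrite /gap_bound/= /sqr_dist -h// -h'// -[zeta s]fineK ?zeta_fin//.
rewrite -!EFinD -!EFinM !lee_fin; split.
  apply: (coeff_gap (ltW K0) _ e0 z0 r1 kb' kb); first by rewrite mulr_ge0 ?sqr_ge0.
    by move=> yr; have [] := he sT (hP' s sT) yr.
  exact: (lipschitz_nsq _ _ L0 lb sT (hP' s sT) (hP s sT) zP).
apply: (coeff_gap (ltW K0) _ e0 z0 r1 ks' ks); first by rewrite mulr_ge0 ?sqr_ge0.
  by move=> yr; have [] := he sT (hP' s sT) yr.
exact: (lipschitz_nsq _ _ L0 ls sT (hP' s sT) (hP s sT) zP).
Qed.

Let clock t w := \int[mu]_(s in `[0%R, t]) gapY (s, w).

Let gap0 z : 0 <= gapY z.
Proof. by apply: gap_bound_ge0 => //; exact: ltW. Qed.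

Let mgap : measurable_fun setT gapY.
Proof. exact: measurable_gap_bound. Qed.

Let clock0 t w : 0 <= clock t w.
Proof. by apply: integral_ge0 => s _; exact: gap0. Qed.

Let mclock t : measurable_fun setT (clock t).
Proof.
have mD : measurable (`[0%R, t]%classic : set R) by [].
have mg : measurable_fun (`[0%R, t]%classic `*` setT) gapY by exact: measurable_funTS.
by apply: (measurable_section_integral mD mg) => z _; exact: gap0.
Qed.

Let clock_mono s t w : (s <= t)%R -> clock s w <= clock t w.
Proof.
move=> st; apply: ge0_subset_integral => //; last exact: subset_itvl.
have mD : measurable (`[0%R, t]%classic : set R) by [].
have mg : measurable_fun (`[0%R, t]%classic `*` setT) gapY by exact: measurable_funTS.
exact: (measurable_section w mD mg).
Qed.

Let drift_diff : {ae P, forall w, forall s, s \in `[0%R, T] ->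
  (nsq ((\col_i (\int[mu]_(r in `[0%R, s]) bX' r w i 0)) -
        (\col_i (\int[mu]_(r in `[0%R, s]) bX r w i 0)))%R)%:E <= T%:E * clock s w}.
Proof.
have [_ _ _ ib _] := hX; have [_ _ _ ib' _] := hX'.
apply: filterS3 coefficients_gap ib ib' => w hgap ib ib' s sT.
have := sT; rewrite in_itv/= => /andP[s0 sT'].
have int i : mu.-integrable `[0%R, s] (EFin \o (fun t => bX t w i 0%R)).
  by apply: (integrableS _ _ _ (ib i)) => //; exact: subset_itvl.
have int' i : mu.-integrable `[0%R, s] (EFin \o (fun t => bX' t w i 0%R)).
  by apply: (integrableS _ _ _ (ib' i)) => //; exact: subset_itvl.
move: s0; rewrite le_eqVlt => /predU1P[s0|s0].
  rewrite (_ : (_ - _)%R = 0%R); first by rewrite nsq0 mule_ge0.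
  by apply/matrixP => i j; rewrite !mxE -s0 set_itv1 !Rintegral_set1 subr0.
rewrite (_ : (_ - _)%R = \col_i (\int[mu]_(t in `[0%R, s]) (bX' t w - bX t w)%R i 0)%R); last first.
  apply/matrixP => i j; rewrite !mxE -RintegralB//.
  by apply: eq_Rintegral => t _; rewrite !mxE.
apply: le_trans (nsq_Rintegral_le (g := fun t => gapY (t, w)) s0 _ _) _.
- move=> i; have /measurable_int/measurable_EFinP m := int i.
  have /measurable_int/measurable_EFinP m' := int' i.
  rewrite (_ : (fun _ => _) = fun t => bX' t w i 0 - bX t w i 0)%R;
    last by apply/funext => t; rewrite !mxE.
  exact: measurable_funB.
- by move=> t ts; have [] := hgap t (sub sT ts).
by rewrite lee_wpmul2r ?lee_fin//; exact: clock0.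
Qed.

Lemma quad_var_clock : {ae P, forall w, forall t, t \in `[0%R, T] ->
  quad_var sX' sX t w <= clock t w}.
Proof.
apply: filterS coefficients_gap => w h t tT.
apply: ge0_le_integral_nomeas => s st; first by rewrite lee_fin nsq_ge0.
by have [] := h s (sub tT st).
Qed.

Let sup_dist t w := ereal_sup [set (nsq (X' s w - X s w))%:E | s in `[0%R, t]].

Let I_exists (b0 : coeff R d d 1) (s0 : coeff R d d d) (X0 : R -> {RV P >-> 'cV[R]_d}) :
  mkv_solution F B T x b0 s0 X0 -> exists2 I : R -> Omega -> 'cV[R]_d,
    ito_integral P F B T (fun t w => s0 t (X0 t w) (distribution P (X0 t))) I &
    {ae P, forall w, forall t, t \in `[0%R, T] ->
      X0 t w = (x + \col_i (\int[mu]_(r in `[0%R, t])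
        b0 r (X0 r w) (distribution P (X0 r)) i 0) + I t w)%R}.
Proof. by case. Qed.

(** The maximal inequality without localization asks for a finite expected clock; the moment bounds
    supply it. *)
Let mean_clock_fin t : (0 <= t <= T)%R -> \int[P]_w clock t w < +oo.
Proof.
move=> tT; apply: le_lt_trans (expected_gap_bound P hT mY cY mY' cY' (r / 4) (ltW c1_gt0) e0 tT) _.
have [M M0 hM] := solution_moment hF hB hT hX hg.
have [M' M'0 hM'] := mean_sqr_dist_bound.
have len (s : R) : (0 <= s)%R -> mu `[0%R, s]%classic = s%:E.
  move=> s0; rewrite lebesgue_measure_itv/= lte_fin.
  by move: s0; rewrite le_eqVlt => /predU1P[<-|s0]; rewrite ?ltxx// s0 -EFinD subr0.
have h1 : \int[mu]_(s in `[0%R, T]) mean_tail P Y (r / 4) s <= (M * T)%:E.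
  apply: (@le_trans _ _ (\int[mu]_(s in `[0%R, T]) M%:E)).
    apply: ge0_le_integral_nomeas => s sT; first exact: mean_tail_ge0.
    apply: le_trans (hM s sT); apply: ae_ge0_le_integral_nomeas => //.
    - apply/measurable_EFinP; apply: measurable_nsq => i j; rewrite (ord1 j).
      exact: measurable_solution.
    - by move=> w _; rewrite lee_fin tail_ge0.
    - by move=> w _; rewrite lee_fin nsq_ge0.
    by apply: filterS XY => w h _; rewrite lee_fin h// tail_le.
  by rewrite integral_cst//= len// -EFinM.
have h2 : \int[mu]_(s in `[0%R, t]) zeta s <= (M' * t)%:E.
  case/andP: tT => t0 tT.
  apply: (@le_trans _ _ (\int[mu]_(s in `[0%R, t]) M'%:E)).
    apply: ge0_le_integral_nomeas => s st; first exact: mean_sqr_dist_ge0.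
    by apply: hM'; apply: sub st; rewrite in_itv/= t0.
  by rewrite integral_cst//= len// -EFinM.
apply: (@le_lt_trans _ _ (c1%:E * ((e * T)%:E + (M * T)%:E + 2%:E * (M' * t)%:E))).
  rewrite lee_wpmul2l ?lee_fin ?(ltW c1_gt0)//.
  by apply: leeD; [exact: leeD|rewrite lee_wpmul2l].
exact: ltry.
Qed.

(** The drifts are compared pathwise by Cauchy-Schwarz in time, the stochastic integrals in mean by
    the maximal inequality; both are controlled by the same [clock], whose expectation is already
    estimated. *)
Lemma expected_sup_dist t : (0 <= t <= T)%R ->
  \int[P]_w sup_dist t w <=
  c2%:E * ((e * T)%:E + \int[mu]_(s in `[0%R, T]) mean_tail P Y (r / 4) s +
           2%:E * \int[mu]_(s in `[0%R, t]) zeta s).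
Proof.
move=> htT; have /andP[t0 tT] := htT.
have tin : t \in `[0%R, T] by rewrite in_itv.
have [I hI XE] := I_exists hX; have [I' hI' XE'] := I_exists hX'.
pose J t w := ereal_sup [set (nsq (I' s w - I s w))%:E | s in `[0%R, t]].
have J0 w : 0 <= J t w.
  apply: le_trans (_ : (nsq (I' 0%R w - I 0%R w))%:E <= _); first by rewrite lee_fin nsq_ge0.
  by apply: ereal_sup_ubound; exists 0%R => //=; rewrite in_itv/= lexx.
have mJ : measurable_fun setT (J t).
  apply: (measurable_path_sup hF t0).
    move=> s st; apply: measurable_nsq => i j.
    rewrite (_ : (fun _ => _) = fun w => I' s w i j - I s w i j)%R;
      last by apply/funext => w; rewrite !mxE.
    apply: measurable_funB; first exact: (ito_measurable hF i j hI' (sub tin st)).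
    exact: (ito_measurable hF i j hI (sub tin st)).
  have [_ _ k1 _] := hI'; have [_ _ k2 _] := hI.
  apply: filterS2 k1 k2 => w k1 k2.
  apply: (@continuous_subspaceW _ _ _ `[0%R, T]); first exact: subset_itvl.
  apply: within_continuous_nsq => i j.
  rewrite (_ : (fun s => _) = (fun s => I' s w i j - I s w i j)%R);
    last by apply/funext => s; rewrite !mxE.
  have {}k1 := @within_continuous_coord R _ _ _ _ i j k1.
  have {}k2 := @within_continuous_coord R _ _ _ _ i j k2.
  by move=> s; apply: cvgB; [exact: k1|exact: k2].
apply: (@le_trans _ _ (\int[P]_w ((2 * T)%:E * clock t w + 2%:E * J t w))).
  apply: ae_ge0_le_integral_nomeas => //.
  - by apply: emeasurable_funD; exact: emeasurable_funM.
  - move=> w _; apply: le_trans (_ : (nsq (X' 0%R w - X 0%R w))%:E <= _).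
      by rewrite lee_fin nsq_ge0.
    by apply: ereal_sup_ubound; exists 0%R => //=; rewrite in_itv/= lexx.
  - by move=> w _; rewrite adde_ge0// mule_ge0// lee_fin mulr_ge0.
  apply: filterS3 XE XE' drift_diff => w XE XE' hD _.
  apply: ub_ereal_sup => _ [s st <-].
  have sT := sub tin st.
  have Is : (nsq (I' s w - I s w))%:E <= J t w by apply: ereal_sup_ubound; exists s.
  apply: (@le_trans _ _ (2%:E * (T%:E * clock s w) + 2%:E * (nsq (I' s w - I s w))%:E)).
    have := hD s sT; set D' := (\col_i _)%R; set D := (\col_i _)%R => hDs.
    apply: (@le_trans _ _ (2%:E * (nsq (D' - D))%:E + 2%:E * (nsq (I' s w - I s w))%:E)).
      rewrite -!EFinM -EFinD lee_fin (_ : X' s w - X s w = (D' - D) + (I' s w - I s w))%R.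
        by rewrite -mulrDr; exact: nsqD.
      rewrite XE// XE'// -/D -/D'; clearbody D D'.
      by apply/matrixP => i j; rewrite !mxE; ring.
    by rewrite leeD2r// lee_wpmul2l.
  apply: leeD; last by rewrite lee_wpmul2l.
  rewrite EFinM -muleA lee_wpmul2l// lee_wpmul2l ?lee_fin//; apply: clock_mono.
  by move: st; rewrite /= in_itv/= => /andP[].
rewrite ge0_integralD//; last 4 first.
- by move=> w _; rewrite mule_ge0// lee_fin mulr_ge0.
- exact: emeasurable_funM.
- by move=> w _; rewrite mule_ge0.
- exact: emeasurable_funM.
rewrite !ge0_integralZl ?lee_fin ?mulr_ge0//.
have Vclock : \int[P]_w quad_var sX' sX t w <= \int[P]_w clock t w.
  apply: ae_ge0_le_integral_nomeas => //.
    by move=> w _; exact: quad_var_ge0.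
  by apply: filterS quad_var_clock => w h _; exact: h.
have hJ := ito_sup_estimate hF hB T0 hI' hI htT (le_lt_trans Vclock (mean_clock_fin htT)).
apply: (@le_trans _ _ ((2 * T + 2 * ito_constant R d)%:E * \int[P]_w clock t w)).
  have combine (q : R) (u v : \bar R) : (0 <= q)%R -> 0 <= u -> v <= q%:E * u ->
      (2 * T)%:E * u + 2%:E * v <= (2 * T + 2 * q)%:E * u.
    move=> q0 u0 vq; rewrite [(2 * T + _)%:E]EFinD ge0_muleDl ?lee_fin ?mulr_ge0//.
    by rewrite leeD2l// [(2 * q)%:E]EFinM -muleA lee_wpmul2l.
  apply: combine; [exact: ito_constant_ge0|by apply: integral_ge0 => w _; exact: clock0|].
  apply: le_trans hJ _; apply: lee_wpmul2l; last exact: Vclock.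
  by rewrite lee_fin ito_constant_ge0.
rewrite [c2%:E]EFinM -muleA lee_wpmul2l//.
  by rewrite lee_fin addr_ge0// mulr_ge0// ito_constant_ge0.
exact: (expected_gap_bound P hT mY cY mY' cY' (r / 4) (ltW c1_gt0) e0 htT).
Qed.

(** Gronwall's lemma is applied to the mean squared distance, which the expected supremum dominates;
    its bound is then inserted back under the integral to recover the supremum. *)
Lemma expected_sup_dist_le :
  \int[P]_w sup_dist T w <=
  stability_constant%:E * ((e * T)%:E + \int[mu]_(s in `[0%R, T]) mean_tail P Y (r / 4) s).
Proof.
have TT : (0 <= T <= T)%R by rewrite T0 lexx.
set tau := \int[mu]_(s in _) mean_tail _ _ _ _.
have tau0 : 0 <= tau by apply: integral_ge0 => s _; exact: mean_tail_ge0.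
have := leey tau; rewrite le_eqVlt => /predU1P[tauoo|tau_fin].
  by rewrite tauoo addey// gt0_muley ?leey// lte_fin stability_constant_gt0.
have [M M0 hM] := mean_sqr_dist_bound.
have tauE : tau = (fine tau)%:E by rewrite fineK// ge0_fin_numE.
pose a := (c2 * (e * T + fine tau))%R.
have a0 : (0 <= a)%R by rewrite mulr_ge0 ?(ltW c2_gt0)// addr_ge0 ?fine_ge0// mulr_ge0.
pose c := (2 * c2)%R; have c0 : (0 < c)%R by rewrite mulr_gt0.
have est t : (0 <= t <= T)%R ->
    \int[P]_w sup_dist t w <= a%:E + c%:E * \int[mu]_(s in `[0%R, t]) zeta s.
  move=> tT; apply: le_trans (expected_sup_dist tT) _.
  rewrite -/tau tauE -EFinD.
  have Z0 : 0 <= \int[mu]_(s in `[0%R, t]) zeta s.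
    by apply: integral_ge0 => s _; exact: mean_sqr_dist_ge0.
  rewrite ge0_muleDr//; last 2 first.
  - by rewrite lee_fin addr_ge0 ?fine_ge0// mulr_ge0.
  - by rewrite mule_ge0.
  by rewrite muleA -!EFinM [(c2 * 2)%R]mulrC.
have mz : measurable_fun `[0%R, T] zeta.
  by apply: measurable_funTS; exact: measurable_mean_sqr_dist.
have zM s : s \in `[0%R, T] -> 0 <= zeta s <= M%:E.
  by move=> sT; rewrite mean_sqr_dist_ge0 hM.
have hz := gronwall a0 c0 T0 mz zM.
have {}hz t : t \in `[0%R, T] -> zeta t <= (2 * a * expR (2 * c * t))%:E.
  apply: hz => s sT; apply: le_trans (est s _); last by move: sT; rewrite in_itv.
  rewrite mean_sqr_distE//; apply: ge0_le_integral_nomeas => w _.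
    by rewrite lee_fin nsq_ge0.
  apply: ereal_sup_ubound; exists s => //=.
  by move: sT; rewrite !in_itv/= lexx andbT => /andP[].
apply: le_trans (est T TT) _.
apply: (@le_trans _ _ (a%:E + c%:E * (2 * a * expR (2 * c * T) * T)%:E)).
  rewrite leeD2l// lee_wpmul2l ?lee_fin ?(ltW c0)//.
  apply: (@le_trans _ _ (\int[mu]_(s in `[0%R, T]) (2 * a * expR (2 * c * T))%:E)).
    apply: ge0_le_integral_nomeas => s sT; first exact: mean_sqr_dist_ge0.
    apply: le_trans (hz s sT) _.
    rewrite lee_fin; apply: ler_wpM2l; first by rewrite mulr_ge0.
    rewrite ler_expR; apply: ler_wpM2l; first by rewrite mulr_ge0// ltW.
    by move: sT; rewrite /= in_itv/= => /andP[].
  by rewrite integral_cst//= lebesgue_measure_itv/= lte_fin hT -EFinD subr0 -EFinM.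
rewrite tauE -EFinM -!EFinD -EFinM lee_fin /stability_constant /a /c.
set E := expR _; rewrite le_eqVlt; apply/orP; left; apply/eqP; ring.
Qed.

End with_version.
End two_solutions.

(** * Vanishing tails and the conclusion *)

Section tails.
Context (d0 : measure_display) (Omega : measurableType d0) (R : realType).
Context (P : probability Omega R) (d : nat).
Context (Y : R -> Omega -> 'cV[R]_d).
Context (mY : forall s i, measurable_fun setT (fun w => Y s w i 0)).
Context (cY : forall w i, continuous (fun s => Y s w i 0)).
Context (T M : R) (hM : forall s, s \in `[0, T] -> (\int[P]_w (nsq (Y s w))%:E <= M%:E)%E).
Local Notation mu := (@lebesgue_measure R).
Local Open Scope ereal_scope.

Let mn s : measurable_fun setT (fun w => (nsq (Y s w))%:E).
Proof. by apply/measurable_EFinP; exact: measurable_nsq_process. Qed.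

Lemma mean_tail_cvg s : s \in `[0%R, T] -> mean_tail P Y n%:R s @[n --> \oo] --> 0.
Proof.
move=> sT.
have mt r : measurable_fun setT (fun w => (tail r (Y s w))%:E).
  apply/measurable_EFinP; apply: measurable_fun_ifT => //; last exact: measurable_nsq_process.
  by apply: measurable_fun_ler => //; exact: measurable_nsq_process.
have ig : P.-integrable setT (fun w => (nsq (Y s w))%:E).
  apply/integrableP; split; first exact: mn.
  under eq_integral do rewrite gee0_abs ?lee_fin ?nsq_ge0//.
  exact: le_lt_trans (hM sT) (ltry _).
have [||||_ _] := @dominated_convergence _ _ R P setT measurableT
  (fun n w => (tail n%:R (Y s w))%:E) (cst 0) (fun w => (nsq (Y s w))%:E) _ _ _ ig _.
- by move=> n; exact: mt.
- exact: measurable_cst.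
- apply: aeW => w _; apply/cvg_ballP => e e0.
  exists (Num.truncn (nsq (Y s w))).+1 => // n /= hn; rewrite /tail ifT; first exact: ballxx.
  by apply: ltW; apply: lt_le_trans (truncnS_gt _) _ => //; rewrite ler_nat.
- by apply: aeW => w n _; rewrite gee0_abs ?lee_fin ?tail_ge0// tail_le.
by rewrite integral0.
Qed.

(** Dominated convergence in time, after the same in chance at each time: |Y_s|^2 dominates inside
    the expectation, and the uniform moment bound [M] dominates in time. *)
Lemma integral_mean_tail_cvg :
  \int[mu]_(s in `[0%R, T]) mean_tail P Y n%:R s @[n --> \oo] --> 0.
Proof.
have [|||||_ _] := @dominated_convergence _ _ R mu `[0%R, T]%classic (measurable_itv _)
  (fun n s => mean_tail P Y n%:R s) (cst 0) (cst M%:E) _ _ _ _ _.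
- by move=> n; apply: measurable_funTS; exact: measurable_mean_tail.
- exact: measurable_cst.
- by apply: aeW => s sT; exact: mean_tail_cvg.
- apply/integrableP; split; first exact: measurable_cst.
  rewrite integral_cst//= lebesgue_measure_itv/= lte_fin.
  by case: ifPn => _; rewrite ?mule0 ?ltry// -EFinD -EFinM ltry.
- apply: aeW => s n sT; rewrite gee0_abs ?mean_tail_ge0//; apply: le_trans (hM sT).
  by apply: ge0_le_integral_nomeas => w _; rewrite lee_fin ?tail_ge0 ?tail_le.
by rewrite integral0.
Qed.

End tails.

Lemma cvg_ereal0 (R : realType) (u : nat -> \bar R) : (forall n, 0 <= u n)%E ->
  (forall e : R, 0 < e -> \forall n \near \oo, (u n <= e%:E)%E) -> u n @[n --> \oo] --> 0%E.
Proof.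
move=> u0 ue; apply/fine_cvgP; split.
  apply: filterS (ue 1 ltr01) => n un.
  by rewrite ge0_fin_numE// (le_lt_trans un) ?ltry.
apply/cvgrPdist_le => e e0; apply: filterS (ue e e0) => n un /=.
rewrite sub0r normrN ger0_norm ?fine_ge0//.
by rewrite -lee_fin fineK// ge0_fin_numE// (le_lt_trans un) ?ltry.
Qed.

Theorem theorem6p1 (d0 : measure_display) (Omega : measurableType d0)
  (R : realType) (P : probability Omega R) (F : R -> set (set Omega))
  (hF : usual_filtration P F)
  (d : nat) (B : R -> Omega -> 'cV[R]_d) (hB : brownian_motion P F B)
  (T : R) (hT : 0 < T) (x : 'cV[R]_d)
  (b : coeff R d d 1) (sigma : coeff R d d d)
  (bn : nat -> coeff R d d 1) (sigman : nat -> coeff R d d d)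
  (hb : admissible T b sigma)
  (hbn : forall n, admissible T (bn n) (sigman n))
  (h_i : exists2 C : R, 0 < C & forall n y mu, P2 mu ->
    (ereal_sup [set (enorm (bn n t y mu) + enorm (sigman n t y mu))%:E
               | t in `[0%R, T]] <= (C * (1 + enorm y))%:E)%E)
  (h_ii : forall K : set 'cV[R]_d, compact K -> K !=set0 ->
    ereal_sup [set ereal_sup [set ereal_sup
        [set (enorm (bn n t y mu - b t y mu)
              + enorm (sigman n t y mu - sigma t y mu))%:E
        | mu in @P2 R d] | y in K] | t in `[0%R, T]] @[n --> \oo] --> 0%E)
  (X : R -> {RV P >-> 'cV[R]_d}) (Xn : nat -> R -> {RV P >-> 'cV[R]_d})
  (hX : mkv_solution F B T x b sigma X)
  (hXn : forall n, mkv_solution F B T x (bn n) (sigman n) (Xn n)) :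
  (\int[P]_w ereal_sup [set (enorm (Xn n t w - X t w : 'cV[R]_d) ^+ 2)%:E
                       | t in `[0%R, T]])%E @[n --> \oo] --> 0%E.
Proof.
have T0 := ltW hT.
have [_ _ hg [L L0 [lb ls]]] := hb.
have [C C0 hC] := hg; have [C' C'0 hC'] := h_i.
have [_ _ cX _ _] := hX.
have [Y [mY cY XY]] := regular_version T0 (measurable_solution X) cX.
(* One growth constant for the limit coefficients and for all perturbed ones; the growth bound
   uniform in n enters here, in the squared form of [growth_sqr]. *)
pose K := 2 * (C + C') ^+ 2.
have K0 : 0 < K by rewrite mulr_gt0// exprn_gt0// addr_gt0.
have hK n t y nu : t \in `[0, T] -> P2 nu ->
    [/\ nsq (b t y nu) <= K * (1 + nsq y), nsq (sigma t y nu) <= K * (1 + nsq y),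
        nsq (bn n t y nu) <= K * (1 + nsq y) & nsq (sigman n t y nu) <= K * (1 + nsq y)].
  move=> tT hnu; have CC0 : 0 <= C + C' by rewrite addr_ge0// ltW.
  have y0 := enorm_ge0 y.
  have h : enorm (b t y nu) + enorm (sigma t y nu) <= (C + C') * (1 + enorm y).
    by apply: le_trans (hC t y nu tT hnu) _; rewrite ler_wpM2r ?addr_ge0// lerDl ltW.
  have h' : enorm (bn n t y nu) + enorm (sigman n t y nu) <= (C + C') * (1 + enorm y).
    apply: (@le_trans _ _ (C' * (1 + enorm y))); last first.
      by rewrite ler_wpM2r ?addr_ge0// lerDr ltW.
    rewrite -lee_fin; apply: le_trans (hC' n y nu hnu).
    by apply: ereal_sup_ubound; exists t.
  rewrite -!enorm_sqr; split.
  - by apply: (growth_sqr (enorm_ge0 _) (enorm_ge0 _) y0 CC0); rewrite addrC; exact: h.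
  - exact: (growth_sqr (enorm_ge0 _) (enorm_ge0 _) y0 CC0 h).
  - by apply: (growth_sqr (enorm_ge0 _) (enorm_ge0 _) y0 CC0); rewrite addrC; exact: h'.
  - exact: (growth_sqr (enorm_ge0 _) (enorm_ge0 _) y0 CC0 h').
have [M M0 hM] := solution_moment hF hB hT hX hg.
have hMY s : s \in `[0, T] -> (\int[P]_w (nsq (Y s w))%:E <= M%:E)%E.
  move=> sT; apply: le_trans (hM s sT).
  apply: ae_ge0_le_integral_nomeas => //.
  - apply/measurable_EFinP; apply: measurable_nsq => i j; rewrite (ord1 j).
    exact: measurable_solution.
  - by move=> w _; rewrite lee_fin nsq_ge0.
  - by move=> w _; rewrite lee_fin nsq_ge0.
  by apply: filterS XY => w h _; rewrite h.
pose A := stability_constant d T L K.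
have A0 : 0 < A by exact: stability_constant_gt0.
under eq_fun => n do under eq_integral => w _ do under eq_imagel => t _ do rewrite enorm_sqr.
apply: cvg_ereal0 => [n|e e0].
  apply: integral_ge0 => w _; apply: (@le_trans _ _ (nsq (Xn n 0 w - X 0 w))%:E).
    by rewrite lee_fin nsq_ge0.
  by apply: ereal_sup_ubound; exists 0 => //=; rewrite in_itv/= lexx.
(* Chosen so that A (e' T + e') = e / 2: the first e' bounds the gap between the coefficients, the
   second the tail. *)
pose e' := e / (2 * A * (T + 1)).
have T1 : 0 < T + 1 by rewrite addr_gt0.
have e'0 : 0 < e' by apply: divr_gt0 => //; apply: mulr_gt0 => //; exact: mulr_gt0.
have [k0 _ hk] : \forall n \near \oo,
    (\int[lebesgue_measure]_(s in `[0%R, T]) mean_tail P Y n%:R s <= e'%:E)%E.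
  have nh : nbhs (0%E : \bar R) [set y | (y < e'%:E)%E].
    by apply: open_nbhs_nbhs; split; [exact: open_ereal_lt_ereal|rewrite /= lte_fin].
  have [N _ hN] := integral_mean_tail_cvg mY cY hMY nh.
  by exists N => // n /hN /= /ltW.
(* The radius is fixed by the tail of the limit solution, before n is chosen. The factor 4 makes r /
   4 an integer level past [k0]. *)
pose r : R := 4 * k0.+1%:R.
have r1 : 1 <= r by rewrite /r -natr1; have := ler0n R k0; lra.
have r4 : r / 4 = k0.+1%:R by rewrite /r mulrAC divff// mul1r.
apply: filterS (uniform_coeff_gap r h_ii e'0) => n hn.
have [_ _ hgn _] := hbn n; have [_ _ cXn _ _] := hXn n.
have [Y' [mY' cY' XY']] := regular_version T0 (measurable_solution (Xn n)) cXn.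
have := expected_sup_dist_le hF hB hT hX hg mY cY XY L0 K0 lb ls (hXn n) hgn (ltW e'0) r1
  (hK n) hn mY' cY' XY'.
move=> /le_trans; apply; rewrite r4.
apply: (@le_trans _ _ (A%:E * ((e' * T)%:E + e'%:E))%E).
  by rewrite lee_wpmul2l ?lee_fin ?(ltW A0)// leeD2l// hk/=.
rewrite -EFinD -EFinM lee_fin (_ : A * _ = e / 2); first by lra.
by rewrite /e'; field; rewrite (gt_eqF A0) (gt_eqF T1).
Qed.
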